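(* Let $A>0$ be given, and suppose that the statements $EH(N^{\theta}(\log N)^{2A+8})$ and $EH_{\mu}(N^{1-\theta})$ (defined in the context) are both true for some constant $0<\theta<1$. For a positive integer $N$ put $\widetilde r(N)=\sum_{n<N}\Lambda(n)\Lambda(N-n)$. Then for all positive even integers $N$, \[ \widetilde r(N)\ \ge\ \mathfrak S(N)\,(1-\mathcal A(N))\,N+O\left(\frac{N}{(\log N)^{A}}\right), \] where \[ \mathfrak S(N)=2\prod_{p>2}\left(1-\frac1{(p-1)^2}\right)\prod_{\substack{p\mid N\\ p>2}}\left(1+\frac1{p-2}\right),\qquad \mathcal A(N)=\prod_{\substack{p\nmid N\\ p>2}}\left(1-\frac1{p(p-1)}\right) \] (products over primes $p$), and the implicit constant depends only on $A$ and $\theta$. Moreover, if $EH(N^{\theta}(\log N)^{2A+8})$ and $EH_{\mu}(N^{1-\theta})$ are both true for the given $A>0$ and some constant $0<\theta<1$, then the following two assertions, as $N\to\infty$ through even integers, are equivalent: (i) $\widetilde r(N)\sim\mathfrak S(N)N$; (ii) $\sum_{n<N}\Lambda(n)\mu(N-n)=o(N)$.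
   Context: $\Lambda$ is the von Mangoldt function, $\mu$ the Möbius function, $\phi$ Euler's totient function; sums over $n$ run over positive integers. For real constants $\theta$ and $C$, $EH(N^{\theta}(\log N)^{C})$ denotes the following statement (the Elliott-Halberstam conjecture with this level): for every $A'>0$ there is a constant $K$ such that for all integers $N\ge 2$, \[ \sum_{q\le N^{\theta}(\log N)^{C}}\ \max_{y\le N}\ \max_{(a,q)=1}\left|\sum_{\substack{n\le y\\ n\equiv a\ (\mathrm{mod}\ q)}}\Lambda(n)-\frac{y}{\phi(q)}\right|\le K\frac{N}{(\log N)^{A'}} . \] For a real constant $\vartheta$, $EH_{\mu}(N^{\vartheta})$ denotes the following statement: for every $A'>0$ there is a constant $K$ such that for all integers $N\ge 2$, \[ \sum_{q\le N^{\vartheta}}\ \max_{y<N}\ \max_{(a,q)=1}\left|\sum_{\substack{n\le y\\ n\equiv a\ (\mathrm{mod}\ q)}}\Lambda(n)\mu(N-n)-\frac1{\phi(q)}\sum_{n\le y}\Lambda(n)\mu(N-n)\right|\le K\frac{N}{(\log N)^{A'}} . \] Here $q$ runs over positive integers, $y$ over positive real numbers in the indicated range (maxima over $y$ are understood as suprema), and $a$ over integers coprime to $q$. *)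

(* Defs.v *)
From HB Require Import structures.
From mathcomp Require Import all_boot all_order all_algebra.
From mathcomp Require Import all_classical all_reals all_analysis.

Set Implicit Arguments.
Unset Strict Implicit.
Unset Printing Implicit Defensive.

Import Order.TTheory GRing.Theory Num.Theory.
Import numFieldNormedType.Exports.

Local Open Scope classical_set_scope.
Local Open Scope ring_scope.

(* [primes n] lists the distinct prime divisors of [n], so it is a singleton
   [:: p] exactly when [n] is a power p ^ k with k >= 1. *)
Definition vonMangoldt {R : realType} (n : nat) : R :=
  if primes n is [:: p] then ln p%:R else 0.

Definition squarefree (n : nat) : bool :=
  (0 < n)%N && all (fun p => ~~ (p ^ 2 %| n)%N) (primes n).

Definition moebius {R : realType} (n : nat) : R :=
  if squarefree n then (-1) ^+ size (primes n) else 0.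

(* The positive integers n <= y are the n with 1 <= n < (Num.truncn y).+1:
   for y >= 0, [Num.truncn y] is the integer part of y. *)
Definition sum_upto {R : realType} (y : R) (F : nat -> R) : R :=
  \sum_(1 <= n < (Num.truncn y).+1) F n.

Definition sum_upto_mod {R : realType} (y : R) (a : int) (q : nat)
    (F : nat -> R) : R :=
  \sum_(1 <= n < (Num.truncn y).+1 | (n%:Z == a %[mod q%:Z])%Z) F n.

(* The suprema below are taken over nonempty bounded sets of reals (for q >= 1
   and N >= 2), so that the junk value of [sup] is never used. *)
Definition EH {R : realType} (theta C : R) : Prop :=
  forall A' : R, 0 < A' -> exists K : R, forall N : nat, (2 <= N)%N ->
    sum_upto (N%:R `^ theta * ln N%:R `^ C) (fun q =>
      sup [set sup [set `| sum_upto_mod y a q vonMangoldt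
                           - y / (totient q)%:R |
                    | a in [set a : int | coprimez a q%:Z]]
           | y in [set y : R | 0 < y <= N%:R]])
    <= K * (N%:R / ln N%:R `^ A').

Definition EHmu {R : realType} (vartheta : R) : Prop :=
  forall A' : R, 0 < A' -> exists K : R, forall N : nat, (2 <= N)%N ->
    let LM := fun n : nat => vonMangoldt n * moebius (N - n)%N in
    sum_upto (N%:R `^ vartheta) (fun q =>
      sup [set sup [set `| sum_upto_mod y a q LM
                           - (totient q)%:R^-1 * sum_upto y LM |
                    | a in [set a : int | coprimez a q%:Z]]
           | y in [set y : R | 0 < y < N%:R]])
    <= K * (N%:R / ln N%:R `^ A').

Definition goldbach_r {R : realType} (N : nat) : R :=
  \sum_(1 <= n < N) vonMangoldt n * vonMangoldt (N - n)%N.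

Definition mangoldt_moebius {R : realType} (N : nat) : R :=
  \sum_(1 <= n < N) vonMangoldt n * moebius (N - n)%N.

Definition prime_prod {R : realType} (P : pred nat) (F : nat -> R) : R :=
  limn (fun m => \prod_(0 <= p < m | prime p && P p) F p).

Definition singular_series {R : realType} (N : nat) : R :=
  2 * prime_prod (fun p => 2 < p)%N (fun p => 1 - ((p%:R - 1) ^+ 2)^-1)
    * \prod_(p <- primes N | (2 < p)%N) (1 + (p%:R - 2)^-1).

Definition calA {R : realType} (N : nat) : R :=
  prime_prod (fun p => ~~ (p %| N) && (2 < p))%N
    (fun p => 1 - (p%:R * (p%:R - 1))^-1).

Definition even_oo : set_system nat := within [set N | ~~ odd N] \oo.

#[global] Instance even_oo_filter : ProperFilter even_oo.
Proof.
apply: Build_ProperFilter_ex => P [n _ nP].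
by exists n.*2; apply: nP; rewrite /= ?odd_double// -addnn leq_addr.
Qed.

(* Main.v *)
(** Write [m = N - n] and split [- Lambda m = \sum_(d %| m) mu d * ln d] at
    [d = N^theta], having first discarded the [n] not coprime to [N] and the [m]
    that are not squarefree, which costs [O(sqrt N * (ln N)^3)].

    For [d <= N^theta] insert [mu m ^+ 2 = \sum_(k ^ 2 %| m) mu k], truncated at
    [k <= (ln N)^(A+4)]; the level [N^theta * (ln N)^(2A+8)] of EH is exactly what
    the moduli [lcm(d, k ^ 2)] require.  The main term is governed by the sums of
    [mu e / phi e] and [mu e * ln e / phi e] over [e] coprime to [k * N], which tend
    to [0] and to minus a singular constant faster than any power of [ln N]; only
    [k = 1] survives and this range contributes [S(N) * N].

    For [d > N^theta] put [d = m / e], so [e < N^(1-theta)] and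
    [mu m * mu e = mu d]; EH_mu and partial summation turn this range into
    [- S(N) * \sum_n Lambda n * mu (N - n)].  Hence
      [r(N) = S(N) * (N - \sum_n Lambda n * mu (N - n)) + O(N / (ln N)^A)].
    The lower bound follows from [mu <= mu ^+ 2] and
    [\sum_n Lambda n * mu (N - n) ^+ 2 = calA(N) * N + o(N)], and the
    equivalence from [S(N) >= 1].

    The prime number theorem with arbitrary log-power savings, which feeds the
    Moebius sums above, is itself the modulus [q = 1] of EH. *)

Require Import Defs.
From HB Require Import structures.
From mathcomp Require Import all_boot all_order all_algebra.
From mathcomp Require Import all_classical all_reals all_analysis.
From mathcomp Require Import zify ring lra.
From mathcomp Require cyclic.

Set Implicit Arguments.
Unset Strict Implicit.
Unset Printing Implicit Defensive.

Import Order.TTheory GRing.Theory Num.Theory.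
Import numFieldNormedType.Exports.

Local Open Scope classical_set_scope.
Local Open Scope ring_scope.

(** * Arithmetic functions *)

Section DivisorSums.
Context {V : nmodType}.

(** Two obstacles shape the work. EH and EH_mu only reach residue classes prime to the modulus, and
    the class in play is [N] modulo [q]; once [n] is coprime to [N], every [q] dividing [N - n] is
    coprime to [N]. The price is that each Moebius sum carries a coprimality condition to a modulus
    [Q] as large as a power of its length, so all estimates must be uniform in [Q <= x ^ j]. They
    are derived elementarily: the function [mu n * ln n], as the Dirichlet convolution of [- mu] and
    [Lambda], turns Mertens' formula into cancellation in the sum of [mu n / n]; the convolution of
    [mu] with 1 then evaluates the sum with a logarithm; and writing [e / phi e] as the sum of
    [1 / phi d] over [d] dividing [e] passes to the weights [1 / phi e]. Constants: truncating at
    [k <= K] costs [N * (ln N) ^ 4 / K], hence [K] near [(ln N) ^ (A + 4)]. The bound available for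
    the singular series is [O(ln N)], so in the lower bound the Moebius sum is estimated with
    exponent [A + 1]. *)

Lemma eq_sum_nat (m n : nat) (P : pred nat) (F G : nat -> V) :
  (forall i, (m <= i < n)%N -> P i -> F i = G i) ->
  \sum_(m <= i < n | P i) F i = \sum_(m <= i < n | P i) G i.
Proof.
move=> FG; rewrite big_mkcond [RHS]big_mkcond; apply: eq_big_nat => i imn.
by case: ifP => // /FG; apply.
Qed.

Lemma sum_multiples (d x : nat) (f : nat -> V) : (0 < d)%N ->
  \sum_(1 <= n < x.+1 | (d %| n)%N) f n
  = \sum_(1 <= e < (x %/ d).+1) f (d * e)%N.
Proof.
move=> d0; elim: x => [|x IH].
  by rewrite div0n !big_geq.
rewrite big_mkcond big_nat_recr //= -big_mkcond IH divnS //.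
case: ifPn => dx; last by rewrite add0n addr0.
rewrite add1n [RHS]big_nat_recr //=; congr (_ + f _).
have := divnK dx; rewrite divnS // dx add1n => <-.
by rewrite mulnC.
Qed.

Lemma sum_divisors_widen (n x : nat) (f : nat -> V) : (0 < n <= x)%N ->
  \sum_(1 <= d < x.+1 | (d %| n)%N) f d = \sum_(1 <= d < n.+1 | (d %| n)%N) f d.
Proof.
move=> /andP[n0 nx].
rewrite (big_cat_nat (n := n.+1)) //= [X in _ + X]big1_seq ?addr0 // => d.
rewrite mem_index_iota => /and3P[dn nd _].
by have := dvdn_leq n0 dn; rewrite leqNgt nd.
Qed.

(** Both sides run over the pairs [(d, e)] with [d * e <= x]. Dirichlet convolutions are summed in
    this way throughout. *)
Lemma hyperbola (x : nat) (F : nat -> nat -> V) :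
  \sum_(1 <= n < x.+1) \sum_(1 <= d < n.+1 | (d %| n)%N) F d (n %/ d)%N
  = \sum_(1 <= d < x.+1) \sum_(1 <= e < (x %/ d).+1) F d e.
Proof.
transitivity (\sum_(1 <= n < x.+1) \sum_(1 <= d < x.+1 | (d %| n)%N)
                 F d (n %/ d)%N).
  apply: eq_big_nat => n /andP[n0 nx].
  by rewrite (@sum_divisors_widen n x) // n0 -ltnS.
under eq_bigr do rewrite big_mkcond /=.
rewrite exchange_big /=; apply: eq_big_nat => d /andP[d0 dx].
rewrite -big_mkcond sum_multiples //; apply: eq_big_nat => e /andP[e0 _].
by rewrite mulKn.
Qed.

(** Both sides run over the pairs [(d, b)] with [d * b] dividing [n]. *)
Lemma sum_divisor_pairsC (n : nat) (F : nat -> nat -> V) : (0 < n)%N ->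
  \sum_(1 <= d < n.+1 | (d %| n)%N) \sum_(1 <= b < (n %/ d).+1 | (b %| n %/ d)%N) F d b
  = \sum_(1 <= b < n.+1 | (b %| n)%N) \sum_(1 <= d < (n %/ b).+1 | (d %| n %/ b)%N) F d b.
Proof.
move=> n0.
have step (G : nat -> nat -> V) : \sum_(1 <= d < n.+1 | (d %| n)%N)
      \sum_(1 <= b < (n %/ d).+1 | (b %| n %/ d)%N) G d b =
    \sum_(1 <= d < n.+1) \sum_(1 <= b < n.+1 | (d * b %| n)%N) G d b.
  rewrite big_mkcond; apply: eq_big_nat => d /andP[d0 dn].
  case: ifPn => dvd; last first.
    rewrite big1 // => b db; case/negP: dvd.
    by apply: dvdn_trans db; rewrite dvdn_mulr.
  rewrite -(@sum_divisors_widen (n %/ d) n); last first.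
    by rewrite leq_div andbT divn_gt0 // -ltnS.
  by apply: eq_bigl => b; rewrite dvdn_divRL // mulnC.
rewrite !step.
under eq_bigr do rewrite big_mkcond.
rewrite exchange_big_nat /=; apply: eq_bigr => b _; rewrite -big_mkcond.
by apply: eq_bigl => d; rewrite mulnC.
Qed.

(** A weak Moebius inversion: summation over divisors is injective. It yields [moebius_ln] by
    comparing divisor sums. *)
Lemma eq_of_sum_divisors_eq0 (W : zmodType) (f : nat -> W) :
  (forall n, (0 < n)%N -> \sum_(1 <= d < n.+1 | (d %| n)%N) f d = 0) ->
  forall n, (0 < n)%N -> f n = 0.
Proof.
move=> f0; elim/ltn_ind=> n IH n0.
have := f0 _ n0; rewrite big_mkcond big_nat_recr //= dvdnn.
rewrite big1_seq ?add0r // => d /=; rewrite mem_index_iota => /andP[d0 dn].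
by case: ifP => // _; apply: IH.
Qed.

End DivisorSums.

Section Arithmetic.
Context {R : realType}.
Implicit Types (n m p k : nat).
Local Notation Lambda := (@vonMangoldt R).
Local Notation mu := (@moebius R).

Lemma squarefree_coprimeM m n : coprime m n ->
  squarefree (m * n) = squarefree m && squarefree n.
Proof.
move=> cmn; rewrite /squarefree muln_gt0.
have [m0|] := posnP m; first by rewrite m0.
have [n0|] := posnP n; first by rewrite n0 /= andbF.
move=> n0 m0 /=; apply/allP/andP.
  move=> H; split; apply/allP => p pp.
    have /H : p \in primes (m * n) by rewrite primesM // pp.
    by apply: contra => /dvdn_trans -> //; rewrite dvdn_mulr.
  have /H : p \in primes (m * n) by rewrite primesM // pp orbT.
  by apply: contra => /dvdn_trans -> //; rewrite dvdn_mull.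
move=> [/allP Hm /allP Hn] p; rewrite primesM // => /orP[pp|pp].
  have /Hm := pp; apply: contra; rewrite Gauss_dvdl // coprimeXl //.
  move: pp; rewrite mem_primes => /and3P[_ _ pm].
  exact: coprime_dvdl pm cmn.
have /Hn := pp; apply: contra; rewrite Gauss_dvdr // coprimeXl //.
move: pp; rewrite mem_primes => /and3P[_ _ pm].
by apply: coprime_dvdl pm _; rewrite coprime_sym.
Qed.

Lemma primes_coprimeM m n : (0 < m)%N -> (0 < n)%N -> coprime m n ->
  perm_eq (primes (m * n)) (primes m ++ primes n).
Proof.
move=> m0 n0 cmn; apply: uniq_perm.
- exact: primes_uniq.
- rewrite cat_uniq !primes_uniq andbT /=; apply/hasPn => p pn.
  by apply: contraL cmn => pm; rewrite coprime_has_primes // negbK; apply/hasP; exists p.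
- by move=> p; rewrite mem_cat primesM.
Qed.

Lemma moebiusM m n : (0 < m)%N -> (0 < n)%N -> coprime m n ->
  mu (m * n) = mu m * mu n.
Proof.
move=> m0 n0 cmn; rewrite /moebius squarefree_coprimeM //.
rewrite (perm_size (primes_coprimeM m0 n0 cmn)) size_cat.
by case: (squarefree m); case: (squarefree n) => //=; rewrite ?mulr0 ?mul0r // exprD.
Qed.

Lemma squarefreeP n : (0 < n)%N ->
  reflect (forall k, (k ^ 2 %| n)%N -> k = 1%N) (squarefree n).
Proof.
move=> n0; rewrite /squarefree n0 /=; apply: (iffP allP) => H k.
  move=> k2; apply/eqP; apply: contraT => k1.
  have k0 : (0 < k)%N.
    by case: k k2 {k1} => //; rewrite exp0n // dvd0n => /eqP n00; rewrite n00 in n0.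
  have pk : pdiv k \in primes n.
    have k_gt1 : (1 < k)%N by rewrite ltn_neqAle eq_sym k1.
    rewrite mem_primes n0 pdiv_prime //=.
    by apply: dvdn_trans k2; rewrite expnS dvdn_mulr // pdiv_dvd.
  have /negP[] := H _ pk; apply: dvdn_trans k2.
  by rewrite dvdn_exp2r // pdiv_dvd.
rewrite mem_primes => /and3P[pk _ _]; apply/negP => /(H k) k1.
by rewrite k1 in pk.
Qed.

Lemma squarefree_gt0 n : squarefree n -> (0 < n)%N.
Proof. by case/andP. Qed.

Lemma dvdn_squarefree m n : (m %| n)%N -> squarefree n -> squarefree m.
Proof.
move=> mn sn; have n0 := squarefree_gt0 sn.
apply/squarefreeP => [|k k2]; first exact: dvdn_gt0 mn.
by apply: (squarefreeP n0 sn); apply: dvdn_trans mn.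
Qed.

Lemma squarefree_prime p : prime p -> squarefree p.
Proof.
move=> pp; rewrite /squarefree prime_gt0 // primes_prime //= andbT.
apply/negP => /(dvdn_leq (prime_gt0 pp)); apply/negP; rewrite -ltnNge.
by rewrite -[X in (X < _)%N]expn1 ltn_exp2l // prime_gt1.
Qed.

Lemma moebius1 : mu 1 = 1.
Proof. by []. Qed.

Lemma moebius_prime p : prime p -> mu p = -1.
Proof. by move=> pp; rewrite /moebius squarefree_prime // primes_prime //= expr1. Qed.

Lemma moebius_nsquarefree n : ~~ squarefree n -> mu n = 0.
Proof. by rewrite /moebius => /negbTE ->. Qed.

Lemma moebiusMp p n : prime p -> (0 < n)%N ->
  mu (p * n) = if (p %| n)%N then 0 else - mu n.
Proof.
move=> pp n0; have p0 := prime_gt0 pp; case: ifPn => pn.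
  apply: moebius_nsquarefree; apply/negP => /(squarefreeP _) H.
  have /H : (p ^ 2 %| p * n)%N by rewrite expnS expn1 dvdn_pmul2l.
  by rewrite muln_gt0 p0 n0 => /(_ isT) p1; rewrite p1 in pp.
by rewrite moebiusM // ?prime_coprime // moebius_prime // mulN1r.
Qed.

Lemma moebius_sqr n : mu n ^+ 2 = (squarefree n)%:R.
Proof. by rewrite /moebius; case: ifP => _; rewrite ?expr0n // sqrr_sign. Qed.

Lemma normr_moebius n : `|mu n| = (squarefree n)%:R.
Proof. by rewrite /moebius; case: ifP => _; rewrite ?normr0 // normr_sign. Qed.

Lemma normr_moebius_le1 n : `|mu n| <= 1.
Proof. by rewrite normr_moebius; case: squarefree. Qed.

(** With [p := pdiv n], each divisor [d] prime to [p] cancels against [p * d], since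
    [mu (p * d) = - mu d]; divisors that [p ^ 2] divides have [mu = 0]. *)
Lemma sum_moebius n : (0 < n)%N ->
  \sum_(1 <= d < n.+1 | (d %| n)%N) mu d = (n == 1%N)%:R.
Proof.
move=> n0; case: eqP => [->|/eqP n1].
  by rewrite big_mkcond big_nat1 /= moebius1.
set p := pdiv n; have pp : prime p by apply: pdiv_prime; rewrite ltn_neqAle eq_sym n1.
have pn : (p %| n)%N by exact: pdiv_dvd.
have p0 := prime_gt0 pp.
rewrite (bigID (fun d => p %| d)%N) /=.
have -> : \sum_(1 <= d < n.+1 | (d %| n)%N && (p %| d)%N) mu d =
    \sum_(1 <= e < (n %/ p).+1 | (e %| n %/ p)%N) mu (p * e).
  rewrite (eq_bigl (fun d => (p %| d) && (d %| n))%N); last by move=> d; rewrite andbC.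
  rewrite big_mkcondr (@sum_multiples _ p) // [RHS]big_mkcond.
  by apply: eq_bigr => e _; rewrite dvdn_divRL // mulnC.
rewrite (@eq_sum_nat R 1 (n %/ p).+1 _ _
  (fun e => if ~~ (p %| e)%N then - mu e else 0)); last first.
  by move=> e /andP[e0 _] _; rewrite moebiusMp //; case: (p %| e)%N.
rewrite -big_mkcondr /= sumrN.
suff -> : \sum_(1 <= e < (n %/ p).+1 | (e %| n %/ p)%N && ~~ (p %| e)%N) mu e =
   \sum_(1 <= e < n.+1 | (e %| n)%N && ~~ (p %| e)%N) mu e by rewrite addNr.
have := @sum_divisors_widen R (n %/ p) n (fun e => if ~~ (p %| e)%N then mu e else 0).
rewrite leq_div divn_gt0 // dvdn_leq // -!big_mkcondr => <- //.
apply: eq_bigl => e; case: (boolP (p %| e)%N) => pe; rewrite ?andbF // !andbT.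
by rewrite dvdn_divRL // Gauss_dvd ?pn ?andbT // coprime_sym prime_coprime.
Qed.

Lemma vonMangoldt_ge0 n : 0 <= Lambda n.
Proof.
rewrite /vonMangoldt; case En : (primes n) => [|p [|q s]] //.
have : p \in primes n by rewrite En mem_head.
by rewrite mem_primes => /and3P[/prime_gt0 p0 _ _]; rewrite ln_ge0 // ler1n.
Qed.

Lemma vonMangoldt_prime_power p k : prime p -> (0 < k)%N ->
  Lambda (p ^ k) = ln p%:R.
Proof. by move=> pp k0; rewrite /vonMangoldt primesX // primes_prime. Qed.

Lemma vonMangoldt_neq0 n : Lambda n != 0 ->
  exists p k, [/\ prime p, (0 < k)%N & n = (p ^ k)%N].
Proof.
rewrite /vonMangoldt; case En : (primes n) => [|p [|q s]]; rewrite ?eqxx // => _.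
have : p \in primes n by rewrite En mem_head.
rewrite mem_primes => /and3P[pp n0 pn].
exists p, (logn p n); split => //; first by rewrite logn_gt0 En mem_head.
rewrite [LHS](prod_prime_decomp n0) prime_decompE En /= big_cons big_nil /=.
by rewrite muln1.
Qed.

Lemma vonMangoldt1 : Lambda 1 = 0.
Proof. by []. Qed.

(** Induction from [n %/ p] to [n] with [p := pdiv n]: the only prime power dividing [n] but not
    [n %/ p] is the full power [p ^ logn p n], which contributes the missing [ln p]. *)
Lemma sum_vonMangoldt n : (0 < n)%N ->
  \sum_(1 <= d < n.+1 | (d %| n)%N) Lambda d = ln n%:R.
Proof.
elim/ltn_ind: n => n IH n0.
have [n_gt1|] := ltnP 1 n; last first.
  move=> n1; have -> : n = 1%N by apply/eqP; rewrite eqn_leq n1.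
  by rewrite big_mkcond big_nat1 /= ln1.
set p := pdiv n; have pp : prime p by exact: pdiv_prime.
have pn : (p %| n)%N by exact: pdiv_dvd.
set m := (n %/ p)%N.
have nE : n = (p * m)%N by rewrite mulnC divnK.
have m0 : (0 < m)%N by rewrite divn_gt0 ?prime_gt0 // dvdn_leq.
have mn : (m < n)%N by rewrite ltn_Pdiv // prime_gt1.
rewrite (bigID (fun d => d %| m)%N) /=.
rewrite (eq_bigl (fun d => d %| m)%N); last first.
  move=> d; case: (boolP (d %| m)%N); rewrite ?andbF // andbT => dm.
  by rewrite nE dvdn_mull.
rewrite sum_divisors_widen ?m0 1?ltnW // IH //.
have -> : \sum_(1 <= d < n.+1 | (d %| n)%N && ~~ (d %| m)%N) Lambda d = ln p%:R.
  have lpp : logn p p = 1%N by rewrite logn_prime // eqxx.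
  have a0 : (0 < logn p n)%N by rewrite logn_gt0 mem_primes pp n0.
  have pan : (p ^ logn p n %| n)%N by rewrite pfactor_dvdn.
  have pam : ~~ (p ^ logn p n %| m)%N.
    rewrite pfactor_dvdn // -ltnNge nE lognM ?(prime_gt0 pp) //.
    by rewrite lpp addSn.
  rewrite big_mkcond (bigD1_seq (p ^ logn p n)%N) ?iota_uniq //=; last first.
    by rewrite mem_index_iota expn_gt0 prime_gt0 //= ltnS dvdn_leq.
  rewrite pan pam vonMangoldt_prime_power // big1 ?addr0 // => d dp.
  case: ifPn => // /andP[dn dm].
  apply: contraNeq dm => /vonMangoldt_neq0[q [k [pq k0 dE]]].
  rewrite {}dE in dn dp *.
  have [qp|qp] := eqVneq q p; last first.
    by move: dn; rewrite nE Gauss_dvdr // coprimeXl // prime_coprime // dvdn_prime2.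
  rewrite qp in dn dp *; rewrite pfactor_dvdn //.
  move: dn dp; rewrite pfactor_dvdn // leq_eqVlt => /predU1P[->|].
    by rewrite eqxx.
  by rewrite nE lognM ?(prime_gt0 pp) // lpp add1n ltnS.
by rewrite -lnM ?posrE ?ltr0n ?(prime_gt0 pp) // -natrM mulnC -nE.
Qed.

Lemma sum_moebius_divisor_pairs n (f : nat -> R) : (0 < n)%N ->
  \sum_(1 <= d < n.+1 | (d %| n)%N)
     \sum_(1 <= b < (n %/ d).+1 | (b %| n %/ d)%N) mu d * f b = f n.
Proof.
move=> n0; rewrite sum_divisor_pairsC //.
rewrite (@eq_sum_nat _ 1 n.+1 _ _ (fun b => (b == n)%:R * f b)); last first.
  move=> b /andP[b0 _] bn.
  rewrite -mulr_suml sum_moebius; last by rewrite divn_gt0 // dvdn_leq.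
  congr (_%:R * _); congr nat_of_bool.
  apply/eqP/eqP => [H|->]; last by rewrite divnn n0.
  by rewrite -(divnK bn) H mul1n.
rewrite big_mkcond big_nat_recr //= dvdnn eqxx mul1r big1_seq ?add0r // => b.
rewrite /= mem_index_iota => /andP[_ bn].
by rewrite (ltn_eqF bn) mul0r if_same.
Qed.

(** For [n > 1] the sum of [mu d * ln n] vanishes, so [ln d] may be traded for [- ln (n %/ d)]; the
    resulting sum is the Moebius inverse of [ln], that is [Lambda]. *)
Lemma sum_moebius_ln n : (0 < n)%N ->
  \sum_(1 <= d < n.+1 | (d %| n)%N) mu d * ln d%:R = - Lambda n.
Proof.
move=> n0.
have H : \sum_(1 <= d < n.+1 | (d %| n)%N) mu d * ln (n %/ d)%:R = Lambda n.
  transitivity (\sum_(1 <= d < n.+1 | (d %| n)%N)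
     \sum_(1 <= b < (n %/ d).+1 | (b %| n %/ d)%N) mu d * Lambda b).
    apply: eq_sum_nat => d /andP[d0 _] dn; rewrite -mulr_sumr sum_vonMangoldt //.
    by rewrite divn_gt0 // dvdn_leq.
  exact: sum_moebius_divisor_pairs.
have := sum_moebius n0; have [->|n1] := eqVneq n 1%N.
  by move=> _; rewrite big_mkcond big_nat1 /= ln1 mulr0 vonMangoldt1 oppr0.
move=> /(congr1 (fun z => z * ln n%:R)); rewrite mul0r mulr_suml.
rewrite (@eq_sum_nat _ 1 n.+1 _ _
    (fun d => mu d * ln (n %/ d)%:R + mu d * ln d%:R)); last first.
  move=> d /andP[d0 _] dn; rewrite -mulrDr -lnM ?posrE ?ltr0n //; last first.
    by rewrite divn_gt0 // dvdn_leq.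
  by rewrite -natrM divnK.
by rewrite big_split /= H => /eqP; rewrite addrC addr_eq0 => /eqP.
Qed.

(** Both sides have divisor sum [- Lambda n], by [sum_moebius_ln] and [sum_moebius_divisor_pairs],
    and divisor sums determine a function. In terms of Dirichlet series, this is the derivative of
    [1 / zeta]. *)
Lemma moebius_ln n : (0 < n)%N ->
  mu n * ln n%:R = - \sum_(1 <= d < n.+1 | (d %| n)%N) mu d * Lambda (n %/ d).
Proof.
move=> n0; apply/eqP; rewrite -addr_eq0; apply/eqP.
apply: (@eq_of_sum_divisors_eq0 R (fun n => mu n * ln n%:R +
  \sum_(1 <= d < n.+1 | (d %| n)%N) mu d * Lambda (n %/ d))) n0 => {}n n0.
rewrite big_split /= sum_moebius_ln //.
have -> : \sum_(1 <= m < n.+1 | (m %| n)%N)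
    \sum_(1 <= d < m.+1 | (d %| m)%N) mu d * Lambda (m %/ d) =
  \sum_(1 <= d < n.+1 | (d %| n)%N)
     \sum_(1 <= b < (n %/ d).+1 | (b %| n %/ d)%N) mu d * Lambda b.
  transitivity (\sum_(1 <= m < n.+1 | (m %| n)%N)
     \sum_(1 <= d < n.+1 | (d %| m)%N) mu d * Lambda (m %/ d)).
    apply: eq_sum_nat => m /andP[m0 mn] _; rewrite [RHS]sum_divisors_widen //.
    by rewrite m0 -ltnS.
  under eq_bigr do rewrite big_mkcond /=.
  rewrite exchange_big /= [RHS]big_mkcond; apply: eq_big_nat => d /andP[d0 dn].
  rewrite -big_mkcondr (eq_bigl (fun m => (d %| m) && (m %| n))%N); last first.
    by move=> m; rewrite andbC.
  rewrite big_mkcondr sum_multiples //.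
  case: ifPn => [dn'|dn']; last first.
    rewrite big1 // => e _; case: ifPn => // den.
    by case/negP: dn'; apply: dvdn_trans den; rewrite dvdn_mulr.
  rewrite [RHS]big_mkcond; apply: eq_bigr => e _.
  by rewrite mulKn // dvdn_divRL // mulnC.
by rewrite sum_moebius_divisor_pairs // addNr.
Qed.

Lemma vonMangoldt_le_ln n : (0 < n)%N -> Lambda n <= ln n%:R.
Proof.
move=> n0; rewrite -sum_vonMangoldt // big_mkcond big_nat_recr //= dvdnn.
rewrite lerDr; apply: sumr_ge0 => i _; case: ifP => // _; exact: vonMangoldt_ge0.
Qed.

(** Dividing [a] and [b] by their gcd reduces to two coprime squares, whose product divides whatever
    both divide. *)
Lemma dvdn_lcm_sqr a b m : (0 < m)%N ->
  (a ^ 2 %| m)%N -> (b ^ 2 %| m)%N -> (lcmn a b ^ 2 %| m)%N.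
Proof.
move=> m0 am bm.
have pos c : (c ^ 2 %| m)%N -> (0 < c)%N.
  by case: c => //; rewrite exp0n // dvd0n => /eqP m00; rewrite m00 in m0.
have a0 := pos _ am; have b0 := pos _ bm.
set g := gcdn a b; have g0 : (0 < g)%N by rewrite gcdn_gt0 a0.
have aE : a = (g * (a %/ g))%N by rewrite mulnC divnK // dvdn_gcdl.
have bE : b = (g * (b %/ g))%N by rewrite mulnC divnK // dvdn_gcdr.
have cop : coprime (a %/ g) (b %/ g).
  rewrite /coprime -(eqn_pmul2l g0) muln_gcdr -aE -bE muln1; exact/eqP.
have lE : lcmn a b = (g * ((a %/ g) * (b %/ g)))%N.
  apply/eqP; rewrite -(eqn_pmul2r g0) muln_lcm_gcd [X in (X * _)%N]aE {1}bE.
  by apply/eqP; ring.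
rewrite lE !expnMn.
have [m' mE] : exists m', m = (g ^ 2 * m')%N.
  have /dvdnP[q qE] : (g ^ 2 %| m)%N.
    by apply: dvdn_trans am; rewrite dvdn_exp2r // dvdn_gcdl.
  by exists q; rewrite mulnC.
move: am bm; rewrite {1}aE {1}bE !expnMn mE !dvdn_pmul2l ?expn_gt0 ?g0 //.
by move=> am bm; rewrite Gauss_dvd ?am // coprimeXl // coprimeXr.
Qed.

(** By [dvdn_lcm_sqr] the [k] with [k ^ 2 %| m] are precisely the divisors of the largest of them,
    so the sum is a full divisor sum of [mu]. *)
Lemma sum_moebius_sqr m x : (0 < m <= x)%N ->
  \sum_(1 <= k < x.+1 | (k ^ 2 %| m)%N) mu k = (squarefree m)%:R.
Proof.
move=> /andP[m0 mx].
have bnd k : (k ^ 2 %| m)%N -> (k <= m)%N.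
  move=> km; apply: leq_trans (dvdn_leq m0 km).
  by rewrite expnS expn1; case: k {km} => // k; rewrite leq_pmulr.
have ex1 : exists k, (k ^ 2 %| m)%N by exists 1%N; rewrite exp1n dvd1n.
have [s sm smax] := ex_maxnP ex1 bnd.
have dvdE k : (0 < k)%N -> (k ^ 2 %| m)%N = (k %| s)%N.
  move=> k0; apply/idP/idP => [km|ks]; last by apply: dvdn_trans sm; rewrite dvdn_exp2r.
  have /smax := dvdn_lcm_sqr m0 sm km.
  move=> H; have := dvdn_lcml s k; rewrite dvdn_eq => /eqP.
  have s0 : (0 < s)%N by apply: smax; rewrite exp1n dvd1n.
  have l0 : (0 < lcmn s k)%N by rewrite lcmn_gt0 s0.
  have -> : lcmn s k = s.
    by apply/eqP; rewrite eqn_leq H dvdn_leq // dvdn_lcml.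
  by move=> _; rewrite -[X in (_ %| X)%N](_ : lcmn s k = s) ?dvdn_lcmr //;
     apply/eqP; rewrite eqn_leq H dvdn_leq // dvdn_lcml.
have s0 : (0 < s)%N by apply: smax; rewrite exp1n dvd1n.
transitivity (\sum_(1 <= k < x.+1 | (k %| s)%N) mu k).
  rewrite big_mkcond [RHS]big_mkcond; apply: eq_big_nat => k /andP[k0 _].
  by rewrite dvdE.
rewrite sum_divisors_widen; last by rewrite s0 (leq_trans _ mx) // bnd.
rewrite sum_moebius //; congr (nat_of_bool _)%:R.
apply/eqP/(squarefreeP m0) => [s1 k km|]; last exact.
apply/eqP; rewrite -dvdn1 -s1 -dvdE //.
by case: k km => //; rewrite exp0n // dvd0n => /eqP m00; rewrite m00 in m0.
Qed.

Lemma totient_neq0 n : (0 < n)%N -> (totient n)%:R != 0 :> R.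
Proof. by move=> n0; rewrite pnatr_eq0 -lt0n totient_gt0. Qed.

Lemma squarefree_coprime_div e d : squarefree e -> (d %| e)%N -> coprime d (e %/ d).
Proof.
move=> se de; have e0 := squarefree_gt0 se.
rewrite /coprime; apply/eqP/(squarefreeP e0 se).
rewrite -[X in (_ %| X)%N](divnK de) mulnC expnS expn1.
by apply: dvdn_mul; rewrite ?dvdn_gcdl ?dvdn_gcdr.
Qed.

(** After multiplication by [totient e], the quotient [totient e / totient d] is [totient (e %/ d)]
    because [d] and [e %/ d] are coprime, and Gauss's formula for the sum of totients applies. *)
Lemma sum_inv_totient e : squarefree e ->
  \sum_(1 <= d < e.+1 | (d %| e)%N) (totient d)%:R^-1 = e%:R / (totient e)%:R :> R.
Proof.
move=> se; have e0 := squarefree_gt0 se.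
apply: (mulIf (totient_neq0 e0)); rewrite divfK ?totient_neq0 // mulr_suml.
have -> : e%:R = \sum_(0 <= d < e.+1 | (d %| e)%N) (totient d)%:R :> R.
  by rewrite -natr_sum big_mkord cyclic.sum_totient_dvd.
transitivity (\sum_(1 <= d < e.+1 | (d %| e)%N) (totient (e %/ d))%:R : R).
  apply: eq_sum_nat => d /andP[d0 _] de.
  have -> : totient e = (totient d * totient (e %/ d))%N.
    by rewrite -totient_coprime ?squarefree_coprime_div // mulnC divnK.
  by rewrite natrM mulKf // totient_neq0.
rewrite [RHS]big_mkcond big_ltn //= dvd0n gtn_eqF // add0r -big_mkcond.
rewrite -big_filter -[RHS]big_filter.
set s := [seq i <- index_iota 1 e.+1 | (i %| e)%N].
have us : uniq s by rewrite filter_uniq // iota_uniq.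
have memE d : (d \in s) = (0 < d)%N && (d %| e)%N.
  rewrite mem_filter mem_index_iota andbC; case: (boolP (d %| e)%N) => //; rewrite ?andbF // => de.
  by rewrite !andbT ltnS (dvdn_leq e0 de) andbT.
rewrite -(big_map (fun d => e %/ d)%N xpredT (fun d => (totient d)%:R)).
apply: perm_big; apply: uniq_perm => //.
  rewrite map_inj_in_uniq // => a b; rewrite !memE => /andP[a0 ae] /andP[b0 be] H.
  by rewrite -[a](mulKn _ e0) -divnA // H divnA // mulKn.
move=> d; rewrite memE; apply/mapP/andP => [[c]|[d0 de]].
  by rewrite memE => /andP[c0 ce] ->; rewrite divn_gt0 // dvdn_leq // dvdn_div.
exists (e %/ d)%N; first by rewrite memE divn_gt0 // dvdn_leq // dvdn_div.
by rewrite divnA // mulKn.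
Qed.

(** The full power of [p := pdiv n] is stripped off: the divisors that are multiples of [p]
    contribute [- f p] times the sum for the cofactor. Since [mu] kills the divisors with a square
    factor, multiplicativity matters only at [p * d] with [p] not dividing [d]. *)
Lemma euler_divisors n (f : nat -> R) : (0 < n)%N -> f 1%N = 1 ->
  (forall p d, prime p -> (0 < d)%N -> ~~ (p %| d)%N -> f (p * d)%N = f p * f d) ->
  \sum_(1 <= d < n.+1 | (d %| n)%N) mu d * f d = \prod_(p <- primes n) (1 - f p).
Proof.
move=> n0 f1 fM; elim/ltn_ind: n n0 => n IH n0.
have [n_gt1|n_le1] := ltnP 1 n; last first.
  have -> : n = 1%N by apply/eqP; rewrite eqn_leq n_le1.
  by rewrite big_mkcond big_nat1 /= moebius1 f1 mulr1 big_nil.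
set p := pdiv n; have pp : prime p by exact: pdiv_prime.
have p0 := prime_gt0 pp.
have pn : (p %| n)%N by exact: pdiv_dvd.
set a := logn p n; set m := (n %/ p ^ a)%N.
have a0 : (0 < a)%N by rewrite logn_gt0 mem_primes pp n0.
have pan : (p ^ a %| n)%N by rewrite pfactor_dvdn.
have nE : n = (p ^ a * m)%N by rewrite mulnC divnK.
have m0 : (0 < m)%N by rewrite divn_gt0 ?expn_gt0 ?p0 // dvdn_leq.
have mn : (m < n)%N by rewrite ltn_Pdiv // -(exp1n a) ltn_exp2r // prime_gt1.
have cpm : coprime p m.
  rewrite prime_coprime //; apply/negP => pm.
  have : (p ^ a.+1 %| n)%N by rewrite nE expnSr dvdn_pmul2l ?expn_gt0 ?p0.
  by rewrite pfactor_dvdn // ltnn.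
have dmE d : (d %| m)%N = (d %| n)%N && ~~ (p %| d)%N.
  case: (boolP (p %| d)%N) => [pd|pd]; rewrite ?andbF ?andbT.
    apply/negP => dm; move: cpm; rewrite prime_coprime // => /negP; apply.
    exact: dvdn_trans dm.
  by rewrite nE Gauss_dvdr // coprimeXr // coprime_sym prime_coprime.
have perm : perm_eq (primes n) (p :: primes m).
  rewrite nE; apply: (perm_trans (primes_coprimeM _ m0 _)).
  - by rewrite expn_gt0 p0.
  - by rewrite coprimeXl.
  - by rewrite primesX // primes_prime.
rewrite (perm_big _ perm) big_cons -IH //.
rewrite (bigID (fun d => p %| d)%N) /= addrC.
rewrite (eq_bigl (fun d => d %| m)%N); last by move=> d; rewrite dmE.
rewrite sum_divisors_widen ?m0 1?ltnW // mulrBl mul1r; congr (_ + _).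
rewrite (eq_bigl (fun d => (p %| d) && (d %| n))%N); last by move=> d; rewrite andbC.
rewrite big_mkcondr sum_multiples //.
rewrite mulr_sumr -sumrN.
have mnp : (0 < m <= n %/ p)%N.
  by rewrite m0 leq_divRL // nE -[a]prednK // expnS mulnC -mulnA leq_pmul2l // leq_pmull // expn_gt0 p0.
rewrite -(sum_divisors_widen _ mnp) big_mkcond [RHS]big_mkcond.
apply: eq_big_nat => d /andP[d0 _].
case: ifPn => [pdn|pdn]; last first.
  case: ifPn => // dm; case/negP: pdn; rewrite nE -[a]prednK // expnS -mulnA dvdn_pmul2l //.
  by rewrite dvdn_mull.
rewrite moebiusMp //; case: ifPn => [pd|pd].
  by rewrite dmE pd andbF mul0r.
rewrite dmE pd andbT (dvdn_trans _ pdn) ?dvdn_mull //.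
by rewrite fM // mulNr mulrCA mulrA mulrC mulrA mulrAC -mulrA.
Qed.

(** * Crude bounds for sums of [Lambda] over sparse sets and for [n / totient n] *)

Lemma ln2_ge_half : 2^-1 <= ln 2 :> R.
Proof.
rewrite -ler_expR lnK ?posrE // -[X in X <= _]invrK -expRN.
rewrite -[X in _ <= X]invrK lef_pV2 ?posrE ?invr_gt0 ?expR_gt0 //.
by apply: le_trans (expR_ge1Dx _); lra.
Qed.

Lemma nat_le_ln k n : (0 < n)%N -> (2 ^ k <= n)%N -> k%:R <= 2 * ln n%:R :> R.
Proof.
move=> n0 kn; have : ln (2 ^ k)%:R <= ln n%:R :> R.
  by rewrite ler_ln ?posrE ?ltr0n ?expn_gt0 // ler_nat.
rewrite natrX lnXn ?ltr0n // -[ln _ *+ _]mulr_natl; have := ln2_ge_half.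
by have : 0 <= k%:R :> R by []; nra.
Qed.

(** The prime powers in question all divide [P ^ l] with [l := trunc_log 2 N], so the sum is at most
    that of [Lambda] over the divisors of [P ^ l], which is [l * ln P]. It serves with [P] a
    modulus, for the integers not coprime to it, and with [P] a factorial, for the proper prime
    powers. *)
Lemma sum_vonMangoldt_dvd_pow (P N : nat) (Q : pred nat) : (0 < P)%N ->
  (forall p k, prime p -> (0 < k)%N -> (p ^ k <= N)%N -> Q (p ^ k)%N -> (p %| P)%N) ->
  \sum_(1 <= n < N.+1 | Q n) Lambda n <= 2 * ln N%:R * ln P%:R.
Proof.
move=> P0 HQ; have [->|N0] := posnP N.
  by rewrite big_geq // ln0 // mulr0 mul0r.
pose l := trunc_log 2 N; pose X := maxn N (P ^ l).
have Pl0 : (0 < P ^ l)%N by rewrite expn_gt0 P0.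
apply: (@le_trans _ _ (\sum_(1 <= n < X.+1 | (n %| P ^ l)%N) Lambda n)).
  rewrite [leRHS](big_cat_nat (n := N.+1)) //=; last by rewrite ltnS leq_maxl.
  rewrite -[leLHS]addr0 lerD //; last first.
    by apply: sumr_ge0 => i _; exact: vonMangoldt_ge0.
  rewrite big_mkcond [leRHS]big_mkcond; apply: ler_sum_nat => n /andP[n0 nN].
  case: ifPn => Qn; last by case: ifP => // _; exact: vonMangoldt_ge0.
  have [->|/vonMangoldt_neq0[p [k [pp k0 nE]]]] := eqVneq (Lambda n) 0.
    by case: ifP.
  have pP : (p %| P)%N by apply: (HQ p k) => //; rewrite -nE.
  have kl : (k <= l)%N.
    apply: trunc_log_max => //; rewrite -ltnS; apply: leq_ltn_trans nN.
    by rewrite nE leq_exp2r // prime_gt1.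
  by rewrite ifT // nE (dvdn_trans (dvdn_exp2r k pP)) // dvdn_exp2l.
rewrite sum_divisors_widen ?Pl0 ?leq_maxr // sum_vonMangoldt //.
rewrite natrX lnXn ?ltr0n // -[ln _ *+ _]mulr_natl ler_wpM2r ?ln_ge0 ?ler1n //.
by apply: nat_le_ln => //; exact: trunc_logP.
Qed.

(** The i-th smallest member is at least [i + 1], so the product is dominated by the telescoping
    product of [(i + 1) / i]. For [primes n] this bounds [n / totient n] by one plus the number of
    prime factors. *)
Lemma prod_sorted_le (s : seq nat) : sorted ltn s -> all (ltn 1) s ->
  \prod_(p <- s) (p%:R / (p.-1)%:R) <= (size s).+1%:R :> R.
Proof.
elim/last_ind: s => [|s p IH]; first by rewrite big_nil.
move=> srt; rewrite all_rcons => /andP[p1 s1].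
have {}p1 : (1 < p)%N by [].
move: srt; rewrite sorted_pairwise ?pairwise_rcons; last exact: ltn_trans.
rewrite -sorted_pairwise; last exact: ltn_trans.
move=> /andP[/allP sp srts].
have szp : ((size s).+2 <= p)%N.
  have : (size s <= size (iota 2 (p - 2)))%N.
    apply: uniq_leq_size; first exact: sorted_uniq ltn_trans ltnn _ srts.
    move=> x xs; rewrite mem_iota subnKC //; apply/andP; split; [exact: (allP s1)|exact: sp].
  by rewrite size_iota; lia.
rewrite -cats1 big_cat /= big_seq1 size_cat addn1.
apply: le_trans (ler_wpM2r _ (IH srts s1)) _; first by rewrite divr_ge0.
rewrite mulrA ler_pdivrMr; last by rewrite ltr0n; lia.
by rewrite -!natrM ler_nat; nia.
Qed.

Lemma two_pow_omega_le n : (0 < n)%N -> (2 ^ size (primes n) <= n)%N.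
Proof.
move=> n0; rewrite [leqRHS](prod_prime_decomp n0) prime_decompE big_map /=.
have : forall s : seq nat, (forall p, p \in s -> p \in primes n) ->
   (2 ^ size s <= \prod_(p <- s) p ^ logn p n)%N.
  elim => [|p s IH] H; first by rewrite big_nil.
  rewrite big_cons /= expnS leq_mul //; last first.
    by apply: IH => q qs; apply: H; rewrite inE qs orbT.
  have := H p (mem_head _ _); rewrite mem_primes => /and3P[pp _ _].
  apply: (leq_trans (prime_gt1 pp)); rewrite -{1}[p]expn1 leq_exp2l ?prime_gt1 //.
  by rewrite logn_gt0 H // mem_head.
by apply.
Qed.

Lemma natr_div_totient n : (0 < n)%N ->
  n%:R / (totient n)%:R = \prod_(p <- primes n) (p%:R / (p.-1)%:R) :> R.
Proof.
move=> n0; rewrite totientE // [X in X%:R / _](prod_prime_decomp n0) prime_decompE big_map /=.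
rewrite !natr_prod -prodf_div; apply: eq_big_seq => p.
rewrite mem_primes => /and3P[pp _ pn].
have a0 : (0 < logn p n)%N by rewrite logn_gt0 mem_primes pp n0.
rewrite -[in (p ^ logn p n)%N](prednK a0) expnS !natrM invfM mulrACA divff ?mulr1 //.
by rewrite natrX expf_neq0 // pnatr_eq0 -lt0n prime_gt0.
Qed.

Lemma div_totient_le n : (0 < n)%N -> n%:R / (totient n)%:R <= 1 + 2 * ln n%:R :> R.
Proof.
move=> n0; rewrite natr_div_totient //.
apply: le_trans (prod_sorted_le _ _) _.
- exact: sorted_primes.
- by apply/allP => p; rewrite mem_primes => /and3P[/prime_gt1].
- by rewrite -addn1 natrD addrC lerD2l nat_le_ln // two_pow_omega_le.
Qed.

End Arithmetic.

(** * Logarithms and sums of real numbers *)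

(* The shift by 1 makes [slog n >= 1] for every [n], including [n = 0], as [ln 0 = 0]. *)
Definition slog {R : realType} (n : nat) : R := 1 + ln n%:R.

Section RealSums.
Context {R : realType}.
Implicit Types (n m k : nat) (u f : nat -> R).
Local Notation L := (@slog R).

Lemma slog_ge1 n : 1 <= L n.
Proof.
rewrite /slog lerDl; case: n => [|n]; first by rewrite ln0.
by rewrite ln_ge0 // ler1n.
Qed.

Lemma slog_gt0 n : 0 < L n.
Proof. exact: lt_le_trans ltr01 (slog_ge1 n). Qed.

Lemma slog_ge0 n : 0 <= L n.
Proof. exact: ltW (slog_gt0 n). Qed.

Lemma slog1 : L 1 = 1.
Proof. by rewrite /slog ln1 addr0. Qed.

Lemma le_slog m n : (m <= n)%N -> L m <= L n.
Proof.
case: m => [|m] mn.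
  by rewrite {1}/slog ln0 // addr0 slog_ge1.
rewrite lerD2l ler_ln ?posrE ?ltr0n ?ler_nat //; exact: leq_trans mn.
Qed.

Lemma ln_le_slog n : ln n%:R <= L n.
Proof. by rewrite lerDr. Qed.

Lemma ln_nat_ge0 n : 0 <= ln n%:R :> R.
Proof. by have := slog_ge1 n; rewrite /slog lerDl. Qed.

Lemma slogM_le m n : L (m * n) <= L m + L n.
Proof.
have [->|m0] := posnP m; first by rewrite mul0n lerDl slog_ge0.
have [->|n0] := posnP n; first by rewrite muln0 lerDr slog_ge0.
by rewrite /slog natrM lnM ?posrE ?ltr0n //; lra.
Qed.

Lemma slogX_le n j : L (n ^ j) <= j.+1%:R * L n.
Proof.
elim: j => [|j IH]; first by rewrite expn0 mul1r {1}/slog mulr1n ln1 addr0 slog_ge1.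
rewrite expnS; apply: le_trans (slogM_le _ _) _.
by rewrite -[in leRHS]natr1 mulrDl mul1r addrC lerD2r.
Qed.

Lemma slog_le_exp m n j : (m <= n ^ j)%N -> L m <= j.+1%:R * L n.
Proof. by move=> mn; apply: le_trans (slogX_le n j); apply: le_slog. Qed.

Lemma ln_le_sub1 (x : R) : 0 < x -> ln x <= x - 1.
Proof.
move=> x0; have := @le_ln1Dx R (x - 1); rewrite (addrC 1) subrK; apply; lra.
Qed.

Lemma powR_nat_ge1 n (e : R) : (0 < n)%N -> 0 <= e -> 1 <= n%:R `^ e.
Proof.
move=> n0 e0; have n1 : 1 <= n%:R :> R by rewrite ler1n.
by have := ler_powR n1 e0; rewrite powRr0.
Qed.

Lemma slog_le_powR (B : nat) (eta : R) : 0 < eta ->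
  exists2 C : R, 0 < C & forall n, (0 < n)%N -> L n ^+ B <= C * n%:R `^ eta.
Proof.
move=> eta0; have [->|B0] := posnP B.
  exists 1 => // n n0; rewrite expr0 mul1r.
  by apply: powR_nat_ge1 => //; exact: ltW.
(* Spreading [eta] evenly over the [B] factors reduces the claim to [ln y <= y - 1] at
   [y = n ^ e]. *)
pose e := eta / B%:R; have Bp : 0 < B%:R :> R by rewrite ltr0n.
have e0 : 0 < e by rewrite divr_gt0.
exists ((1 + e^-1) ^+ B) => [|n n0]; first by rewrite exprn_gt0 // addr_gt0 ?invr_gt0.
have n1 : 1 <= n%:R `^ e by apply: powR_nat_ge1 => //; exact: ltW.
have -> : n%:R `^ eta = (n%:R `^ e) ^+ B.
  by rewrite -powR_mulrn ?powR_ge0 // -powRrM divfK // gt_eqF.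
rewrite -exprMn lerXn2r ?nnegrE ?slog_ge0 //.
  by rewrite mulr_ge0 ?powR_ge0 // addr_ge0 // invr_ge0 ltW.
have : ln n%:R = e^-1 * ln (n%:R `^ e) by rewrite ln_powR mulrA mulVf ?mul1r // gt_eqF.
rewrite /slog => ->; rewrite mulrDl mul1r lerD // ler_wpM2l ?invr_ge0 ?(ltW e0) //.
by apply: le_trans (ln_le_sub1 _) _; [exact: lt_le_trans n1|lra].
Qed.

Lemma le_ln_sub (x y : R) : 0 < x -> 0 < y -> 1 - x / y <= ln y - ln x.
Proof.
move=> x0 y0; have := ln_le_sub1 (divr_gt0 x0 y0).
by rewrite ln_div ?posrE //; lra.
Qed.

Lemma ln_sub_le (x y : R) : 0 < x -> 0 < y -> ln y - ln x <= y / x - 1.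
Proof. by move=> x0 y0; have := le_ln_sub y0 x0; lra. Qed.

Lemma inv_le_lnS n : (0 < n)%N -> n.+1%:R^-1 <= ln n.+1%:R - ln n%:R :> R.
Proof.
move=> n0; apply: le_trans (le_ln_sub _ _); rewrite ?ltr0n //.
have : n.+1%:R != 0 :> R by rewrite pnatr_eq0.
move=> h; have -> : n%:R = n.+1%:R - 1 :> R by rewrite -natr1 addrK.
by rewrite mulrBl divff // mul1r subKr.
Qed.

Lemma harmonic_le n : \sum_(1 <= k < n.+1) k%:R^-1 <= L n.
Proof.
elim: n => [|n IH]; first by rewrite big_geq // slog_ge0.
rewrite big_nat_recr //=; case: n IH => [|n] IH.
  by rewrite big_geq // add0r invr1 slog_ge1.
apply: le_trans (lerD IH (inv_le_lnS _)) _ => //.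
by rewrite /slog; lra.
Qed.

Lemma abel_monotone u f a b (M : R) : (a < b)%N ->
  (forall n, (a < n <= b)%N -> `|\sum_(a.+1 <= k < n.+1) u k| <= M) ->
  (forall k, (a < k <= b)%N -> 0 <= f k) ->
  (forall k, (a < k < b)%N -> f k.+1 <= f k) ->
  `|\sum_(a.+1 <= k < b.+1) u k * f k| <= M * f a.+1.
Proof.
move=> ab Hu f0 fmon.
(* With the boundary term [U * f n] removed, the error becomes [M * (f a.+1 - f n)], whose
   increments telescope; restoring the boundary term at [b] costs the missing [M * f b]. *)
suff H n : (a < n <= b)%N -> `|\sum_(a.+1 <= k < n.+1) u k * f k -
   (\sum_(a.+1 <= k < n.+1) u k) * f n| <= M * (f a.+1 - f n).
  have abb : (a < b <= b)%N by rewrite ab leqnn.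
  have := H _ abb; have := Hu _ abb; have := f0 _ abb.
  set U := \sum_(_ <= _ < _) _; set S := \sum_(_ <= _ < _) _ => fb Ub HS.
  have -> : S = (S - U * f b) + U * f b by rewrite subrK.
  apply: le_trans (ler_normD _ _) _; rewrite normrM (ger0_norm fb).
  by have := ler_wpM2r fb Ub; lra.
elim: n => // n IH /andP[an nb].
move: an; rewrite ltnS leq_eqVlt => /predU1P[an|an].
  by rewrite an !big_nat1 !subrr mulr0 normr0.
move: IH; rewrite an (ltnW nb) => /(_ isT) IH.
rewrite ![\sum_(_ <= _ < n.+2) _]big_nat_recr /= 1?ltnW //.
have fn : f n.+1 <= f n by apply: fmon; rewrite an nb.
have := Hu n; rewrite an (ltnW nb) => /(_ isT).
move: IH; set S := \sum_(_ <= _ < _) _; set U := \sum_(_ <= _ < _) _ => IH Un.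
have -> : S + u n.+1 * f n.+1 - (U + u n.+1) * f n.+1 = (S - U * f n) + U * (f n - f n.+1).
  by ring.
apply: le_trans (ler_normD _ _) _; rewrite normrM (ger0_norm (_ : 0 <= f n - f n.+1)) ?subr_ge0 //.
have := ler_wpM2r (_ : 0 <= f n - f n.+1) Un; rewrite subr_ge0 => /(_ fn).
by lra.
Qed.

Lemma sum_le_telescope (a g : nat -> R) m n : (m <= n)%N ->
  (forall k, (m <= k < n)%N -> a k.+1 <= g k - g k.+1) ->
  \sum_(m.+1 <= k < n.+1) a k <= g m - g n.
Proof.
move=> mn H; rewrite big_add1 /= -opprB -(telescope_sumr g mn) -sumrN.
by apply: ler_sum_nat => k kmn; rewrite opprB H.
Qed.

(** [t + w] is nonincreasing and bounded below by [t 0 - w 0], and [w] converges by monotonicity,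
    hence so does the difference. Explicit tails come from [dist_telescope_le] with
    [dist_lim_le]. *)
Lemma telescoping_cvg (t w : nat -> R) :
  (forall n, `|t n.+1 - t n| <= w n - w n.+1) -> (forall n, 0 <= w n) ->
  cvgn t.
Proof.
move=> tw w0.
have wmon : nonincreasing_seq w.
  apply/nonincreasing_seqP => n.
  by have := le_trans (normr_ge0 _) (tw n); rewrite subr_ge0.
have wc : cvgn w.
  by apply: nonincreasing_is_cvgn => //; exists 0 => _ [n _ <-].
have vmon : nonincreasing_seq (fun n => t n + w n).
  apply/nonincreasing_seqP => n.
  by have := le_trans (ler_norm _) (tw n); lra.
have vc : cvgn (fun n => t n + w n).
  apply: nonincreasing_is_cvgn => //; exists (t 0%N - w 0%N) => _ [n _ <-].
  elim: n => [|n IH]; first by have := w0 0%N; lra.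
  have : t 0%N - w 0%N <= t n - w n; last first.
    have := tw n; have := ler_norm (t n - t n.+1); rewrite distrC.
    by have := w0 n.+1; lra.
  elim: n {IH} => [|n IH]; first by [].
  have := tw n; have := ler_norm (t n - t n.+1); rewrite distrC; lra.
have -> : t = (fun n => (t n + w n) - w n) by apply/funext => n; rewrite addrK.
exact: is_cvgB.
Qed.

Lemma dist_lim_le (t : nat -> R) (c b : R) m : t @ \oo --> c ->
  (forall n, (m <= n)%N -> `|t n - t m| <= b) -> `|t m - c| <= b.
Proof.
move=> tc H; rewrite distrC.
have H' : (fun n => `|t n - t m|) @ \oo --> `|c - t m|.
  by apply: cvg_norm; apply: cvgB => //; exact: cvg_cst.
rewrite -(cvg_lim _ H') //; apply: limr_le; first by apply/cvg_ex; exists `|c - t m|.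
by exists m => // n /= mn; exact: H.
Qed.

Lemma dist_telescope_le (t w : nat -> R) m n : (m <= n)%N ->
  (forall k, (m <= k < n)%N -> `|t k.+1 - t k| <= w k - w k.+1) ->
  `|t n - t m| <= w m - w n.
Proof.
elim: n => [|n IH]; first by rewrite leqn0 => /eqP -> _; rewrite !subrr normr0.
rewrite leq_eqVlt => /predU1P[->|mn] H; first by rewrite !subrr normr0.
have -> : t n.+1 - t m = (t n.+1 - t n) + (t n - t m) by rewrite addrA subrK.
apply: le_trans (ler_normD _ _) _.
have {}mn : (m <= n)%N by [].
have := H n; rewrite mn ltnSn => /(_ isT).
have H' k : (m <= k < n)%N -> (m <= k < n.+1)%N.
  by move=> /andP[-> kn]; rewrite ltnS ltnW.
have := IH mn (fun k kk => H k (H' k kk)); lra.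
Qed.

(** An inverse square root, not an integer square root. Its cube [k ^ (-3/2)] is the common majorant
    of the coefficient series below, whose tails are then [O(isqrt)]. *)
Definition isqrt k : R := (Num.sqrt k%:R)^-1.

Lemma isqrt_ge0 k : 0 <= isqrt k.
Proof. by rewrite invr_ge0 sqrtr_ge0. Qed.

Lemma isqrt_gt0 k : (0 < k)%N -> 0 < isqrt k.
Proof. by move=> k0; rewrite invr_gt0 sqrtr_gt0 ltr0n. Qed.

Lemma isqrt1 : isqrt 1 = 1.
Proof. by rewrite /isqrt sqrtr1 invr1. Qed.

Lemma isqrt_sqr k : isqrt k ^+ 2 = k%:R^-1.
Proof. by rewrite exprVn sqr_sqrtr. Qed.

Lemma isqrt_anti m n : (0 < m <= n)%N -> isqrt n <= isqrt m.
Proof.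
move=> /andP[m0 mn]; have n0 := leq_trans m0 mn.
by rewrite lef_pV2 ?posrE ?sqrtr_gt0 ?ltr0n // ler_wsqrtr // ler_nat.
Qed.

(** With [y] and [z] the two inverse roots, [y ^ 2 - z ^ 2 = y ^ 2 * z ^ 2]; factoring the left side
    gives [y * z ^ 2 <= 2 * (y - z)], and [z <= y]. *)
Lemma isqrt_step k : (0 < k)%N -> isqrt k.+1 ^+ 3 <= 2 * isqrt k - 2 * isqrt k.+1.
Proof.
move=> k0; have y0 := isqrt_gt0 k0; have z0 := isqrt_gt0 (ltn0Sn k).
have zy : isqrt k.+1 <= isqrt k by apply: isqrt_anti; rewrite k0 leqnSn.
have kE : k%:R * isqrt k ^+ 2 = 1 by rewrite isqrt_sqr divff // pnatr_eq0 -lt0n.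
have kE' : (k%:R + 1) * isqrt k.+1 ^+ 2 = 1.
  by rewrite isqrt_sqr natr1 divff // pnatr_eq0.
have k0' : 0 < k%:R :> R by rewrite ltr0n.
move: (isqrt k) (isqrt k.+1) y0 z0 zy kE kE' => y z y0 z0 zy kE kE'.
have yz : y ^+ 2 - z ^+ 2 = y ^+ 2 * z ^+ 2.
  transitivity (y ^+ 2 * ((k%:R + 1) * z ^+ 2) - z ^+ 2 * (k%:R * y ^+ 2)); last by ring.
  by rewrite kE kE' !mulr1.
have h : y * z ^+ 2 <= 2 * (y - z).
  rewrite -(ler_pM2l y0) mulrA -expr2 -yz subr_sqr.
  have -> : y * (2 * (y - z)) = (y - z) * (y + y) by ring.
  by rewrite ler_wpM2l ?subr_ge0 // lerD2l.
rewrite -mulrBr; apply: le_trans h; rewrite exprS.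
by rewrite ler_wpM2r // sqr_ge0.
Qed.

(** A discrete integral test: [1 / (x * ln^(B+2) x)] is, up to a constant, the derivative of
    [- 1 / ln^(B+1) x]. The factor [2 ^+ B.+2] comes from replacing [L k] by [L k.+1 <= 2 * L k]. *)
Lemma slog_pow_step k B : (0 < k)%N ->
  (k.+1%:R * L k ^+ B.+2)^-1 <= 2 ^+ B.+2 * (L k ^- B.+1 - L k.+1 ^- B.+1).
Proof.
move=> k0; have a1 := slog_ge1 k; have b1 := slog_ge1 k.+1.
have d : (k.+1%:R)^-1 <= L k.+1 - L k.
  by apply: le_trans (inv_le_lnS k0) _; rewrite /slog; lra.
have b2 : L k.+1 <= 2 * L k.
  have : ln k.+1%:R <= ln k%:R + ln 2 :> R.
    by rewrite -lnM ?posrE ?ltr0n // -natrM ler_ln ?posrE ?ltr0n ?muln_gt0 ?k0 // ler_nat; lia.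
  by have := @ln_le_sub1 2 (ltr0Sn _ _); rewrite /slog in a1 *; lra.
have d0 : 0 <= L k.+1 - L k by apply: le_trans d; rewrite invr_ge0.
move: (L k) (L k.+1) a1 b1 d b2 d0 => a b a1 b1 d b2 d0.
have a0 : 0 < a by lra. have b0 : 0 < b by lra.
have key : (b - a) * b ^- B.+2 <= a ^- B.+1 - b ^- B.+1.
  elim: B => [|B IH].
    have -> : a ^- 1 - b ^- 1 = (b - a) * (a ^-1 * b ^-1).
      by rewrite !expr1; field; rewrite !gt_eqF.
    by rewrite ler_wpM2l // expr2 invfM ler_wpM2r ?invr_ge0 ?(ltW b0) // lef_pV2 ?posrE //; lra.
  have -> : a ^- B.+2 - b ^- B.+2 = a^-1 * (a ^- B.+1 - b ^- B.+1) + b ^- B.+1 * (a^-1 - b^-1).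
    by rewrite !(exprS _ B.+1) !invfM; ring.
  have ba : b^-1 <= a^-1 by rewrite lef_pV2 ?posrE //; lra.
  have h1 : 0 <= b ^- B.+1 * (a^-1 - b^-1).
    by rewrite mulr_ge0 ?subr_ge0 // invr_ge0 exprn_ge0 // ltW.
  have h2 : b^-1 * ((b - a) * b ^- B.+2) <= a^-1 * (a ^- B.+1 - b ^- B.+1).
    apply: ler_pM => //; first by rewrite invr_ge0 ltW.
    by rewrite mulr_ge0 // invr_ge0 exprn_ge0 // ltW.
  apply: le_trans (_ : b^-1 * ((b - a) * b ^- B.+2) <= _); last by lra.
  by rewrite (exprS _ B.+2) invfM mulrCA.
apply: le_trans (ler_wpM2l _ key); last by rewrite exprn_ge0.
rewrite invfM mulrCA; apply: ler_pM.
- by rewrite invr_ge0.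
- by rewrite invr_ge0 exprn_ge0 // ltW.
- exact: d.
rewrite -exprVn -exprVn -exprMn lerXn2r ?nnegrE ?mulr_ge0 ?invr_ge0 ?(ltW a0) ?(ltW b0) //.
by rewrite -ler_pdivrMl ?invr_gt0 //; rewrite -(invfM) lef_pV2 ?posrE; lra.
Qed.

Lemma isqrt_series (a : nat -> R) (C : R) :
  (forall k, (0 < k)%N -> `|a k| <= C * isqrt k ^+ 3) ->
  exists2 c, (fun n => \sum_(1 <= k < n.+1) a k) @ \oo --> c &
    forall z, (0 < z)%N -> `|\sum_(1 <= k < z.+1) a k - c| <= 2 * C * isqrt z.
Proof.
move=> aC.
have C0 : 0 <= C by have := aC 1%N isT; rewrite isqrt1 expr1n mulr1; apply: le_trans.
set t := fun n => _.
(* [isqrt 0] is the default value 0, so [w 0] is set by hand; [3 * C] makes the first increment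
   equal to the bound [C] on [a 1]. *)
pose w n := if n == 0%N then 3 * C else 2 * C * isqrt n.
have tS n : t n.+1 - t n = a n.+1.
  by rewrite /t big_nat_recr //= addrAC subrr add0r.
have tw n : `|t n.+1 - t n| <= w n - w n.+1.
  rewrite tS; apply: le_trans (aC _ (ltn0Sn n)) _; rewrite /w /=.
  case: n => [|n] /=; first by rewrite isqrt1 expr1n; lra.
  by have := ler_wpM2l C0 (isqrt_step (ltn0Sn n)); lra.
have w0 n : 0 <= w n.
  by rewrite /w; case: eqP => _; rewrite !mulr_ge0 ?isqrt_ge0.
have tc : cvgn t by exact: telescoping_cvg tw w0.
exists (limn t) => // z z0; apply: (dist_lim_le tc) => n zn.
apply: le_trans (dist_telescope_le zn (fun k _ => tw k)) _.
by have := w0 n; rewrite [w z]/w gtn_eqF //; lra.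
Qed.

(** Partial summation: [t n = s n.+1 - A n.+1 / n.+1] has increments [A n.+1 / (n.+1 * n.+2)],
    summable by the log savings through [slog_pow_step]. The limit of [t] does not depend on [B], so
    one [c] serves all exponents. *)
Lemma log_saving_series (a : nat -> R) :
  (forall B, exists C, forall n, (0 < n)%N ->
     `|\sum_(1 <= k < n.+1) a k| <= C * (n%:R / L n ^+ B)) ->
  exists c, forall B, exists C, forall n, (0 < n)%N ->
     `|\sum_(1 <= k < n.+1) a k / k%:R - c| <= C / L n ^+ B.
Proof.
move=> HA.
pose A n := \sum_(1 <= k < n.+1) a k.
pose s n := \sum_(1 <= k < n.+1) a k / k%:R.
pose t n := s n.+1 - A n.+1 / n.+1%:R.
have tS n : t n.+1 - t n = A n.+1 / (n.+1%:R * n.+2%:R).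
  rewrite /t /s /A ![\sum_(_ <= _ < n.+3) _]big_nat_recr //=.
  set S := \sum_(_ <= _ < n.+2) _; set U := \sum_(_ <= _ < n.+2) _.
  rewrite -[n.+2%:R]natr1; field.
  by have n0 : 0 <= n%:R :> R by []; rewrite !lt0r_neq0 //; lra.
have HB B : exists2 C, 0 <= C & forall n, `|t n.+1 - t n| <=
     C * L n.+1 ^- B.+1 - C * L n.+2 ^- B.+1.
  have [C HC] := HA B.+2.
  have C0 : 0 <= C.
    have := HC 1%N isT; rewrite slog1 expr1n divr1 mulr1.
    by apply: le_trans.
  exists (C * 2 ^+ B.+2) => [|n]; first by rewrite mulr_ge0 // exprn_ge0.
  rewrite tS normrM (ger0_norm (_ : 0 <= (_ * _)^-1)) ?invr_ge0 ?mulr_ge0 //.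
  apply: le_trans (ler_wpM2r _ (HC n.+1 isT)) _; first by rewrite invr_ge0 mulr_ge0.
  have := ler_wpM2l C0 (@slog_pow_step n.+1 B isT).
  have -> : C * (n.+1%:R / L n.+1 ^+ B.+2) / (n.+1%:R * n.+2%:R) =
            C / (n.+2%:R * L n.+1 ^+ B.+2).
    have p0 : n.+1%:R != 0 :> R by rewrite pnatr_eq0.
    have q0 : n.+2%:R != 0 :> R by rewrite pnatr_eq0.
    have l0 : L n.+1 ^+ B.+2 != 0 by rewrite expf_neq0 // gt_eqF // slog_gt0.
    by move: (n.+1%:R : R) (n.+2%:R : R) (L _ ^+ _) p0 q0 l0 => p q l p0 q0 l0; field; rewrite p0 q0 l0.
  by move/le_trans; apply; rewrite -mulrBr mulrA.
have [C0 C00 H0] := HB 0%N.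
have tc : cvgn t.
  apply: (@telescoping_cvg _ (fun n => C0 * L n.+1 ^- 1) H0) => n.
  by rewrite mulr_ge0 // invr_ge0 exprn_ge0 // slog_ge0.
exists (limn t) => B; have [C C_ge0 HC] := HB B; have [D HD] := HA B.
exists (C + D) => -[//|n] _.
have -> : \sum_(1 <= k < n.+2) a k / k%:R - limn t =
   (t n - limn t) + A n.+1 / n.+1%:R by rewrite /t /s; ring.
rewrite mulrDl; apply: le_trans (ler_normD _ _) (lerD _ _).
  apply: (dist_lim_le tc) => m nm.
  apply: le_trans (dist_telescope_le (w := fun n => C * L n.+1 ^- B.+1) nm (fun k _ => HC k)) _.
  have h0 : 0 <= C * L m.+1 ^- B.+1.
    by rewrite mulr_ge0 // invr_ge0 exprn_ge0 // slog_ge0.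
  apply: le_trans (_ : C * L n.+1 ^- B.+1 <= _); first by lra.
  rewrite ler_wpM2l // lef_pV2 ?posrE ?exprn_gt0 ?slog_gt0 //.
  by rewrite ler_weXn2l ?slog_ge1.
rewrite normrM (ger0_norm (_ : 0 <= _^-1)) ?invr_ge0 //.
apply: le_trans (ler_wpM2r _ (HD n.+1 isT)) _; first by rewrite invr_ge0.
by rewrite -mulrA (mulrAC n.+1%:R) divff ?mul1r // pnatr_eq0.
Qed.

End RealSums.

(** * Elliott-Halberstam hypotheses without suprema *)

Section ElliottHalberstam.
Context {R : realType}.
Local Notation L := (@slog R).
Local Notation Lambda := (@vonMangoldt R).
Local Notation mu := (@moebius R).

Section SupSup.
Variables (I : Type) (Y : set R) (X : set I) (D : R -> I -> R).
Hypothesis D_ge0 : forall y i, 0 <= D y i.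

Lemma sup_ge0 (S : set R) : (forall x, S x -> 0 <= x) -> 0 <= sup S.
Proof.
move=> S0; have [hS|hS] := pselect (has_sup S); last by rewrite sup_out.
by have [[x Sx] ub] := hS; apply: le_trans (S0 _ Sx) _; apply: ub_le_sup.
Qed.

Lemma sup_sup_ge0 : 0 <= sup [set sup [set D y i | i in X] | y in Y].
Proof.
apply: sup_ge0 => _ [y _ <-]; apply: sup_ge0 => _ [i _ <-]; exact: D_ge0.
Qed.

(** The uniform bound [M] ensures that neither supremum falls back on the default value of [sup]. *)
Lemma sup_sup_ge (M : R) y i : (forall y i, Y y -> X i -> D y i <= M) ->
  Y y -> X i -> D y i <= sup [set sup [set D y i | i in X] | y in Y].
Proof.
move=> DM Yy Xi.
have ubX y' : Y y' -> ubound [set D y' i | i in X] M.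
  by move=> Yy' _ [j Xj <-]; exact: DM.
have ubY : ubound [set sup [set D y i | i in X] | y in Y] M.
  move=> _ [y' Yy' <-]; apply: ge_sup; [by exists (D y' i), i | exact: ubX].
apply: (@le_trans _ _ (sup [set D y i | i in X])).
  by apply: ub_le_sup; [exists M; exact: ubX | exists i].
by apply: ub_le_sup; [exists M | exists y].
Qed.

End SupSup.

Lemma eqz_mod_nat (n a q : nat) :
  (n%:Z == a%:Z %[mod q%:Z])%Z = (n == a %[mod q])%N.
Proof. by rewrite !modz_nat. Qed.

Lemma sum_upto_nat (y : nat) (F : nat -> R) :
  sum_upto y%:R F = \sum_(1 <= n < y.+1) F n.
Proof. by rewrite /sum_upto natrK. Qed.

Lemma sum_upto_mod_nat (y a q : nat) (F : nat -> R) :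
  sum_upto_mod y%:R a q F = \sum_(1 <= n < y.+1 | n == a %[mod q]) F n.
Proof. by rewrite /sum_upto_mod natrK; apply: eq_bigl => n; rewrite eqz_mod_nat. Qed.

Lemma sum_mod_le_sum (y : R) (N q : nat) (a : int) (F : nat -> R) : y <= N%:R ->
  `|sum_upto_mod y a q F| <= \sum_(1 <= n < N.+1) `|F n|.
Proof.
move=> yN; apply: le_trans (ler_norm_sum _ _ _) _.
have tN : ((Num.truncn y).+1 <= N.+1)%N by rewrite ltnS -[N](@natrK R) le_truncn.
rewrite [leRHS](big_cat_nat (n := (Num.truncn y).+1)) //= -[leLHS]addr0 lerD //.
  rewrite big_mkcond; apply: ler_sum => n _; by case: ifP.
exact: sumr_ge0.
Qed.

Lemma sum_upto_le_sum (y : R) (N : nat) (F : nat -> R) : y <= N%:R ->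
  `|sum_upto y F| <= \sum_(1 <= n < N.+1) `|F n|.
Proof.
move=> yN; have := @sum_mod_le_sum y N 1 0 F yN.
rewrite /sum_upto_mod (eq_bigl xpredT) // => n.
by rewrite /= !modz1.
Qed.

(** The supremum is frozen as a function [D] of the modulus; from here on only integral [y] and
    natural representatives [a] occur. The trivial bound on the discrepancy shows that the suprema
    are genuine. *)
Lemma EH_discrepancy (theta C A' : R) : 0 < A' -> EH theta C ->
  exists K, forall N, (2 <= N)%N -> exists D : nat -> R,
  [/\ forall q, 0 <= D q,
      forall q y a, (0 < y <= N)%N -> coprime a q ->
        `|\sum_(1 <= n < y.+1 | n == a %[mod q]) Lambda n - y%:R / (totient q)%:R|
          <= D q
    & sum_upto (N%:R `^ theta * ln N%:R `^ C) D <= K * (N%:R / ln N%:R `^ A')].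
Proof.
move=> A'0 /(_ _ A'0)[K HK]; exists K => N N2.
pose D q (y : R) (a : int) := `|sum_upto_mod y a q Lambda - y / (totient q)%:R|.
exists (fun q => sup [set sup [set D q y a | a in [set a : int | coprimez a q%:Z]]
           | y in [set y : R | 0 < y <= N%:R]]); split.
- by move=> q; apply: sup_sup_ge0 => y a; exact: normr_ge0.
- move=> q y a /andP[y0 yN] aq; rewrite -sum_upto_mod_nat.
  apply: (@sup_sup_ge _ _ _ _ (\sum_(1 <= n < N.+1) `|Lambda n| + N%:R)).
  + move=> {yN aq y0}y {}a /andP[y0 yN] _.
    apply: le_trans (ler_normB _ _) _; apply: lerD; first exact: sum_mod_le_sum.
    rewrite ger0_norm ?divr_ge0 ?(ltW y0) //; have [->|q0] := posnP q.
      by rewrite invr0 mulr0.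
    rewrite ler_pdivrMr ?ltr0n ?totient_gt0 //; apply: (le_trans yN).
    by rewrite ler_peMr // ler1n totient_gt0.
  + by rewrite /= ltr0n y0 ler_nat.
  + by rewrite /= coprimezE.
- exact: HK.
Qed.

Lemma EHmu_discrepancy (theta A' : R) : 0 < A' -> EHmu theta ->
  exists K, forall N, (2 <= N)%N ->
  let LM := fun n : nat => Lambda n * mu (N - n) in
  exists D : nat -> R,
  [/\ forall q, 0 <= D q,
      forall q y a, (0 < q)%N -> (0 < y < N)%N -> coprime a q ->
        `|\sum_(1 <= n < y.+1 | n == a %[mod q]) LM n
          - (totient q)%:R^-1 * \sum_(1 <= n < y.+1) LM n| <= D q
    & sum_upto (N%:R `^ theta) D <= K * (N%:R / ln N%:R `^ A')].
Proof.
move=> A'0 /(_ _ A'0)[K HK]; exists K => N N2 LM.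
pose D q (y : R) (a : int) :=
  `|sum_upto_mod y a q LM - (totient q)%:R^-1 * sum_upto y LM|.
exists (fun q => sup [set sup [set D q y a | a in [set a : int | coprimez a q%:Z]]
           | y in [set y : R | 0 < y < N%:R]]); split.
- by move=> q; apply: sup_sup_ge0 => y a; exact: normr_ge0.
- move=> q y a q0 /andP[y0 yN] aq; rewrite -sum_upto_mod_nat -sum_upto_nat.
  pose M := \sum_(1 <= n < N.+1) `|LM n|.
  apply: (@sup_sup_ge _ _ _ _ (M + M)).
  + move=> {yN aq y0}y {}a /andP[y0 /ltW yN] _.
    apply: le_trans (ler_normB _ _) _; apply: lerD; first exact: sum_mod_le_sum.
    rewrite normrM ger0_norm ?invr_ge0 // mulrC ler_pdivrMr ?ltr0n ?totient_gt0 //.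
    apply: (le_trans (sum_upto_le_sum _ yN)).
    by rewrite ler_peMr ?ler1n ?totient_gt0 // sumr_ge0.
  + by rewrite /= ltr0n y0 ltr_nat.
  + by rewrite /= coprimezE.
- exact: HK.
Qed.

Lemma slog_le_3ln (N : nat) : (2 <= N)%N -> L N <= 3 * ln N%:R.
Proof.
move=> N2; have : ln 2 <= ln N%:R :> R.
  by rewrite ler_ln ?posrE ?ltr0n ?ler_nat //; exact: leq_trans N2.
by have := @ln2_ge_half R; rewrite /slog; lra.
Qed.

(** The finitely many ratios [|f n| / g n] below [n0] are added to the constant. *)
Lemma le_all_of_eventually (f g : nat -> R) n0 : (forall n, (0 < n)%N -> 0 < g n) ->
  (exists K, forall n, (n0 <= n)%N -> f n <= K * g n) ->
  exists K, forall n, (0 < n)%N -> f n <= K * g n.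
Proof.
move=> g0 [K HK]; exists (`|K| + \sum_(1 <= n < n0) `|f n| / g n) => n n_gt0.
have S0 : 0 <= \sum_(1 <= n < n0) `|f n| / g n.
  rewrite big_seq; apply: sumr_ge0 => i; rewrite mem_index_iota => /andP[i0 _].
  by rewrite divr_ge0 // ltW // g0.
have [/HK h|nn0] := leqP n0 n.
  apply: (le_trans h); rewrite ler_wpM2r ?(ltW (g0 _ n_gt0)) //.
  by have := ler_norm K; lra.
apply: (le_trans (ler_norm _)); rewrite -ler_pdivrMr ?g0 //.
apply: (@le_trans _ _ (\sum_(1 <= n < n0) `|f n| / g n)); last by have := normr_ge0 K; lra.
rewrite (bigD1_seq n) ?iota_uniq ?mem_index_iota ?n_gt0 //= lerDl.
rewrite big_seq_cond; apply: sumr_ge0 => i; rewrite mem_index_iota => /andP[/andP[i0 _] _].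
by rewrite divr_ge0 // ltW // g0.
Qed.

Lemma inv_ln_powR_le N (B : nat) : (2 <= N)%N ->
  (ln N%:R `^ B%:R)^-1 <= 3 ^+ B / L N ^+ B.
Proof.
move=> N2; have h := slog_le_3ln N2; have l0 := @slog_gt0 R N.
have ln0 : 0 < ln N%:R :> R by lra.
rewrite powR_mulrn ?(ltW ln0) // ler_pdivlMr ?exprn_gt0 // ler_pdivrMl ?exprn_gt0 //.
by rewrite -exprMn mulrC lerXn2r ?nnegrE ?(ltW l0) // mulr_ge0 // ltW.
Qed.

Lemma ln_ge1 n : (4 <= n)%N -> 1 <= ln n%:R :> R.
Proof.
move=> n4; apply: (@le_trans _ _ (ln (4%:R : R))).
  have -> : 4%:R = 2%:R * 2%:R :> R by ring.
  by have := @ln2_ge_half R; rewrite lnM ?posrE //; lra.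
by rewrite ler_ln ?posrE ?ltr0n ?ler_nat // (leq_trans _ n4).
Qed.

(** The hypotheses are invoked with exponent [B.+1], which is positive even for [B = 0]; this
    converts their bounds from [ln] to [L]. *)
Lemma ln_saving (M : R) (B N : nat) : (1 < N)%N ->
  M * (N%:R / ln N%:R `^ B.+1%:R) <= `|M| * 3 ^+ B.+1 * (N%:R / L N ^+ B).
Proof.
move=> N1; have h := @inv_ln_powR_le N B.+1 N1.
have l1 : (L N ^+ B.+1)^-1 <= (L N ^+ B)^-1.
  by rewrite lef_pV2 ?posrE ?exprn_gt0 ?slog_gt0 // exprS ler_peMl ?exprn_ge0 ?slog_ge0 ?slog_ge1.
apply: (@le_trans _ _ (`|M| * (N%:R * (3 ^+ B.+1 / L N ^+ B.+1)))).
  apply: (@le_trans _ _ (`|M| * (N%:R / ln N%:R `^ B.+1%:R))).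
    by rewrite ler_wpM2r ?ler_norm // divr_ge0 ?powR_ge0.
  by rewrite ler_wpM2l // ler_wpM2l.
rewrite -mulrA ler_wpM2l // mulrCA ler_wpM2l ?exprn_ge0 //.
by rewrite ler_wpM2l.
Qed.

Lemma EH_prime_number_theorem (theta C : R) : 0 < theta -> 0 <= C -> EH theta C ->
  forall B, exists K, forall n, (0 < n)%N ->
    `|\sum_(1 <= k < n.+1) (Lambda k - 1)| <= K * (n%:R / L n ^+ B).
Proof.
move=> theta0 C0 hEH B; apply: (@le_all_of_eventually _ _ 4).
  by move=> n n0; rewrite divr_gt0 ?ltr0n // exprn_gt0 // slog_gt0.
have [K HK] := EH_discrepancy (ltr0Sn R B) hEH.
exists (`|K| * 3 ^+ B.+1) => n n4.
have [D [D0 HD HS]] := HK n (ltn_trans (isT : (1 < 3)%N) n4).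
have n0 : (0 < n)%N by apply: leq_trans n4.
have ln1 := ln_ge1 n4.
have := HD 1%N n 0%N; rewrite n0 leqnn => /(_ isT isT).
rewrite (eq_bigl xpredT); last by move=> k; rewrite !modn1.
have -> : totient 1 = 1%N by []; rewrite divr1.
have -> : \sum_(1 <= k < n.+1) (Lambda k - 1) = \sum_(1 <= k < n.+1) Lambda k - n%:R.
  by rewrite big_split /= sumrN sumr_const_nat subn1.
move/le_trans; apply.
set X := _ * _ in HS.
have X1 : 1 <= X.
  rewrite -[1]mulr1 ler_pM // ?powR_nat_ge1 //; first exact: ltW.
  by have := ler_powR ln1 C0; rewrite powRr0.
apply: (@le_trans _ _ (sum_upto X D)).
  rewrite /sum_upto big_ltn; last by rewrite ltnS truncn_gt0.
  by rewrite lerDl sumr_ge0.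
apply: (le_trans HS); apply: ln_saving; exact: leq_trans n4.
Qed.

End ElliottHalberstam.

(** * Moebius sums with coprimality conditions *)

Definition PNT (R : realType) : Prop :=
  forall B, exists K : R, forall n, (0 < n)%N ->
    `|\sum_(1 <= k < n.+1) (vonMangoldt k - 1)| <= K * (n%:R / slog n ^+ B).

Definition mobius_sum {R : realType} (Q x : nat) : R :=
  \sum_(1 <= n < x.+1 | coprime n Q) moebius n / n%:R.

Definition mangoldt_sum {R : realType} (Q x : nat) : R :=
  \sum_(1 <= n < x.+1 | coprime n Q) vonMangoldt n / n%:R.

Section MobiusSums.
Context {R : realType}.
Local Notation L := (@slog R).
Local Notation Lambda := (@vonMangoldt R).
Local Notation mu := (@moebius R).
Local Notation m_ := (@mobius_sum R).
Local Notation T_ := (@mangoldt_sum R).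

Lemma harmonic_asymp : exists gamma : R, forall n, (0 < n)%N ->
  `|\sum_(1 <= k < n.+1) k%:R^-1 - ln n%:R - gamma| <= n%:R^-1.
Proof.
pose t n : R := \sum_(1 <= k < n.+2) k%:R^-1 - ln n.+1%:R.
pose w n : R := n.+1%:R^-1.
have tw n : `|t n.+1 - t n| <= w n - w n.+1.
  rewrite /t /w big_nat_recr //=.
  have h1 := @inv_le_lnS R n.+1 isT.
  have h2 := @ln_sub_le R n.+1%:R n.+2%:R (ltr0Sn _ _) (ltr0Sn _ _).
  have e : n.+2%:R / n.+1%:R - 1 = n.+1%:R^-1 :> R.
    by rewrite -[n.+2]addn1 natrD mulrDl divff ?pnatr_eq0 // mul1r addrAC subrr add0r.
  rewrite e in h2; move: h1 h2; move: (n.+1%:R^-1) (n.+2%:R^-1) (ln _) (ln _) => p q l l'.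
  by move=> h1 h2; rewrite ler0_norm; lra.
have w0 n : 0 <= w n by rewrite invr_ge0.
have tc := telescoping_cvg tw w0.
exists (limn t) => -[//|n] _.
apply: (@dist_lim_le _ t _ _ n tc) => k nk.
apply: le_trans (dist_telescope_le nk (fun i _ => tw i)) _.
by rewrite gerBl.
Qed.

Lemma inv_nat_le_slog B : exists2 C : R, 0 < C & forall n, (0 < n)%N ->
  n%:R^-1 <= C / L n ^+ B.
Proof.
have [C C0 H] := @slog_le_powR R B 1 ltr01; exists C => // n n0.
have := H n n0; rewrite powRr1 // => h.
by rewrite ler_pdivlMr ?exprn_gt0 ?slog_gt0 // ler_pdivrMl ?ltr0n // mulrC.
Qed.

(** The series of [(Lambda k - 1) / k] converges at every log-power rate by [log_saving_series]; the
    harmonic sum supplies [ln n] and Euler's constant. *)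
Lemma mertens : PNT R -> exists c : R, forall B, exists2 C : R, 0 <= C &
  forall n, (0 < n)%N ->
  `|\sum_(1 <= k < n.+1) Lambda k / k%:R - ln n%:R - c| <= C / L n ^+ B.
Proof.
move=> pnt; have [c Hc] := log_saving_series pnt.
have [gamma Hg] := harmonic_asymp.
exists (c + gamma) => B; have [C HC] := Hc B; have [D D0 HD] := inv_nat_le_slog B.
have C0 : 0 <= C.
  by have := HC 1%N isT; rewrite slog1 expr1n divr1; apply: le_trans.
exists (C + D) => [|n n0]; first by rewrite addr_ge0 // ltW.
have -> : \sum_(1 <= k < n.+1) Lambda k / k%:R - ln n%:R - (c + gamma) =
  (\sum_(1 <= k < n.+1) (Lambda k - 1) / k%:R - c) +
  (\sum_(1 <= k < n.+1) k%:R^-1 - ln n%:R - gamma).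
  under [X in _ = X - _ + _]eq_bigr do rewrite mulrBl mul1r.
  by rewrite sumrB; lra.
rewrite mulrDl; apply: le_trans (ler_normD _ _) (lerD (HC n n0) _).
exact: le_trans (Hg n n0) (HD n n0).
Qed.

(** Partial summation, the summatory function of [Lambda] over the [k] not coprime to [Q] being at
    most [2 * ln Q * ln k]. *)
Lemma mangoldt_noncoprime_tail Q m n : (0 < Q)%N -> (0 < m <= n)%N ->
  \sum_(m.+1 <= k < n.+1 | ~~ coprime k Q) Lambda k / k%:R
  <= 2 * ln Q%:R * (L m / m%:R).
Proof.
move=> Q0 /andP[m0 mn].
pose A n := \sum_(1 <= k < n.+1 | ~~ coprime k Q) Lambda k.
have A_ge0 k : 0 <= A k by apply: sumr_ge0 => i _; exact: vonMangoldt_ge0.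
have HA k : A k <= 2 * ln Q%:R * ln k%:R.
  rewrite mulrAC; apply: sum_vonMangoldt_dvd_pow => // p i pp i0 _.
  by rewrite coprime_pexpl // prime_coprime // negbK.
(* Keeping the boundary term [A n / n] makes the induction on [n] close; the additive 1 in [L] pays
   for [n * (ln n.+1 - ln n) <= 1]. *)
suff H : \sum_(m.+1 <= k < n.+1 | ~~ coprime k Q) Lambda k / k%:R <=
    A n / n%:R + 2 * ln Q%:R * (L m / m%:R - L n / n%:R).
  apply: (le_trans H).
  have n0 := leq_trans m0 mn.
  have : A n / n%:R <= 2 * ln Q%:R * (L n / n%:R).
    rewrite mulrA ler_wpM2r ?invr_ge0 //; apply: le_trans (HA n) _.
    by rewrite ler_wpM2l ?mulr_ge0 ?ln_nat_ge0 // ln_le_slog.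
  by lra.
elim: n mn => [|n IH]; first by rewrite leqn0 => /eqP m00; rewrite m00 in m0.
rewrite leq_eqVlt => /predU1P[<-|].
  by rewrite big_geq // subrr mulr0 addr0 divr_ge0.
rewrite ltnS => mn; have {}IH := IH mn.
have n0 := leq_trans m0 mn.
rewrite big_mkcond big_nat_recr //= -big_mkcond /=.
have -> : A n.+1 = A n + (if ~~ coprime n.+1 Q then Lambda n.+1 else 0).
  by rewrite /A [LHS]big_mkcond big_nat_recr //= -big_mkcond.
set a := (X in A n + X); set b := if _ then _ else _.
have -> : b = a / n.+1%:R by rewrite /a /b; case: ifP; rewrite ?mul0r.
have step : A n / n%:R - A n / n.+1%:R <= 2 * ln Q%:R * (L n / n%:R - L n.+1 / n.+1%:R).
  have -> : A n / n%:R - A n / n.+1%:R = A n * (n%:R * n.+1%:R)^-1.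
    rewrite -natr1; field; have : 0 < n%:R :> R by rewrite ltr0n.
    by move=> np; rewrite !lt0r_neq0 //; lra.
  apply: (@le_trans _ _ (2 * ln Q%:R * (ln n%:R * (n%:R * n.+1%:R)^-1))).
    by rewrite mulrA ler_wpM2r ?invr_ge0 ?mulr_ge0.
  rewrite ler_wpM2l ?mulr_ge0 ?ln_nat_ge0 //.
  have np : 0 < n%:R :> R by rewrite ltr0n.
  have h := @ln_sub_le R n%:R n.+1%:R np (ltr0Sn _ _).
  have -> : L n / n%:R - L n.+1 / n.+1%:R =
    (n.+1%:R * L n - n%:R * L n.+1) * (n%:R * n.+1%:R)^-1.
    rewrite -natr1; field; by rewrite !lt0r_neq0 //; lra.
  rewrite ler_wpM2r ?invr_ge0 ?mulr_ge0 //.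
  have : n%:R * (ln n.+1%:R - ln n%:R) <= 1 :> R.
    apply: le_trans (ler_wpM2l (ltW np) h) _.
    by rewrite mulrBr mulr1 mulrCA divff ?gt_eqF // mulr1 -natr1; lra.
  by rewrite /slog -natr1; lra.
rewrite mulrDl; move: IH step; rewrite !mulrBr.
move: (\sum_(_ <= _ < _ | _) _) (a / _) (A n / n%:R) (A n / n.+1%:R).
move: (_ * (L m / _)) (_ * (L n / _)) (_ * (L n.+1 / _)).
by move=> *; lra.
Qed.

(** This is [moebius_ln] summed through [hyperbola]. Since [T_ Q y] is close to [ln y] plus a
    constant, the bracket on the right is almost constant, which forces [m_ Q x] times about [ln x]
    to be small. *)
Lemma mobius_sum_ln Q x : (0 < x)%N ->
  m_ Q x * ln x%:R = \sum_(1 <= a < x.+1 | coprime a Q)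
     mu a / a%:R * (ln (x%:R / a%:R) - T_ Q (x %/ a)).
Proof.
move=> x0.
have H : \sum_(1 <= n < x.+1 | coprime n Q) mu n / n%:R * ln n%:R =
  - \sum_(1 <= a < x.+1 | coprime a Q) mu a / a%:R * T_ Q (x %/ a).
  pose F a b := (if coprime a Q then mu a / a%:R else 0) *
                (if coprime b Q then Lambda b / b%:R else 0).
  transitivity (- \sum_(1 <= n < x.+1) \sum_(1 <= d < n.+1 | (d %| n)%N) F d (n %/ d)%N).
    rewrite -sumrN big_mkcond; apply: eq_big_nat => n /andP[n0 _].
    rewrite /F; case: ifPn => cn.
      rewrite mulrAC moebius_ln // mulNr mulr_suml; congr (- _).
      apply: eq_sum_nat => d /andP[d0 _] dn.
      have nE := divnK dn; move: cn; rewrite -{1}nE coprimeMl => /andP[-> ->].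
      rewrite -[in n%:R](divnK dn) natrM invfM.
      ring.
    rewrite big1_seq ?oppr0 // => d /andP[dn _].
    by move: cn; rewrite -{1}(divnK dn) coprimeMl; case: (coprime d Q); rewrite ?mul0r // andbT => /negbTE ->; rewrite mulr0.
  rewrite hyperbola; congr (- _); rewrite [RHS]big_mkcond; apply: eq_bigr => a _.
  rewrite /F.
  rewrite -mulr_sumr -big_mkcond /T_ /mangoldt_sum.
  by case: ifP => _; rewrite ?mul0r.
transitivity (\sum_(1 <= n < x.+1 | coprime n Q) mu n / n%:R * ln n%:R +
  \sum_(1 <= a < x.+1 | coprime a Q) mu a / a%:R * ln (x%:R / a%:R)).
  rewrite -big_split /= mulr_suml; apply: eq_sum_nat => n /andP[n0 _] _.
  by rewrite -mulrDr ln_div ?posrE ?ltr0n // addrC subrK.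
by rewrite H addrC -sumrB; apply: eq_bigr => a _; rewrite mulrBr.
Qed.

Lemma normr_moebius_div_le n : `|mu n / n%:R| <= n%:R^-1.
Proof.
by rewrite normrM normfV normr_nat ler_piMl ?invr_ge0 // normr_moebius_le1.
Qed.

Lemma mobius_sum_le Q x : `|m_ Q x| <= L x.
Proof.
apply: le_trans (ler_norm_sum _ _ _) (le_trans _ (harmonic_le x)).
rewrite big_mkcond; apply: ler_sum => n _; case: ifP => // _.
exact: normr_moebius_div_le.
Qed.

(* Axer's argument: the asymptotic formula for [F] handles [a <= x / Y], and partial
   summation against the increments of [m_ Q] handles the remaining [a]. *)
Lemma axer_mobius Q x Y (F : nat -> R) (kappa c eps M : R) :
  (0 < Y <= x)%N -> 0 <= kappa -> (forall n, 0 <= F n) ->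
  (forall m n, (m <= n)%N -> F m <= F n) ->
  (forall a, (0 < a <= x %/ Y)%N ->
     `|F (x %/ a)%N - kappa * ln (x%:R / a%:R) - c| <= eps) ->
  (forall t, (x %/ Y <= t <= x)%N -> `|m_ Q t| <= M) ->
  `|\sum_(1 <= a < x.+1 | coprime a Q)
      mu a / a%:R * (F (x %/ a)%N - kappa * ln (x%:R / a%:R) - c)|
  <= eps * L x + 2 * M * (F Y + kappa * ln Y%:R + `|c|).
Proof.
move=> /andP[Y0 Yx] k0 F0 Fmon Heps HM; set z := (x %/ Y)%N.
have x0 : (0 < x)%N by exact: leq_trans Yx.
have zx : (z <= x)%N by exact: leq_div.
have z0 : (0 < z)%N by rewrite divn_gt0.
have M0 : 0 <= M by apply: le_trans (HM x _); rewrite ?zx ?leqnn.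
have eps0 : 0 <= eps by apply: le_trans (Heps 1%N _); rewrite ?z0.
pose u a := if coprime a Q then mu a / a%:R else 0.
have uE n : \sum_(1 <= a < n.+1) u a = m_ Q n by rewrite [RHS]big_mkcond.
rewrite big_mkcond (eq_bigr (fun a => u a *
    (F (x %/ a)%N - kappa * ln (x%:R / a%:R) - c))); last first.
  by move=> a _; rewrite /u; case: ifP; rewrite ?mul0r.
rewrite (big_cat_nat (n := z.+1)) //=.
apply: le_trans (ler_normD _ _) (lerD _ _).
  apply: le_trans (ler_norm_sum _ _ _) _.
  apply: (@le_trans _ _ (\sum_(1 <= a < z.+1) eps * a%:R^-1)).
    apply: ler_sum_nat => a /andP[a0 az]; rewrite normrM mulrC.
    apply: ler_pM; rewrite ?normr_ge0 //; first by apply: Heps; rewrite a0.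
    rewrite /u; case: ifP => _; last by rewrite normr0 invr_ge0.
    exact: normr_moebius_div_le.
  rewrite -mulr_sumr ler_wpM2l //; apply: le_trans (harmonic_le z) _.
  exact: le_slog.
have [xz|ltzx] := leqP x z.
  rewrite big_geq // normr0 !mulr_ge0 // addr_ge0 ?normr_ge0 // addr_ge0 //.
  by rewrite mulr_ge0 // ln_nat_ge0.
have parts n : (z < n <= x)%N -> `|\sum_(z.+1 <= k < n.+1) u k| <= 2 * M.
  move=> /andP[zn nx].
  have -> : \sum_(z.+1 <= k < n.+1) u k = m_ Q n - m_ Q z.
    by rewrite -!uE [X in X - _](big_cat_nat (n := z.+1)) //= 1?ltnW // addrAC subrr add0r.
  apply: le_trans (ler_normB _ _) _.
  have := HM n; rewrite (ltnW zn) nx => /(_ isT).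
  by have := HM z; rewrite leqnn zx => /(_ isT); lra.
have Sz : (x %/ z.+1 < Y)%N.
  by rewrite ltn_divLR // mulnC -ltn_divLR.
have lnz : ln (x%:R / z.+1%:R) <= ln Y%:R :> R.
  rewrite ler_ln ?posrE ?divr_gt0 ?ltr0n // ler_pdivrMr ?ltr0n // -natrM ler_nat.
  by rewrite mulnC; apply: ltnW; rewrite -ltn_divLR.
have A1 : `|\sum_(z.+1 <= a < x.+1) u a * F (x %/ a)%N| <= 2 * M * F Y.
  apply: le_trans (@abel_monotone R u (fun a => F (x %/ a)%N) z x (2 * M) ltzx parts _ _) _.
  - by [].
  - move=> k /andP[zk _]; apply: Fmon; apply: leq_div2l => //.
    exact: leq_trans zk.
  - by rewrite ler_wpM2l ?mulr_ge0 // Fmon // ltnW.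
have A2 : `|\sum_(z.+1 <= a < x.+1) u a * ln (x%:R / a%:R)| <= 2 * M * ln Y%:R.
  apply: le_trans (@abel_monotone R u (fun a => ln (x%:R / a%:R)) z x (2 * M) ltzx parts _ _) _.
  - move=> k /andP[zk kx]; have k_gt0 := leq_trans z0 (ltnW zk).
    by rewrite ln_ge0 // ler_pdivlMr ?ltr0n // mul1r ler_nat.
  - move=> k /andP[zk _]; have k_gt0 := leq_trans z0 (ltnW zk).
    rewrite ler_ln ?posrE ?divr_gt0 ?ltr0n // ler_wpM2l //.
    by rewrite lef_pV2 ?posrE ?ltr0n // ler_nat.
  - by rewrite ler_wpM2l ?mulr_ge0.
have A3 : `|\sum_(z.+1 <= a < x.+1) u a| <= 2 * M by apply: parts; rewrite ltzx leqnn.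
have -> : \sum_(z.+1 <= a < x.+1) u a * (F (x %/ a)%N - kappa * ln (x%:R / a%:R) - c) =
  \sum_(z.+1 <= a < x.+1) u a * F (x %/ a)%N
  - kappa * \sum_(z.+1 <= a < x.+1) u a * ln (x%:R / a%:R)
  - (\sum_(z.+1 <= a < x.+1) u a) * c.
  rewrite mulr_sumr mulr_suml -!sumrB; apply: eq_bigr => a _; ring.
apply: le_trans (ler_normB _ _) _; rewrite mulrDr; apply: lerD; last first.
  by rewrite normrM ler_wpM2r.
apply: le_trans (ler_normB _ _) _; rewrite mulrDr; apply: lerD => //.
by rewrite normrM ger0_norm // mulrCA ler_wpM2l.
Qed.

Lemma mangoldt_sum_split Q n : \sum_(1 <= k < n.+1) Lambda k / k%:R =
  T_ Q n + \sum_(1 <= k < n.+1 | ~~ coprime k Q) Lambda k / k%:R.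
Proof. by rewrite (bigID (fun k => coprime k Q)). Qed.

Lemma mangoldt_term_ge0 k : 0 <= Lambda k / k%:R.
Proof. by rewrite divr_ge0 // vonMangoldt_ge0. Qed.

Lemma mangoldt_sum_ge0 Q n : 0 <= T_ Q n.
Proof. by apply: sumr_ge0 => k _; exact: mangoldt_term_ge0. Qed.

Lemma mangoldt_sum_mono Q m n : (m <= n)%N -> T_ Q m <= T_ Q n.
Proof.
move=> mn; rewrite /T_ /mangoldt_sum [leRHS](big_cat_nat (n := m.+1)) //=.
by rewrite lerDl sumr_ge0 // => k _; exact: mangoldt_term_ge0.
Qed.

Local Notation s_ x := (Num.sqrt (L x)).

Lemma sqrt_slog_ge1 x : 1 <= s_ x.
Proof. by rewrite -[X in X <= _]sqrtr1 ler_wsqrtr // slog_ge1. Qed.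

Lemma sqrt_slog_sqr x : s_ x ^+ 2 = L x.
Proof. by rewrite sqr_sqrtr // slog_ge0. Qed.

Lemma ler_inv_exp (a b : R) n : 0 < a -> a <= b -> b ^- n <= a ^- n.
Proof.
move=> a0 ab; have b0 := lt_le_trans a0 ab.
by rewrite lef_pV2 ?posrE ?exprn_gt0 // lerXn2r ?nnegrE ?(ltW a0) ?(ltW b0).
Qed.

(* [Y] is about [expR (Num.sqrt (L x))]. *)
Lemma mobius_cutoff x : 4 <= s_ x -> exists Y, [/\ (1 < Y)%N, (Y * Y <= x)%N,
   s_ x <= L Y & ln Y%:R <= s_ x + 1].
Proof.
set s := s_ x => s4; have s2 : s ^+ 2 = L x := sqrt_slog_sqr x.
pose Y := (Num.truncn (expR s)).+1.
have x0 : (0 < x)%N.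
  by rewrite lt0n; apply: contraTneq s4 => x0; rewrite /s x0 /slog ln0 // addr0 sqrtr1 -ltNge; lra.
have Ygt : expR s < Y%:R by exact: truncnS_gt.
have e1 : 1 <= expR s by rewrite -expR0 ler_expR; lra.
have Yle : Y%:R <= 2 * expR s.
  have : Y%:R <= expR s + 1.
    by rewrite /Y -natr1 lerD2r truncn_le expR_ge0.
  lra.
exists Y; split.
- by rewrite ltnS truncn_gt0.
(* [x = expR (s ^+ 2 - 1)], and [4 <= expR 3], so the claim reduces to [2 * s + 3 <= s ^+ 2 - 1],
   true for [s >= 4]. *)
- rewrite -(ler_nat R) natrM; apply: le_trans (_ : (2 * expR s) * (2 * expR s) <= _).
    by apply: ler_pM.
  have -> : x%:R = expR (s ^+ 2 - 1) :> R.
    by rewrite s2 /slog addrAC subrr add0r lnK // posrE ltr0n.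
  have e3 : 4 <= expR 3 :> R by have := @expR_ge1Dx R 3; lra.
  apply: le_trans (_ : expR 3 * (expR s * expR s) <= _).
    have : 0 <= expR s * expR s by rewrite mulr_ge0 ?expR_ge0.
    by nra.
  by rewrite -!expRD ler_expR; nra.
- have : ln (expR s) <= ln Y%:R by rewrite ler_ln ?posrE ?expR_gt0 ?ltr0n // ltW.
  by rewrite expRK /slog; lra.
- have : ln Y%:R <= ln (2 * expR s) by rewrite ler_ln ?posrE ?mulr_gt0 ?expR_gt0 ?ltr0n.
  rewrite lnM ?posrE ?expR_gt0 // expRK.
  by have := @ln_le_sub1 R 2 (ltr0Sn _ _); lra.
Qed.

(** On the range of [t] met in Axer's argument, [L t] is thus at least [L x / 4], and [Q <= x ^ j]
    implies [Q <= t ^ (3 * j)]: bounds known at [t] transfer to [x]. *)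
Lemma cutoff_cube x Y t : (1 < Y)%N -> (Y * Y <= x)%N -> (x %/ Y <= t)%N -> (x <= t ^ 3)%N.
Proof.
move=> Y1 Yx zt; have Y0 := ltnW Y1.
have Yz : (Y <= x %/ Y)%N by rewrite leq_divRL.
have := ltn_ceil x Y0; set z := (x %/ Y)%N in zt Yz * => xz.
apply: leq_trans (_ : z ^ 3 <= _)%N; last by rewrite leq_exp2r.
by rewrite !expnS expn0; nia.
Qed.

(* [m_ Q x * ln x] is, up to [c0 * m_ Q x], a sum to which Axer's argument applies; with the
   cutoff of [mobius_cutoff], a bound [C / s ^+ b] for [m_ Q] near [x] loses a
   factor [s = sqrt (L x)] and the division by [L x = s ^+ 2] then gains two. *)
Lemma mobius_sum_bootstrap b : PNT R -> forall j, exists2 C : R, 0 <= C &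
  forall x Q, (0 < x)%N -> (0 < Q)%N -> (Q <= x ^ j)%N ->
  `|m_ Q x| <= C * (s_ x ^+ 2 / s_ x ^+ b).
Proof.
move=> pnt; elim: b => [|b IH] j.
  exists 1 => // x Q x0 _ _.
  by rewrite mul1r expr0 divr1 sqrt_slog_sqr mobius_sum_le.
have [c Hc] := mertens pnt.
have [C1 C1_ge0 H1] := Hc b.+1; have [C0 C0_ge0 H0] := Hc 0%N.
have [D D0 HD] := @slog_le_powR R b.+2 1 ltr01.
(* The induction hypothesis is used at arguments [t] with [x <= t ^ 3], where [Q] is only bounded by
   [t ^ (3 * j)]; hence [j] is quantified inside the induction. *)
have [Cb Cb0 Hb] := IH (3 * j)%N.
pose K0 := 2 * `|c| + C0 + 1.
have K1 : 1 <= K0 by have := normr_ge0 c; rewrite /K0; lra.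
pose E1 := C1 + (2 * j.+1%:R + 1) * D.
have E10 : 0 <= E1 by rewrite addr_ge0 // mulr_ge0 ?(ltW D0) // addr_ge0 // mulr_ge0.
pose E := 2 * (E1 + 8 * (Cb * 2 ^+ b) * (1 + K0)).
have E0 : 0 <= E.
  by rewrite mulr_ge0 // addr_ge0 // !mulr_ge0 ?exprn_ge0 //; lra.
exists (E + (4 * (1 + K0)) ^+ b.+1) => [|x Q x0 Q0 Qx].
  by rewrite addr_ge0 // exprn_ge0 // mulr_ge0 //; lra.
set s := s_ x; have s1 : 1 <= s := sqrt_slog_ge1 x; have s2 : s ^+ 2 = L x := sqrt_slog_sqr x.
have s_gt0 : 0 < s by lra.
have sq0 : 0 <= s ^+ 2 / s ^+ b.+1 by rewrite divr_ge0 // exprn_ge0 // ltW.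
(* For bounded [s] the trivial bound [L x = s ^+ 2] suffices thanks to the second summand of the
   constant. Large [s] is needed both for the cutoff and for the lower bound on [ln x + c0]. *)
rewrite mulrDl; have [sS|Ss] := ltP s (4 * (1 + K0)).
  apply: le_trans (mobius_sum_le Q x) _; rewrite -s2 -[leLHS]add0r lerD ?(mulr_ge0 E0 sq0) //.
  rewrite mulrCA ler_peMr ?sqr_ge0 // ler_pdivlMr ?exprn_gt0 // mul1r.
  by rewrite lerXn2r ?nnegrE ?(ltW s_gt0) ?(ltW sS) // ltW // (lt_trans s_gt0).
have K4 : 0 <= 4 * (1 + K0) by rewrite mulr_ge0 //; lra.
rewrite -[leLHS]addr0 lerD ?(mulr_ge0 (exprn_ge0 _ K4) sq0) //.
have [Y [Y1 YYx sLY lnY]] : exists Y, [/\ (1 < Y)%N, (Y * Y <= x)%N, s <= L Y & ln Y%:R <= s + 1].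
  by apply: mobius_cutoff; rewrite -/s; lra.
have Y0 : (0 < Y)%N by exact: ltnW.
pose V n := \sum_(1 <= k < n.+1 | ~~ coprime k Q) Lambda k / k%:R.
have V0 n : 0 <= V n by apply: sumr_ge0 => k _; exact: mangoldt_term_ge0.
have TY : T_ Q Y + V Y <= s + K0.
  rewrite -mangoldt_sum_split.
  have := H0 Y Y0; rewrite expr0 divr1 => h.
  have := le_trans (ler_norm _) h; have := ler_norm c; have := normr_ge0 c.
  by rewrite /K0; lra.
(* The part of the Mertens sum not coprime to [Q] is frozen at [Y]: for [y >= Y] its growth is
   negligible by [mangoldt_noncoprime_tail], so [T_ Q y] is close to [ln y + c0]. The constant
   depends on [Q], but only through [|c0| = O(s)]. *)
pose c0 := c - V Y.
have c0_le : `|c0| <= s + 2 * K0.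
  apply: le_trans (ler_normB _ _) _; rewrite (ger0_norm (V0 Y)).
  by have := mangoldt_sum_ge0 Q Y; have := normr_ge0 c; rewrite /K0 in TY *; lra.
have key : m_ Q x * (ln x%:R + c0) = - \sum_(1 <= a < x.+1 | coprime a Q)
   mu a / a%:R * (T_ Q (x %/ a)%N - 1 * ln (x%:R / a%:R) - c0).
  rewrite mulrDr mobius_sum_ln // /m_ /mobius_sum mulr_suml -big_split -sumrN.
  by apply: eq_bigr => a _ /=; ring.
pose eps := E1 * (s ^+ 2 / s ^+ b.+1).
pose M := Cb * 2 ^+ b * (s ^+ 2 / s ^+ b).
have HM t : (x %/ Y <= t <= x)%N -> `|m_ Q t| <= M.
  move=> /andP[zt tx]; have xt3 := cutoff_cube Y1 YYx zt.
  have t0 : (0 < t)%N by rewrite lt0n; apply: contraTneq xt3 => ->; rewrite -ltnNge.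
  have Qt : (Q <= t ^ (3 * j))%N.
    by rewrite expnM; apply: leq_trans Qx _; case: (j) => // k; rewrite leq_exp2r.
  apply: le_trans (Hb t Q t0 Q0 Qt) _.
  rewrite /M -(mulrA Cb) ler_wpM2l //.
  have t2 : s_ t ^+ 2 <= s ^+ 2 by rewrite s2 sqrt_slog_sqr le_slog.
  have st : s / 2 <= s_ t.
    rewrite -(@ler_pXn2r _ 2) ?nnegrE ?divr_ge0 ?(ltW s_gt0) ?sqrtr_ge0 //.
    have := @slog_le_exp R x t 3 xt3; rewrite expr_div_n s2 sqrt_slog_sqr; lra.
  have h : (s_ t) ^- b <= 2 ^+ b * s ^- b.
    have -> : 2 ^+ b * s ^- b = (s / 2) ^- b.
      by rewrite expr_div_n invfM invrK mulrC.
    by apply: ler_inv_exp => //; rewrite divr_gt0.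
  by rewrite mulrCA; apply: ler_pM => //; rewrite invr_ge0 exprn_ge0 // sqrtr_ge0.
have Heps a : (0 < a <= x %/ Y)%N ->
     `|T_ Q (x %/ a)%N - 1 * ln (x%:R / a%:R) - c0| <= eps.
  move=> /andP[a0 az]; set y := (x %/ a)%N.
  have Yy : (Y <= y)%N by rewrite leq_divRL // mulnC -leq_divRL.
  have y0 : (0 < y)%N by exact: leq_trans Yy.
  pose w := s ^- b.+1.
  have w0 : 0 <= w by rewrite invr_ge0 exprn_ge0 // ltW.
  have e1 : `|\sum_(1 <= k < y.+1) Lambda k / k%:R - ln y%:R - c| <= C1 * w.
    apply: le_trans (H1 y y0) _; rewrite ler_wpM2l //; apply: ler_inv_exp => //.
    by apply: (le_trans sLY); exact: le_slog.
  have LYY : L Y / Y%:R <= D * w.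
    apply: (@le_trans _ _ (D * L Y ^- b.+1)); last first.
      by rewrite ler_wpM2l ?(ltW D0) //; exact: ler_inv_exp.
    have := HD Y Y0; rewrite powRr1 // exprS => h.
    by rewrite ler_pdivrMr ?ltr0n // mulrAC ler_pdivlMr ?exprn_gt0 ?slog_gt0.
  have e2 : V y - V Y <= 2 * (j.+1%:R * s ^+ 2) * (D * w).
    have -> : V y - V Y = \sum_(Y.+1 <= k < y.+1 | ~~ coprime k Q) Lambda k / k%:R.
      by rewrite /V [X in X - _](big_cat_nat (n := Y.+1)) //= addrAC subrr add0r.
    apply: le_trans (mangoldt_noncoprime_tail _ _) _ => //; first by rewrite Y0.
    have lnQ : ln Q%:R <= j.+1%:R * s ^+ 2 :> R.
      by rewrite s2; apply: le_trans (ln_le_slog Q) _; exact: slog_le_exp.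
    apply: ler_pM => //; first by rewrite mulr_ge0 // ln_nat_ge0.
      by rewrite divr_ge0 // slog_ge0.
    by rewrite ler_wpM2l.
  have e2' : 0 <= V y - V Y.
    rewrite subr_ge0 /V [leRHS](big_cat_nat (n := Y.+1)) //= lerDl.
    by apply: sumr_ge0 => k _; exact: mangoldt_term_ge0.
  have a0' : 0 < a%:R :> R by rewrite ltr0n.
  have y0' : 0 < y%:R :> R by rewrite ltr0n.
  have yxa : y%:R <= x%:R / a%:R :> R.
    by rewrite ler_pdivlMr // -natrM ler_nat leq_divM.
  have xay : x%:R / a%:R <= y%:R + 1 :> R.
    by rewrite ler_pdivrMr // natr1 -natrM ler_nat ltnW // ltn_ceil.
  have e3 : ln (x%:R / a%:R) - ln y%:R <= D * w.
    apply: le_trans (ln_sub_le _ _) _ => //; first exact: lt_le_trans yxa.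
    apply: (@le_trans _ _ (L Y / Y%:R)) => //.
    apply: (@le_trans _ _ (y%:R^-1)).
      by rewrite lerBlDr ler_pdivrMr // mulrDl mulVf ?gt_eqF // mul1r addrC.
    apply: (@le_trans _ _ (Y%:R^-1)); first by rewrite lef_pV2 ?posrE ?ltr0n // ler_nat.
    by rewrite ler_peMl ?invr_ge0 // slog_ge1.
  have e3' : 0 <= ln (x%:R / a%:R) - ln y%:R :> R.
    by rewrite subr_ge0 ler_ln ?posrE // (lt_le_trans y0').
  have -> : T_ Q y - 1 * ln (x%:R / a%:R) - c0 =
    (\sum_(1 <= k < y.+1) Lambda k / k%:R - ln y%:R - c) - (V y - V Y)
     - (ln (x%:R / a%:R) - ln y%:R).
    by rewrite (mangoldt_sum_split Q) /c0 -/(V y); ring.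
  apply: le_trans (ler_normB _ _) _; rewrite (ger0_norm e3').
  apply: le_trans (lerD (ler_normB _ _) e3) _; rewrite (ger0_norm e2').
  apply: le_trans (lerD (lerD e1 e2) (lexx _)) _.
  have s21 : 1 <= s ^+ 2 by rewrite exprn_ege1.
  have hw : w <= s ^+ 2 * w by rewrite ler_peMl.
  have -> : eps = C1 * (s ^+ 2 * w) + 2 * (j.+1%:R * s ^+ 2) * (D * w) + D * (s ^+ 2 * w).
    by rewrite /eps -/w /E1; ring.
  apply: lerD; last by rewrite ler_wpM2l // ltW.
  by apply: lerD => //; rewrite ler_wpM2l.
have Yx : (0 < Y <= x)%N by rewrite Y0 (leq_trans _ YYx) // leq_pmulr.
have := @axer_mobius Q x Y (T_ Q) 1 c0 eps M Yx ler01 (mangoldt_sum_ge0 Q)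
   (@mangoldt_sum_mono Q) Heps HM.
rewrite -normrN -key mul1r normrM -s2 => H.
pose q := s ^+ 2 / s ^+ b.+1.
have Mq : M * s = Cb * 2 ^+ b * (q * s ^+ 2).
  rewrite /M /q -(mulrA (Cb * _)); congr (_ * _).
  have sb : s ^+ b != 0 by rewrite expf_neq0 // gt_eqF.
  have s0 : s != 0 by rewrite gt_eqF.
  by rewrite (exprS s b); field; rewrite sb s0.
have B : T_ Q Y + ln Y%:R + `|c0| <= 4 * (1 + K0) * s.
  have := V0 Y; have : K0 <= K0 * s by rewrite ler_peMr //; lra.
  by lra.
have M_ge0 : 0 <= M by rewrite !mulr_ge0 ?invr_ge0 ?exprn_ge0 // ltW.
(* [ln x] is [s ^+ 2 - 1] while [c0] is only of order [s], and [s] exceeds [4 * (1 + K0)]. *)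
have Lx : s ^+ 2 / 2 <= `|ln x%:R + c0|.
  have lnx : ln x%:R = s ^+ 2 - 1 by rewrite s2 /slog; ring.
  have h1 := ler_norm (ln x%:R + c0); have h2 := ler_norm (- c0); rewrite normrN in h2.
  have : 4 * (1 + K0) * s <= s ^+ 2 by rewrite expr2 ler_wpM2r // ltW.
  have : K0 <= K0 * s by rewrite ler_peMr //; lra.
  by rewrite lnx in h1 *; lra.
have : `|m_ Q x| * (s ^+ 2 / 2) <= E * q * (s ^+ 2 / 2).
  apply: le_trans (ler_wpM2l (normr_ge0 _) Lx) _; apply: (le_trans H).
  apply: (@le_trans _ _ (eps * s ^+ 2 + 2 * M * (4 * (1 + K0) * s))).
    by rewrite lerD2l ler_wpM2l // mulr_ge0.
  have -> : 2 * M * (4 * (1 + K0) * s) = 8 * (1 + K0) * (M * s) by ring.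
  by rewrite Mq /eps -/q /E le_eqVlt; apply/orP; left; apply/eqP; field.
by rewrite ler_pM2r // divr_gt0 // exprn_gt0.
Qed.

Lemma mobius_sum_small : PNT R -> forall j B, exists2 C : R, 0 <= C &
  forall x Q, (0 < x)%N -> (0 < Q)%N -> (Q <= x ^ j)%N ->
  `|m_ Q x| <= C / L x ^+ B.
Proof.
move=> pnt j B; have [C C0 HC] := mobius_sum_bootstrap (B * 2 + 2) pnt j.
exists C => // x Q x0 Q0 Qx; apply: le_trans (HC x Q x0 Q0 Qx) _.
rewrite ler_wpM2l // exprD mulnC exprM sqrt_slog_sqr invfM mulrCA divff ?mulr1 //.
by rewrite gt_eqF // slog_gt0.
Qed.

End MobiusSums.

(** * Moebius sums weighted by a logarithm *)

Lemma nat_sqrt_exists x : exists r, (r * r <= x < r.+1 * r.+1)%N.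
Proof.
elim: x => [|x [r /andP[h1 h2]]]; first by exists 0%N.
by case: (leqP (r.+1 * r.+1)%N x.+1) => h; [exists r.+1|exists r]; lia.
Qed.

Lemma prod_primes_le n : (0 < n)%N -> (\prod_(p <- primes n) p <= n)%N.
Proof.
move=> n0; rewrite [leqRHS](prod_prime_decomp n0) prime_decompE big_map /=.
rewrite big_seq [leqRHS]big_seq; apply: leq_prod => p pn.
rewrite -{1}[p]expn1 leq_pexp2l ?logn_gt0 //.
by move: pn; rewrite mem_primes => /and3P[/prime_gt0].
Qed.

(** Each prime factor [p >= 2 ^ m] of [Q] pays for its own factor [2 ^ m], and there are at most
    [2 ^ m] smaller ones. So [2 ^ omega Q] lies below any positive power of [Q], up to a
    constant. *)
Lemma two_pow_omega_pow_le m Q : (0 < Q)%N ->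
  ((2 ^ size (primes Q)) ^ m <= (2 ^ m) ^ (2 ^ m) * Q)%N.
Proof.
move=> Q0; rewrite -expnM mulnC expnM.
have -> : ((2 ^ m) ^ size (primes Q) = \prod_(p <- primes Q) 2 ^ m)%N.
  by rewrite big_const_seq count_predT iter_muln_1.
apply: (@leq_trans (\prod_(p <- primes Q) ((if (p < 2 ^ m)%N then 2 ^ m else 1) * p))%N).
  rewrite big_seq [leqRHS]big_seq; apply: leq_prod => p.
  rewrite mem_primes => /and3P[/prime_gt0 p0 _ _].
  by case: ltnP => h; rewrite ?mul1n // leq_pmulr.
rewrite big_split /= leq_mul ?prod_primes_le //.
rewrite -big_mkcond big_const_seq iter_muln_1 leq_pexp2l ?expn_gt0 //.
rewrite -size_filter -[leqRHS](size_iota 0); apply: uniq_leq_size.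
  by rewrite filter_uniq // primes_uniq.
by move=> p; rewrite mem_filter mem_iota => /andP[].
Qed.

Definition mobius_log_sum {R : realType} (Q x : nat) : R :=
  \sum_(1 <= n < x.+1 | coprime n Q) moebius n / n%:R * ln n%:R.

Section MobiusLogSums.
Context {R : realType}.
Local Notation L := (@slog R).
Local Notation mu := (@moebius R).
Local Notation m_ := (@mobius_sum R).

(** The exponent 1/4 is a choice: any exponent below 1/2 wins against the cutoff near [sqrt x] in
    [mobius_log_sum_small]. It results from a root of order [m = 4 * j.+1]. *)
Lemma two_pow_omega_powR j : exists2 C : R, 0 < C & forall Q x, (0 < Q)%N -> (0 < x)%N ->
  (Q <= x ^ j)%N -> 2 ^+ size (primes Q) <= C * x%:R `^ 4^-1 :> R.
Proof.
pose m := (4 * j.+1)%N; pose K := ((2 ^ m) ^ (2 ^ m))%N.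
have m0 : (m%:R : R) != 0 by rewrite pnatr_eq0.
exists (K%:R `^ m%:R^-1) => [|Q x Q0 x0 Qx].
  by rewrite powR_gt0 // ltr0n !expn_gt0.
have h : ((2 ^ size (primes Q)) ^ m)%:R <= K%:R * (x ^ j.+1)%:R :> R.
  rewrite -natrM ler_nat; apply: leq_trans (two_pow_omega_pow_le m Q0) _.
  by rewrite leq_mul2l (leq_trans Qx) ?orbT // leq_pexp2l.
have e (y : R) : 0 <= y -> y = (y ^+ m) `^ m%:R^-1.
  by move=> y0; rewrite -powR_mulrn // -powRrM divff // powRr1.
rewrite [leLHS]e ?exprn_ge0 //.
have -> : x%:R `^ 4^-1 = ((x ^ j.+1)%:R : R) `^ m%:R^-1.
  rewrite natrX -powR_mulrn // -powRrM /m natrM; congr (_ `^ _).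
  by rewrite invfM mulrCA divff ?mulr1 // pnatr_eq0.
rewrite -powRM // ge0_ler_powR ?nnegrE ?invr_ge0 ?mulr_ge0 ?exprn_ge0 //.
by rewrite -!natrX.
Qed.

(** The argument is real and may lie below 1 ([n = 0]): the formula is applied at [t / d] for all
    divisors [d] of a modulus, including those beyond [t]. There [C / t] absorbs [ln t] and the
    constant. *)
Lemma harmonic_asymp_real : exists gamma C : R, 0 <= C /\ forall n (t : R),
  0 < t -> n%:R <= t < n%:R + 1 ->
  `|\sum_(1 <= k < n.+1) k%:R^-1 - ln t - gamma| <= C / t.
Proof.
have [gamma H] := @harmonic_asymp R; exists gamma, (4 + `|gamma|).
split=> [|n t t0 /andP[nt tn]]; first by rewrite addr_ge0.
have g0 := normr_ge0 gamma.
case: n nt tn => [|n] nt tn.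
  rewrite big_geq // sub0r; apply: le_trans (ler_normB _ _) _; rewrite normrN.
  have ti : 1 <= t^-1 by rewrite -invr1 lef_pV2 ?posrE //; lra.
  have lt : `|ln t| <= t^-1.
    rewrite ler0_norm; last by rewrite ln_le0 //; lra.
    rewrite -lnV ?posrE //; apply: le_trans (ln_le_sub1 _) _; rewrite ?invr_gt0 //; lra.
  rewrite mulrDl; apply: (@le_trans _ _ (1 * t^-1 + `|gamma| * t^-1)).
    by rewrite mul1r lerD // ler_peMr.
  by rewrite lerD2r ler_wpM2r ?invr_ge0 ?(ltW t0) //; lra.
have n0 : 0 < n.+1%:R :> R by rewrite ltr0n.
have n1 : 1 <= n.+1%:R :> R by rewrite ler1n.
have h := H n.+1 isT.
have h1 : ln t - ln n.+1%:R <= n.+1%:R^-1.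
  apply: le_trans (ln_sub_le n0 t0) _.
  by rewrite lerBlDr ler_pdivrMr // mulrDl mulVf ?gt_eqF // mul1r; lra.
have h2 : 0 <= ln t - ln n.+1%:R by rewrite subr_ge0 ler_ln ?posrE.
have h3 : n.+1%:R^-1 <= 2 / t.
  by rewrite ler_pdivlMr // ler_pdivrMl //; lra.
have -> : \sum_(1 <= k < n.+2) k%:R^-1 - ln t - gamma =
  (\sum_(1 <= k < n.+2) k%:R^-1 - ln n.+1%:R - gamma) - (ln t - ln n.+1%:R) by ring.
apply: le_trans (ler_normB _ _) _; rewrite (ger0_norm h2).
apply: (@le_trans _ _ (2 / t + 2 / t)); first by apply: lerD; apply: le_trans h3.
by rewrite -mulrDl ler_wpM2r ?invr_ge0 ?(ltW t0) //; lra.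
Qed.

Definition coprime_harmonic Q y : R := \sum_(1 <= k < y.+1 | coprime k Q) k%:R^-1.

Lemma coprime_indicator Q k : (0 < Q)%N -> (0 < k)%N ->
  \sum_(1 <= d < Q.+1 | (d %| Q)%N && (d %| k)%N) mu d = (coprime k Q)%:R.
Proof.
move=> Q0 k0; rewrite (eq_bigl (fun d => d %| gcdn Q k)%N); last first.
  by move=> d; rewrite dvdn_gcd.
rewrite sum_divisors_widen; last by rewrite gcdn_gt0 Q0 (dvdn_leq Q0 (dvdn_gcdl _ _)).
by rewrite sum_moebius ?gcdn_gt0 ?Q0 // gcdnC.
Qed.

Lemma coprime_harmonicE Q y : (0 < Q)%N ->
  coprime_harmonic Q y = \sum_(1 <= d < Q.+1 | (d %| Q)%N)
    mu d / d%:R * \sum_(1 <= k < (y %/ d).+1) k%:R^-1.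
Proof.
move=> Q0; rewrite /coprime_harmonic big_mkcond.
transitivity (\sum_(1 <= k < y.+1) \sum_(1 <= d < Q.+1 | (d %| Q)%N)
    (if (d %| k)%N then mu d / k%:R else 0)).
  apply: eq_big_nat => k /andP[k0 _].
  have -> : (if coprime k Q then k%:R^-1 else 0) = (coprime k Q)%:R * k%:R^-1 :> R.
    by case: coprime; rewrite ?mul1r ?mul0r.
  by rewrite -coprime_indicator // mulr_suml big_mkcondr.
rewrite exchange_big /=; apply: eq_sum_nat => d /andP[d0 _] _.
rewrite -big_mkcond sum_multiples // mulr_sumr; apply: eq_bigr => k _.
by rewrite natrM invfM mulrA.
Qed.

Lemma sum_moebius_div Q : (0 < Q)%N ->
  \sum_(1 <= d < Q.+1 | (d %| Q)%N) mu d / d%:R = (Q%:R / (totient Q)%:R)^-1.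
Proof.
move=> Q0; rewrite (@euler_divisors R Q (fun d => d%:R^-1)) ?invr1 //; last first.
  by move=> p d _ _ _; rewrite natrM invfM.
rewrite natr_div_totient // -prodfV; apply: eq_big_seq => p.
rewrite mem_primes => /and3P[/prime_gt0 p0 _ _].
have p0' : p%:R != 0 :> R by rewrite pnatr_eq0 -lt0n.
rewrite invf_div; have -> : p.-1%:R = p%:R - 1 :> R.
  by rewrite -[in RHS](prednK p0) -natr1 addrK.
by rewrite mulrBl divff // mul1r.
Qed.

Lemma sum_normr_moebius Q : (0 < Q)%N ->
  \sum_(1 <= d < Q.+1 | (d %| Q)%N) `|mu d| = 2 ^+ size (primes Q).
Proof.
move=> Q0; have := @euler_divisors R Q mu Q0 moebius1.
rewrite (eq_bigr (fun d => `|mu d|)); last first.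
  by move=> d _; rewrite -expr2 moebius_sqr normr_moebius.
move=> ->; last first.
  by move=> p d pp d0 pd; rewrite moebiusMp // (negbTE pd) (moebius_prime pp) mulN1r.
rewrite (eq_big_seq (fun=> 2)); last first.
  by move=> p; rewrite mem_primes => /and3P[pp _ _]; rewrite moebius_prime // opprK.
by rewrite big_const_seq count_predT iter_mulr_1.
Qed.

Lemma totient_ratio_bounds Q : (0 < Q)%N ->
  1 <= (Q%:R / (totient Q)%:R : R) <= 2 * L Q.
Proof.
move=> Q0; apply/andP; split; last first.
  by apply: le_trans (div_totient_le Q0) _; rewrite /slog; lra.
rewrite ler_pdivlMr ?ltr0n ?totient_gt0 // mul1r ler_nat.
rewrite -[leqRHS](cyclic.sum_totient_dvd Q) -(big_mkord (fun d => d %| Q)%N).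
by rewrite big_mkcond big_nat_recr //= dvdnn leq_addl.
Qed.

(** Detecting coprimality by [mu] on the divisors of [Q] reduces to harmonic sums at [t / d]. The
    coefficient of [ln t] is then [phi Q / Q], and each squarefree divisor adds an error [O(1 / t)],
    whence [2 ^ omega]. The crude bound on the constant term suffices against arbitrary log
    savings. *)
Lemma coprime_harmonic_asymp : exists C : R, 0 <= C /\ forall Q, (0 < Q)%N ->
  exists c : R, `|c| <= C * L Q ^+ 2 /\ forall n (t : R),
  0 < t -> n%:R <= t < n%:R + 1 ->
  `|coprime_harmonic Q n - (Q%:R / (totient Q)%:R)^-1 * ln t - c|
  <= C * 2 ^+ size (primes Q) / t.
Proof.
have [gamma [C [C0 H]]] := harmonic_asymp_real.
exists (C + 1 + `|gamma|); split=> [|Q Q0]; first by rewrite !addr_ge0.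
pose c := \sum_(1 <= d < Q.+1 | (d %| Q)%N) mu d / d%:R * (gamma - ln d%:R).
exists c; split.
  apply: le_trans (ler_norm_sum _ _ _) _.
  have LQ := @slog_ge1 R Q.
  apply: (@le_trans _ _ (\sum_(1 <= d < Q.+1) ((C + 1 + `|gamma|) * L Q) * d%:R^-1)).
    rewrite big_mkcond; apply: ler_sum_nat => d /andP[d0 dQ].
    case: ifP => _; last by rewrite !mulr_ge0 ?invr_ge0 ?slog_ge0 ?addr_ge0.
    rewrite normrM mulrC; apply: ler_pM => //; last exact: normr_moebius_div_le.
    apply: le_trans (ler_normB _ _) _; rewrite (ger0_norm (ln_nat_ge0 _)).
    have h : ln d%:R <= L Q :> R.
      by apply: le_trans (ln_le_slog _) _; apply: le_slog.
    have := normr_ge0 gamma => g0.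
    have : `|gamma| <= `|gamma| * L Q by rewrite ler_peMr.
    have : 0 <= C * L Q by rewrite mulr_ge0 ?slog_ge0.
    by lra.
  rewrite -mulr_sumr expr2 mulrA ler_wpM2l ?harmonic_le //.
  by rewrite mulr_ge0 ?slog_ge0 // !addr_ge0.
move=> n t t0 /andP[nt tn].
rewrite coprime_harmonicE // -sum_moebius_div // mulr_suml -sumrB -sumrB.
apply: le_trans (ler_norm_sum _ _ _) _.
rewrite -sum_normr_moebius // mulr_sumr mulr_suml.
rewrite big_mkcond [leRHS]big_mkcond; apply: ler_sum_nat => d /andP[d0 _].
case: ifP => // _.
have d0' : 0 < d%:R :> R by rewrite ltr0n.
rewrite -mulrBr -mulrBr normrM normrM normfV normr_nat.
have -> : \sum_(1 <= k < (n %/ d).+1) k%:R^-1 - ln t - (gamma - ln d%:R) =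
  \sum_(1 <= k < (n %/ d).+1) k%:R^-1 - ln (t / d%:R) - gamma :> R.
  by rewrite ln_div ?posrE //; ring.
have h : `|\sum_(1 <= k < (n %/ d).+1) k%:R^-1 - ln (t / d%:R) - gamma| <= C / (t / d%:R).
  apply: H; first by rewrite divr_gt0.
  rewrite ler_pdivlMr // ltr_pdivrMr //; apply/andP; split.
    by apply: le_trans nt; rewrite -natrM ler_nat leq_divM.
  apply: (lt_le_trans tn); rewrite !natr1 -natrM ler_nat; exact: ltn_ceil.
rewrite -mulrA; apply: le_trans (ler_wpM2l (normr_ge0 _) (ler_wpM2l _ h)) _.
  by rewrite invr_ge0.
have -> : `|mu d| * (d%:R^-1 * (C / (t / d%:R))) = C * `|mu d| / t.
  by field; rewrite !gt_eqF.
rewrite ler_wpM2r ?invr_ge0 ?(ltW t0) // ler_wpM2r // -addrA lerDl.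
by rewrite addr_ge0.
Qed.

Lemma coprime_harmonic_mobius Q x : (0 < Q)%N -> (0 < x)%N ->
  \sum_(1 <= a < x.+1 | coprime a Q) mu a / a%:R * coprime_harmonic Q (x %/ a) = 1.
Proof.
move=> Q0 x0.
pose F a b := (if coprime a Q then mu a / a%:R else 0) *
              (if coprime b Q then b%:R^-1 else 0).
transitivity (\sum_(1 <= n < x.+1) \sum_(1 <= d < n.+1 | (d %| n)%N) F d (n %/ d)%N).
  rewrite hyperbola big_mkcond; apply: eq_bigr => a _; rewrite /F -mulr_sumr -big_mkcond.
  by case: ifP; rewrite ?mul0r.
transitivity (\sum_(1 <= n < x.+1) (if coprime n Q then (n == 1%N)%:R / n%:R else 0) : R).
  apply: eq_big_nat => n /andP[n0 _]; rewrite /F.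
  case: ifPn => cn; last first.
    rewrite big1_seq // => d /andP[dn _].
    move: cn; rewrite -{1}(divnK dn) coprimeMl; case: (coprime d Q); rewrite ?mul0r //.
    by rewrite andbT => /negbTE ->; rewrite mulr0.
  rewrite -sum_moebius // mulr_suml; apply: eq_sum_nat => d /andP[d0 _] dn.
  move: cn; rewrite -{1}(divnK dn) coprimeMl => /andP[-> ->].
  by rewrite -[in n%:R^-1](divnK dn) natrM invfM mulrA mulrAC.
rewrite big_ltn // coprime1n eqxx invr1 mulr1 big1_seq ?addr0 // => n.
rewrite /= mem_index_iota => /andP[n1 _].
by rewrite (gtn_eqF n1) mul0r if_same.
Qed.

Lemma mobius_log_sumE Q x : (0 < x)%N -> mobius_log_sum Q x =
  m_ Q x * ln x%:R - \sum_(1 <= a < x.+1 | coprime a Q) mu a / a%:R * ln (x%:R / a%:R).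
Proof.
move=> x0; rewrite /m_ /mobius_sum mulr_suml -sumrB.
apply: eq_sum_nat => a /andP[a0 _] _.
by rewrite ln_div ?posrE ?ltr0n // -mulrBr; congr (_ * _); ring.
Qed.

Lemma coprime_harmonic_ge0 Q n : 0 <= coprime_harmonic Q n.
Proof. by apply: sumr_ge0 => k _; rewrite invr_ge0. Qed.

Lemma coprime_harmonic_mono Q m n : (m <= n)%N ->
  coprime_harmonic Q m <= coprime_harmonic Q n.
Proof.
move=> mn; rewrite [leRHS](big_cat_nat (n := m.+1)) //=.
by rewrite lerDl sumr_ge0 // => k _; rewrite invr_ge0.
Qed.

Lemma coprime_harmonic_le Q n : coprime_harmonic Q n <= L n.
Proof.
apply: le_trans (harmonic_le n); rewrite /coprime_harmonic big_mkcond.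
by apply: ler_sum => k _; case: ifP; rewrite ?invr_ge0.
Qed.

Lemma powR_quarter_le x Y B D : (0 < x)%N -> (0 < Y)%N -> (x <= (2 * Y) ^ 2)%N ->
  L x ^+ B <= D * x%:R `^ 4^-1 ->
  x%:R `^ 4^-1 / Y%:R <= 2 * D / L x ^+ B.
Proof.
move=> x0 Y0 xY h.
have e : (x%:R `^ 4^-1) ^+ 4 = x%:R :> R.
  by rewrite -powR_mulrn ?powR_ge0 // -powRrM mulVf // powRr1.
set w := x%:R `^ 4^-1 in h e *.
have w0 : 0 < w by rewrite powR_gt0 // ltr0n.
have w2 : w ^+ 2 <= 2 * Y%:R.
  rewrite -(@ler_pXn2r _ 2) ?nnegrE ?exprn_ge0 ?(ltW w0) ?mulr_ge0 // -exprM e.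
  by rewrite -natrM -natrX ler_nat.
have Y0' : 0 < Y%:R :> R by rewrite ltr0n.
have D0 : 0 <= D.
  rewrite -(pmulr_lge0 _ w0); apply: le_trans h; exact: exprn_ge0 (slog_ge0 _).
have l0 : 0 < L x ^+ B by rewrite exprn_gt0 // slog_gt0.
rewrite ler_pdivrMr // mulrAC ler_pdivlMr //.
apply: le_trans (ler_wpM2l (ltW w0) h) _.
by rewrite mulrCA -expr2 -mulrA mulrCA ler_wpM2l.
Qed.

(** Axer's argument again, now for [coprime_harmonic], which is close to [kap * ln y + c] with
    [kap = phi Q / Q], while its convolution with [mu a / a] is exactly 1. As [m_ Q x] is
    negligible, the sum [U] of [mu a / a * ln (x / a)] must be close to [1 / kap], and the sum
    sought is close to [- U]. *)
Lemma mobius_log_sum_small : PNT R -> forall j B, exists2 C : R, 0 <= C &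
  forall x Q, (3 < x)%N -> (0 < Q)%N -> (Q <= x ^ j)%N ->
  `|mobius_log_sum Q x + Q%:R / (totient Q)%:R| <= C / L x ^+ B.
Proof.
move=> pnt j B.
(* Three powers of [L x] are lost: two to the bound on [c], one to [1 / kap]. *)
have [Cm Cm0 Hm] := mobius_sum_small pnt (3 * j) (B + 3).
have [Cw [Cw0 Hw]] := coprime_harmonic_asymp.
have [C2 C20 H2] := two_pow_omega_powR j.
have q0 : 0 < 4^-1 :> R by rewrite invr_gt0.
have [D D0 HD] := @slog_le_powR R (B + 3) 4^-1 q0.
pose J : R := j.+1%:R; have J1 : 1 <= J by rewrite ler1n.
pose Cm' := Cm * 4 ^+ (B + 3); pose Ce := Cw * C2 * (2 * D); pose G := Cw * J ^+ 2.
have Cm'0 : 0 <= Cm' by rewrite mulr_ge0 // exprn_ge0.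
have Ce0 : 0 <= Ce by rewrite !mulr_ge0 // ltW.
have G0 : 0 <= G by rewrite mulr_ge0 // exprn_ge0; lra.
exists (Cm' + 2 * J * (Ce + Cm' * (4 + 3 * G))) => [|x Q x4 Q0 Qx].
  by rewrite addr_ge0 // mulr_ge0 //; [lra|rewrite addr_ge0 // mulr_ge0 //; lra].
have x0 : (0 < x)%N by exact: leq_trans x4.
(* The error in [coprime_harmonic] is [2 ^ omega / Y], at most about [x ^ (1/4) / x ^ (1/2)], so a
   cutoff near [sqrt x] already saves a power. [x > 3] guarantees [Y > 1]. *)
have [Y /andP[YYx xY]] := nat_sqrt_exists x.
have Y1 : (1 < Y)%N.
  rewrite ltnNge; apply/negP => Yle.
  have h : (Y.+1 * Y.+1 <= 2 * 2)%N by apply: leq_mul.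
  by move: x4; rewrite ltnNge -ltnS (leq_trans xY h).
have Y0 : (0 < Y)%N by exact: ltnW.
have Yx : (0 < Y <= x)%N by rewrite Y0 (leq_trans _ YYx) // leq_pmulr.
set l := L x; have l1 : 1 <= l := slog_ge1 x.
have lB : 0 <= l ^- (B + 3) by rewrite invr_ge0 exprn_ge0 //; lra.
pose M := Cm' * l ^- (B + 3).
have M0 : 0 <= M by rewrite mulr_ge0.
have HM t : (x %/ Y <= t <= x)%N -> `|m_ Q t| <= M.
  move=> /andP[zt tx]; have xt3 := cutoff_cube Y1 YYx zt.
  have t0 : (0 < t)%N by rewrite lt0n; apply: contraTneq xt3 => ->; rewrite -ltnNge.
  have Qt : (Q <= t ^ (3 * j))%N.
    by rewrite expnM; apply: leq_trans Qx _; case: (j) => // k; rewrite leq_exp2r.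
  apply: le_trans (Hm t Q t0 Q0 Qt) _; rewrite /M /Cm' -mulrA ler_wpM2l //.
  have -> : 4 ^+ (B + 3) * l ^- (B + 3) = (l / 4) ^- (B + 3).
    by rewrite expr_div_n invfM invrK mulrC.
  apply: ler_inv_exp; first by rewrite divr_gt0 //; lra.
  by have := @slog_le_exp R x t 3 xt3; rewrite -/l; lra.
have [c [cle Hc]] := Hw Q Q0.
set kap := (Q%:R / (totient Q)%:R)^-1 in Hc.
have /andP[ki1 ki2] := totient_ratio_bounds Q0.
have kapV : kap^-1 = Q%:R / (totient Q)%:R by rewrite /kap invrK.
rewrite -kapV in ki1 ki2 *.
have kap0 : 0 < kap by rewrite -invr_gt0; lra.
have kap1 : kap <= 1 by rewrite -[kap]invrK invf_le1 //; lra.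
have LQ : L Q <= J * l by exact: slog_le_exp.
have cle' : `|c| <= G * l ^+ 2.
  apply: (le_trans cle); rewrite /G -mulrA -exprMn ler_wpM2l // lerXn2r ?nnegrE ?slog_ge0 //.
  by rewrite mulr_ge0 //; lra.
pose eps := Ce * l ^- (B + 3).
have Heps a : (0 < a <= x %/ Y)%N ->
    `|coprime_harmonic Q (x %/ a) - kap * ln (x%:R / a%:R) - c| <= eps.
  move=> /andP[a0 az].
  have a0' : 0 < a%:R :> R by rewrite ltr0n.
  have Y0' : 0 < Y%:R :> R by rewrite ltr0n.
  have Yt : Y%:R <= x%:R / a%:R :> R.
    by rewrite ler_pdivlMr // -natrM ler_nat mulnC -leq_divRL.
  have t0 : 0 < x%:R / a%:R :> R by exact: lt_le_trans Yt.
  apply: le_trans (Hc (x %/ a)%N _ t0 _) _.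
    rewrite ler_pdivlMr // ltr_pdivrMr // -natrM ler_nat leq_divM /=.
    by rewrite natr1 -natrM ltr_nat ltn_ceil.
  apply: (@le_trans _ _ (Cw * (C2 * x%:R `^ 4^-1) / Y%:R)).
    apply: ler_pM.
    - by rewrite mulr_ge0 // exprn_ge0.
    - by rewrite invr_ge0 ltW.
    - by rewrite ler_wpM2l // H2.
    - by rewrite lef_pV2 ?posrE.
  rewrite /eps /Ce -!mulrA ler_wpM2l // ler_wpM2l ?(ltW C20) // mulrA.
  apply: powR_quarter_le => //; last exact: HD.
  have Y2 : (Y.+1 <= 2 * Y)%N by rewrite mul2n -addnn -addn1 leq_add2l.
  by apply: leq_trans (ltnW xY) _; rewrite -mulnn leq_mul.
have := @axer_mobius R Q x Y (coprime_harmonic Q) kap c eps M Yx (ltW kap0)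
   (coprime_harmonic_ge0 Q) (@coprime_harmonic_mono Q) Heps HM.
rewrite -/l; set S := \sum_(_ <= _ < _ | _) _ => HS.
pose U := \sum_(1 <= a < x.+1 | coprime a Q) mu a / a%:R * ln (x%:R / a%:R).
have SE : S = 1 - kap * U - c * m_ Q x.
  rewrite -(coprime_harmonic_mobius Q0 x0) /U /m_ /mobius_sum !mulr_sumr -!sumrB.
  by apply: eq_bigr => a _; ring.
have N1E : mobius_log_sum Q x + kap^-1 =
    m_ Q x * ln x%:R + kap^-1 * (S + c * m_ Q x).
  rewrite mobius_log_sumE // SE -/U; field; exact: lt0r_neq0.
have mM : `|m_ Q x| <= M by apply: HM; rewrite leq_div leqnn.
have lY : coprime_harmonic Q Y + kap * ln Y%:R <= 2 * l.
  have h1 : L Y <= l by apply: le_slog; case/andP: Yx.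
  have h2 := coprime_harmonic_le Q Y; have h3 := @ln_le_slog R Y.
  have h4 : kap * ln Y%:R <= ln Y%:R by rewrite ler_piMl // ln_nat_ge0.
  by lra.
have ll2 : l <= l ^+ 2 by rewrite expr2 ler_peMl //; lra.
have l2l3 : l ^+ 2 <= l ^+ 3 by rewrite (exprS l 2) ler_peMl // sqr_ge0.
have HS' : `|S + c * m_ Q x| <= (eps + M * (4 + 3 * G)) * l ^+ 2.
  apply: le_trans (ler_normD _ _) _; rewrite normrM.
  have h1 : `|c| * `|m_ Q x| <= G * l ^+ 2 * M by apply: ler_pM.
  have h2 : 2 * M * (coprime_harmonic Q Y + kap * ln Y%:R + `|c|) <=
      2 * M * (2 * l ^+ 2 + G * l ^+ 2) by rewrite ler_wpM2l ?mulr_ge0 //; lra.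
  have eps0 : 0 <= eps by rewrite mulr_ge0.
  have h3 : eps * l <= eps * l ^+ 2 by rewrite ler_wpM2l.
  by lra.
have key : `|mobius_log_sum Q x + kap^-1| <=
    (M + 2 * J * (eps + M * (4 + 3 * G))) * l ^+ 3.
  rewrite N1E; apply: le_trans (ler_normD _ _) _.
  rewrite !normrM (ger0_norm (ln_nat_ge0 _)) [(M + _) * _]mulrDl; apply: lerD.
    apply: ler_pM; rewrite ?ln_nat_ge0 //; apply: le_trans (ln_le_slog x) _.
    by rewrite -/l; lra.
  have eps0 : 0 <= eps by rewrite mulr_ge0.
  have -> : 2 * J * (eps + M * (4 + 3 * G)) * l ^+ 3 =
    2 * (J * l) * ((eps + M * (4 + 3 * G)) * l ^+ 2) by ring.
  apply: ler_pM => //; rewrite ger0_norm ?invr_ge0 ?(ltW kap0) //.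
  by apply: (le_trans ki2); rewrite ler_wpM2l.
have l_gt0 : 0 < l := lt_le_trans ltr01 l1.
have l30 : l ^+ 3 != 0 by rewrite expf_neq0 // gt_eqF.
apply: (le_trans key); rewrite /M /eps exprD invfM.
have -> : forall v w : R, (Cm' * v + 2 * J * (Ce * v + Cm' * v * (4 + 3 * G))) * w =
  (Cm' + 2 * J * (Ce + Cm' * (4 + 3 * G))) * (v * w) by move=> v w; ring.
by rewrite divfK.
Qed.

End MobiusLogSums.

(** * Sums over reciprocals of the totient *)

Definition totient_sum {R : realType} (M x : nat) : R :=
  \sum_(1 <= n < x.+1 | coprime n M) moebius n / (totient n)%:R.

Definition totient_log_sum {R : realType} (M x : nat) : R :=
  \sum_(1 <= n < x.+1 | coprime n M) moebius n / (totient n)%:R * ln n%:R.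

(** For [M > 0] this is the product of [1 - (p - 1) ^ (-2)] over the primes [p] not dividing [M]
    ([coprime_euler_cvg]). The series form is the one that the totient sums produce. *)
Definition coprime_euler {R : realType} (M : nat) : R :=
  limn (fun n => \sum_(1 <= d < n.+1 | coprime d M)
                    moebius d / (totient d)%:R ^+ 2).

(* Minus the limit of [totient_log_sum M] for every [M > 0]; for even [M] it is
   [singular_series M]. *)
Definition singular_constant {R : realType} (M : nat) : R :=
  M%:R / (totient M)%:R * coprime_euler M.

Section TotientSums.
Context {R : realType}.
Local Notation L := (@slog R).
Local Notation mu := (@moebius R).
Local Notation isqrt := (@isqrt R).

Lemma moebius_ncoprime a b : (0 < a)%N -> (0 < b)%N -> ~~ coprime a b -> mu (a * b) = 0.
Proof.
move=> a0 b0 nab; apply: moebius_nsquarefree; apply: contra nab => sab.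
apply/eqP; apply: (squarefreeP _ sab); first by rewrite muln_gt0 a0.
by rewrite -mulnn dvdn_mul // ?dvdn_gcdl ?dvdn_gcdr.
Qed.

(* For squarefree [e], [e / phi e] is the sum of [1 / phi d] over [d %| e]. *)
Lemma totient_sum_decomp M x (F : nat -> R) :
  \sum_(1 <= e < x.+1 | coprime e M) mu e / (totient e)%:R * F e =
  \sum_(1 <= d < x.+1 | coprime d M) mu d / (d%:R * (totient d)%:R) *
    \sum_(1 <= b < (x %/ d).+1 | coprime b (d * M)) mu b / b%:R * F (d * b)%N.
Proof.
pose G a b := if coprime (a * b) M then
   mu (a * b) / (a * b)%:R * ((totient a)%:R^-1 * F (a * b)%N) else 0.
transitivity (\sum_(1 <= n < x.+1) \sum_(1 <= d < n.+1 | (d %| n)%N) G d (n %/ d)%N).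
  rewrite big_mkcond; apply: eq_big_nat => n /andP[n0 _].
  transitivity (\sum_(1 <= d < n.+1 | (d %| n)%N) (if coprime n M then
      mu n / n%:R * ((totient d)%:R^-1 * F n) else 0)); last first.
    by apply: eq_sum_nat => d _ dn; rewrite /G mulnC divnK.
  case: ifPn => cn; last by rewrite big1.
  rewrite -mulr_sumr -mulr_suml.
  have [sn|sn] := boolP (squarefree n); last by rewrite moebius_nsquarefree // !mul0r.
  rewrite sum_inv_totient // !mulrA; congr (_ * _).
  by rewrite -(mulrA (mu n)) mulVf ?mulr1 // pnatr_eq0 -lt0n.
rewrite hyperbola [RHS]big_mkcond; apply: eq_big_nat => d /andP[d0 _].
rewrite /G; case: ifPn => cd; last by rewrite big1 // => b _; rewrite coprimeMl (negbTE cd).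
rewrite mulr_sumr [RHS]big_mkcond; apply: eq_big_nat => b /andP[b0 _].
rewrite coprimeMl cd coprimeMr (coprime_sym b d) /=.
have [cdb|cdb] := boolP (coprime d b); rewrite /=; last first.
  by rewrite moebius_ncoprime // !mul0r if_same.
case: ifP => // _.
by rewrite moebiusM // natrM !invfM; ring.
Qed.

(** [d / phi d] is at most [2 * L d], and the square of a logarithm is absorbed by [d ^ (1/2)], so
    both weights are [O(d ^ (-3/2))]. *)
Lemma inv_totient_bounds : exists2 K : R, 0 <= K & forall d, (0 < d)%N ->
  (totient d)%:R ^- 2 <= K * isqrt d ^+ 3 /\
  (d%:R * (totient d)%:R)^-1 <= K * isqrt d ^+ 3.
Proof.
have h2 : 0 < 2^-1 :> R by rewrite invr_gt0.
have [D D0 HD] := @slog_le_powR R 2 2^-1 h2.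
exists (4 * D) => [|d d0]; first by rewrite mulr_ge0 // ltW.
have /andP[r1 r2] := @totient_ratio_bounds R d d0.
set r := _ / _ in r1 r2.
have d0' : 0 < d%:R :> R by rewrite ltr0n.
have t0 : 0 < (totient d)%:R :> R by rewrite ltr0n totient_gt0.
have hs : isqrt d ^+ 3 = Num.sqrt d%:R * d%:R ^- 2.
  have s0 : 0 < Num.sqrt d%:R :> R by rewrite sqrtr_gt0.
  rewrite /isqrt exprVn -[in d%:R ^- 2](sqr_sqrtr (ltW d0')).
  by field; rewrite gt_eqF.
have h1 : (totient d)%:R ^- 2 <= 4 * D * isqrt d ^+ 3.
  have -> : (totient d)%:R ^- 2 = r ^+ 2 * d%:R ^- 2.
    by rewrite /r; field; rewrite !gt_eqF.
  rewrite hs mulrA ler_wpM2r ?invr_ge0 ?exprn_ge0 //.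
  apply: (@le_trans _ _ ((2 * L d) ^+ 2)).
    rewrite lerXn2r ?nnegrE ?mulr_ge0 ?slog_ge0 //; lra.
  have := HD d d0; rewrite powR12_sqrt ?(ltW d0') // => h.
  have -> : (2 * L d) ^+ 2 = 4 * L d ^+ 2 by ring.
  by rewrite -mulrA ler_wpM2l.
split=> //; apply: le_trans h1.
have -> : (totient d)%:R ^- 2 = r * (d%:R * (totient d)%:R)^-1.
  by rewrite /r; field; rewrite !gt_eqF.
by rewrite ler_peMl // invr_ge0 mulr_ge0 // ltW.
Qed.

Lemma sum_isqrt_tail m n : (0 < m <= n)%N ->
  \sum_(m.+1 <= k < n.+1) isqrt k ^+ 3 <= 2 * isqrt m.
Proof.
move=> /andP[m0 mn].
have := @sum_le_telescope R (fun k => isqrt k ^+ 3) (fun k => 2 * isqrt k) m n mn.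
have n0 := @isqrt_ge0 R n => h; apply: le_trans (h _) _ => [k /andP[mk _]|]; last by lra.
by apply: isqrt_step; exact: leq_trans mk.
Qed.

Lemma sum_isqrt n : \sum_(1 <= k < n.+1) isqrt k ^+ 3 <= 3.
Proof.
case: n => [|n]; first by rewrite big_geq.
rewrite big_ltn // isqrt1 expr1n; have := @sum_isqrt_tail 1 n.+1 isT.
by rewrite isqrt1; lra.
Qed.

(** Up to [r] the smallness of [f] is used and the coefficients are summed absolutely; beyond [r] it
    is the tail of their majorant that is small. The factors 3 and 2 come from [sum_isqrt] and
    [sum_isqrt_tail]. *)
Lemma weighted_split (P : pred nat) (a f : nat -> R) (K eps H : R) r x :
  (0 < r <= x)%N -> 0 <= K -> 0 <= H ->
  (forall d, (0 < d)%N -> `|a d| <= K * isqrt d ^+ 3) ->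
  (forall d, (0 < d <= r)%N -> P d -> `|f d| <= eps) ->
  (forall d, (r < d <= x)%N -> P d -> `|f d| <= H) -> 0 <= eps ->
  `|\sum_(1 <= d < x.+1 | P d) a d * f d| <= 3 * K * eps + 2 * K * H * isqrt r.
Proof.
move=> /andP[r0 rx] K0 H0 Ha Heps HH eps0.
have bnd m n (c : R) : 0 <= c -> (0 < m)%N ->
   (forall d, (m <= d < n)%N -> P d -> `|f d| <= c) ->
   `|\sum_(m <= d < n | P d) a d * f d| <= K * c * \sum_(m <= d < n) isqrt d ^+ 3.
  move=> c0 m0 Hc; apply: le_trans (ler_norm_sum _ _ _) _.
  rewrite big_mkcond mulr_sumr; apply: ler_sum_nat => d dmn.
  have i0 : 0 <= isqrt d ^+ 3 by rewrite exprn_ge0 // isqrt_ge0.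
  case: ifPn => Pd; last by rewrite (mulr_ge0 (mulr_ge0 K0 c0) i0).
  have d0 : (0 < d)%N by case/andP: dmn => + _; exact: leq_trans.
  by rewrite normrM mulrAC; apply: ler_pM => //; [exact: Ha|exact: Hc].
rewrite (big_cat_nat (n := r.+1)) //=.
apply: le_trans (ler_normD _ _) (lerD _ _).
  apply: le_trans (bnd _ _ eps _ _ _) _ => //.
  have := ler_wpM2l (mulr_ge0 K0 eps0) (sum_isqrt r); lra.
apply: le_trans (bnd _ _ H _ _ _) _ => //.
have h := @sum_isqrt_tail r x; rewrite r0 rx in h.
have := ler_wpM2l (mulr_ge0 K0 H0) (h isT); lra.
Qed.

Lemma coprime_euler_tail : exists2 K : R, 0 <= K & forall M z, (0 < z)%N ->
  `|\sum_(1 <= d < z.+1 | coprime d M) mu d / (totient d)%:R ^+ 2 - coprime_euler M|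
  <= K * isqrt z.
Proof.
have [K K0 HK] := inv_totient_bounds; exists (2 * K) => [|M z z0].
  by rewrite mulr_ge0.
pose a d := if coprime d M then mu d / (totient d)%:R ^+ 2 else 0.
have Ha d : (0 < d)%N -> `|a d| <= K * isqrt d ^+ 3.
  move=> d0; have [h _] := HK d d0; apply: le_trans h.
  rewrite /a; case: ifP => _; last by rewrite normr0 invr_ge0 exprn_ge0.
  by rewrite normrM normfV normrX normr_nat ler_piMl ?invr_ge0 ?exprn_ge0 // normr_moebius_le1.
have [c tc Hc] := isqrt_series Ha.
have -> : coprime_euler M = c.
  rewrite /coprime_euler -(cvg_lim _ tc) //; congr (limn _).
  by apply/funext => n; rewrite big_mkcond.
by rewrite big_mkcond; exact: Hc.
Qed.

Lemma isqrt_le_slog B : exists2 D : R, 0 < D & forall r x, (0 < r)%N -> (x <= r ^ 4)%N ->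
  isqrt r <= D / L x ^+ B.
Proof.
have h2 : 0 < 2^-1 :> R by rewrite invr_gt0.
have [D D0 HD] := @slog_le_powR R B 2^-1 h2.
exists (D * 5 ^+ B) => [|r x r0 xr]; first by rewrite mulr_gt0 // exprn_gt0.
have := HD r r0; rewrite powR12_sqrt // => h.
have s0 : 0 < Num.sqrt r%:R :> R by rewrite sqrtr_gt0 ltr0n.
rewrite /isqrt ler_pdivlMr ?exprn_gt0 ?slog_gt0 // ler_pdivrMl //.
apply: (@le_trans _ _ ((5 * L r) ^+ B)).
  by rewrite lerXn2r ?nnegrE ?mulr_ge0 ?slog_ge0 // slog_le_exp.
rewrite exprMn mulrA mulrC ler_wpM2r ?exprn_ge0 //.
by rewrite mulrC.
Qed.

Lemma mobius_log_sum_le Q x : `|mobius_log_sum Q x| <= L x ^+ 2.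
Proof.
apply: le_trans (ler_norm_sum _ _ _) _.
apply: (@le_trans _ _ (\sum_(1 <= n < x.+1) L x * n%:R^-1)).
  rewrite big_mkcond; apply: ler_sum_nat => n /andP[n0 nx].
  case: ifP => _; last by rewrite mulr_ge0 ?slog_ge0 ?invr_ge0.
  rewrite normrM mulrC; apply: ler_pM => //; last exact: normr_moebius_div_le.
  rewrite ger0_norm ?ln_nat_ge0 //; apply: le_trans (ln_le_slog _) _.
  exact: le_slog.
by rewrite -mulr_sumr expr2 ler_wpM2l ?slog_ge0 // harmonic_le.
Qed.

(** With [r] near [sqrt x], the quotients [x %/ d] for [d <= r] exceed the cube root of [x], so
    log-power savings there are as good as at [x]. The threshold 16 gives [r >= 4], the length that
    [mobius_log_sum_small] asks for. *)
Lemma sqrt_split x : (15 < x)%N -> exists r, [/\ (3 < r)%N, (r <= x)%N, (x <= r ^ 4)%N &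
  forall d, (0 < d <= r)%N -> (r <= x %/ d)%N /\ (x <= (x %/ d) ^ 3)%N].
Proof.
move=> x16; have [r /andP[rx xr]] := nat_sqrt_exists x; exists r.
have r4 : (3 < r)%N.
  rewrite ltnNge; apply/negP => r3; have h : (r.+1 * r.+1 <= 4 * 4)%N by apply: leq_mul.
  by move: x16; rewrite ltnNge -ltnS (leq_trans xr h).
have r0 : (0 < r)%N by exact: leq_trans r4.
split=> //.
- by apply: leq_trans rx; rewrite leq_pmulr.
- apply: leq_trans (ltnW xr) _; have -> : (r ^ 4 = (r * r) * (r * r))%N by rewrite !mulnn -expnM.
  have h : (r.+1 <= r * r)%N by clear -r4; nia.
  exact: leq_mul.
move=> d /andP[d0 dr].
have h : (x %/ r <= x %/ d)%N by exact: leq_div2l.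
split; first by apply: leq_trans h; rewrite leq_divRL.
by apply: (@cutoff_cube x r) => //; exact: leq_trans r4.
Qed.

Lemma inv_slog_pow_transfer (C : R) x y B : 0 <= C -> (x <= y ^ 3)%N ->
  C / L y ^+ B <= C * 4 ^+ B / L x ^+ B.
Proof.
move=> C0 xy; rewrite -mulrA ler_wpM2l //.
have -> : 4 ^+ B / L x ^+ B = (L x / 4) ^- B by rewrite expr_div_n invfM invrK mulrC.
have l0 := @slog_gt0 R x.
apply: ler_inv_exp; first by rewrite divr_gt0.
by have := @slog_le_exp R x y 3 xy; lra.
Qed.

Lemma normr_coef_le (K : R) d :
  (d%:R * (totient d)%:R)^-1 <= K * isqrt d ^+ 3 ->
  `|mu d / (d%:R * (totient d)%:R)| <= K * isqrt d ^+ 3.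
Proof.
apply: le_trans; rewrite normrM normfV normrM !normr_nat ler_piMl ?invr_ge0 ?mulr_ge0 //.
exact: normr_moebius_le1.
Qed.

(** The inner sums of [totient_sum_decomp] are [mobius_sum (d * M) (x %/ d)]. For [d] up to about
    [sqrt x], [d * M <= x ^ j.+1 <= (x %/ d) ^ (3 * j.+1)], which explains the exponent requested;
    for larger [d] the tail of the weights [1 / (d * phi d)] beats the trivial bound [L x]. *)
Lemma totient_sum_small : PNT R -> forall j B, exists2 C : R, 0 <= C &
  forall x M, (15 < x)%N -> (0 < M)%N -> (M <= x ^ j)%N ->
  `|totient_sum M x| <= C / L x ^+ B.
Proof.
move=> pnt j B.
have [Cm Cm0 Hm] := mobius_sum_small pnt (3 * j.+1) B.
have [K K0 HK] := inv_totient_bounds.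
have [D D0 HD] := isqrt_le_slog B.+1.
exists (3 * K * (Cm * 4 ^+ B) + 2 * K * D) => [|x M x16 M0 Mx].
  by rewrite addr_ge0 // !mulr_ge0 ?exprn_ge0 // ltW.
have [r [r4 rx xr Hr]] := sqrt_split x16.
have r0 : (0 < r)%N by exact: leq_trans r4.
have x0 : (0 < x)%N by exact: leq_trans x16.
have l0 := @slog_gt0 R x.
pose eps := Cm * 4 ^+ B / L x ^+ B.
have -> : totient_sum M x = \sum_(1 <= d < x.+1 | coprime d M)
    mu d / (d%:R * (totient d)%:R) * mobius_sum (d * M) (x %/ d).
  transitivity (\sum_(1 <= n < x.+1 | coprime n M) mu n / (totient n)%:R * 1).
    by apply: eq_bigr => n _; rewrite mulr1.
  rewrite (@totient_sum_decomp M x (fun=> 1)); apply: eq_bigr => d _; congr (_ * _).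
  by apply: eq_bigr => b _; rewrite mulr1.
apply: le_trans (@weighted_split _ _ _ K eps (L x) r x _ _ _ _ _ _ _) _ => //.
- by rewrite r0.
- exact: slog_ge0.
- by move=> d d0; apply: normr_coef_le; have [] := HK d d0.
- move=> d dr cd; have /andP[d0 dr'] := dr; have [ry xy] := Hr d dr.
  have y0 : (0 < x %/ d)%N by exact: leq_trans ry.
  apply: le_trans (inv_slog_pow_transfer B Cm0 xy); apply: Hm => //.
    by rewrite muln_gt0 d0.
  rewrite expnM; apply: leq_trans (_ : x ^ j.+1 <= _)%N; last by rewrite leq_exp2r.
  by rewrite expnS leq_mul // (leq_trans dr').
- move=> d _ _; apply: le_trans (mobius_sum_le _ _) _.
  by apply: le_slog; exact: leq_div.
- by rewrite !mulr_ge0 ?invr_ge0 ?exprn_ge0 // ltW.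
rewrite [leRHS]mulrDl; apply: lerD; first by rewrite /eps !mulrA.
have := HD r x r0 xr => h.
apply: le_trans (ler_wpM2l _ h) _; first by rewrite !mulr_ge0 // ltW.
rewrite exprS invfM; have -> : 2 * K * L x * (D * ((L x)^-1 / L x ^+ B)) =
   2 * K * D / L x ^+ B * (L x / L x) by ring.
by rewrite divff ?mulr1 // gt_eqF.
Qed.

Lemma singular_constant_le : exists2 C : R, 0 <= C & forall M, (0 < M)%N ->
  `|singular_constant M| <= C * L M.
Proof.
have [K K0 HK] := coprime_euler_tail.
exists (2 * (1 + K)) => [|M M0]; first by rewrite mulr_ge0 // addr_ge0.
have := HK M 1%N isT; rewrite isqrt1 mulr1 big_mkcond big_nat1 coprime1n.
rewrite moebius1 (_ : totient 1 = 1%N) // expr1n divr1 => h.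
have hE : `|@coprime_euler R M| <= 1 + K.
  have -> : @coprime_euler R M = 1 - (1 - coprime_euler M) by ring.
  by apply: le_trans (ler_normB _ _) _; rewrite normr1 lerD2l.
have /andP[r1 r2] := @totient_ratio_bounds R M M0.
rewrite /singular_constant normrM [leRHS]mulrAC; apply: ler_pM => //.
by rewrite ger0_norm //; lra.
Qed.

(** In [totient_sum_decomp], [ln (d * b)] splits as [ln d + ln b]; the first part meets a small
    Moebius sum, the second is close to [- d * M / phi (d * M)]. Against the weights
    [mu d / (d * phi d)] this sums to minus [M / phi M] times the series of [coprime_euler M]. *)
Lemma totient_log_sum_small : PNT R -> forall j B, exists2 C : R, 0 <= C &
  forall x M, (15 < x)%N -> (0 < M)%N -> (M <= x ^ j)%N ->
  `|totient_log_sum M x + singular_constant M| <= C / L x ^+ B.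
Proof.
move=> pnt j B.
have [Cm Cm0 Hm] := mobius_sum_small pnt (3 * j.+1) B.+1.
have [Cn Cn0 Hn] := mobius_log_sum_small pnt (3 * j.+1) B.
have [K K0 HK] := inv_totient_bounds.
have [K' K'0 HK'] := coprime_euler_tail.
have [D D0 HD] := isqrt_le_slog (B + 2).
pose J : R := j.+1%:R; have J1 : 1 <= J by rewrite ler1n.
pose Ce := Cm * 4 ^+ B.+1 + Cn * 4 ^+ B.
have Ce0 : 0 <= Ce by rewrite addr_ge0 // mulr_ge0 // exprn_ge0.
exists (3 * K * Ce + 4 * K * D + 2 * J * K' * D) => [|x M x16 M0 Mx].
  have J0 : 0 <= J by lra.
  by rewrite !addr_ge0 // ?mulr_ge0 // ltW.
have [r [r4 rx xr Hr]] := sqrt_split x16.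
have r0 : (0 < r)%N by exact: leq_trans r4.
have x0 : (0 < x)%N by exact: leq_trans x16.
have l0 := @slog_gt0 R x; have l1 := @slog_ge1 R x.
set l := L x in l0 l1 *.
have lB0 : 0 <= l ^- B by rewrite invr_ge0 exprn_ge0 // ltW.
pose eps := Ce * l ^- B.
have hD : isqrt r * l ^+ 2 <= D * l ^- B.
  have := HD r x r0 xr; rewrite -/l => h.
  apply: le_trans (ler_wpM2r (sqr_ge0 _) h) _; rewrite exprD invfM -!mulrA mulVf ?mulr1 //.
  by rewrite expf_neq0 // gt_eqF.
pose f d := ln d%:R * mobius_sum (d * M) (x %/ d) + mobius_log_sum (d * M) (x %/ d) : R.
(* The limit is compensated only for [d <= r]; beyond, [f d] is bounded trivially and the rest of
   the series is left to [coprime_euler_tail]. *)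
pose g d := if (d <= r)%N then (d * M)%:R / (totient (d * M))%:R else 0 : R.
have tE : totient_log_sum M x = \sum_(1 <= d < x.+1 | coprime d M)
    mu d / (d%:R * (totient d)%:R) * f d.
  rewrite /totient_log_sum totient_sum_decomp; apply: eq_sum_nat => d /andP[d0 _] _.
  congr (_ * _); rewrite /f mulr_sumr -big_split; apply: eq_sum_nat => b /andP[b0 _] _ /=.
  by rewrite natrM lnM ?posrE ?ltr0n //; ring.
pose M' := M%:R / (totient M)%:R : R.
have gE : \sum_(1 <= d < x.+1 | coprime d M) mu d / (d%:R * (totient d)%:R) * g d =
    M' * \sum_(1 <= d < r.+1 | coprime d M) mu d / (totient d)%:R ^+ 2.
  rewrite (big_cat_nat (n := r.+1)) //= [X in _ + X]big1_seq ?addr0; last first.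
    move=> d /andP[_]; rewrite mem_index_iota => /andP[rd _].
    by rewrite /g leqNgt rd mulr0.
  rewrite mulr_sumr; apply: eq_sum_nat => d /andP[d0 dr] cd.
  rewrite /g -ltnS dr totient_coprime // !natrM /M'; field.
  by rewrite !gt_eqF ?ltr0n ?totient_gt0.
have /andP[r1 r2] := @totient_ratio_bounds R M M0; rewrite -/M' in r1 r2.
have LM : L M <= J * l by exact: slog_le_exp.
have e1 : `|\sum_(1 <= d < x.+1 | coprime d M) mu d / (d%:R * (totient d)%:R) * (f d + g d)|
    <= 3 * K * eps + 2 * K * (2 * l ^+ 2) * isqrt r.
  apply: weighted_split => //.
  - by rewrite r0.
  - by rewrite mulr_ge0 // sqr_ge0.
  - by move=> d d0; apply: normr_coef_le; have [] := HK d d0.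
  - move=> d dr cd; have /andP[d0 dr'] := dr; have [ry xy] := Hr d dr.
    have y0 : (0 < x %/ d)%N by exact: leq_trans ry.
    have dM0 : (0 < d * M)%N by rewrite muln_gt0 d0.
    have dMy : (d * M <= (x %/ d) ^ (3 * j.+1))%N.
      rewrite expnM; apply: leq_trans (_ : x ^ j.+1 <= _)%N; last by rewrite leq_exp2r.
      by rewrite expnS leq_mul // (leq_trans dr').
    have h1 := le_trans (Hm _ _ y0 dM0 dMy) (inv_slog_pow_transfer B.+1 Cm0 xy).
    have h2 := le_trans (Hn _ _ (leq_trans r4 ry) dM0 dMy) (inv_slog_pow_transfer B Cn0 xy).
    rewrite /f /g dr' -addrA; apply: le_trans (ler_normD _ _) _.
    rewrite /eps /Ce mulrDl lerD // normrM ger0_norm ?ln_nat_ge0 //.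
    have hd : ln d%:R <= l by apply: le_trans (ln_le_slog d) _; apply: le_slog; exact: leq_trans dr' rx.
    apply: le_trans (ler_pM _ _ hd h1) _; rewrite ?ln_nat_ge0 //.
    rewrite -/l (exprS l B) invfM; have -> : forall u v w : R, u * (v * (u^-1 * w)) = (u / u) * (v * w) by move=> *; ring.
    by rewrite divff ?mul1r // gt_eqF.
  - move=> d /andP[rd dx] cd; rewrite /g leqNgt rd addr0 /f.
    have d0 : (0 < d)%N by exact: leq_trans rd.
    apply: le_trans (ler_normD _ _) _; rewrite normrM ger0_norm ?ln_nat_ge0 //.
    have hd : ln d%:R <= l by apply: le_trans (ln_le_slog d) _; exact: le_slog.
    have hy : L (x %/ d) <= l by apply: le_slog; exact: leq_div.
    have hm := le_trans (mobius_sum_le (d * M) (x %/ d)) hy.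
    have hn : `|mobius_log_sum (d * M) (x %/ d)| <= l ^+ 2.
      apply: le_trans (mobius_log_sum_le _ _) _.
      by rewrite lerXn2r ?nnegrE ?slog_ge0 // ltW.
    have := ler_pM (ln_nat_ge0 d) (normr_ge0 _) hd hm; rewrite -expr2; lra.
  - by rewrite mulr_ge0.
have e2 : `|M' * (\sum_(1 <= d < r.+1 | coprime d M) mu d / (totient d)%:R ^+ 2 - coprime_euler M)|
    <= 2 * (J * l) * (K' * isqrt r).
  rewrite normrM; apply: ler_pM => //; last exact: HK'.
  by rewrite ger0_norm; lra.
have -> : totient_log_sum M x + singular_constant M =
  \sum_(1 <= d < x.+1 | coprime d M) mu d / (d%:R * (totient d)%:R) * (f d + g d)
  - M' * (\sum_(1 <= d < r.+1 | coprime d M) mu d / (totient d)%:R ^+ 2 - coprime_euler M).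
  rewrite mulrBr -gE tE /singular_constant -/M'.
  rewrite [X in _ = X - _](eq_bigr (fun d => mu d / (d%:R * (totient d)%:R) * f d +
     mu d / (d%:R * (totient d)%:R) * g d)); last by move=> d _; rewrite mulrDr.
  by rewrite big_split /=; ring.
apply: le_trans (ler_normB _ _) _; apply: le_trans (lerD e1 e2) _.
have i0 := @isqrt_ge0 R r.
rewrite [leRHS]mulrDl [X in _ <= X + _]mulrDl; apply: lerD; first apply: lerD.
- by rewrite /eps mulrA.
- have -> : 2 * K * (2 * l ^+ 2) * isqrt r = 4 * K * (isqrt r * l ^+ 2) by ring.
  by rewrite -[leRHS]mulrA ler_wpM2l // mulr_ge0.
have ll2 : l <= l ^+ 2 by rewrite expr2 ler_peMl // ltW.
have hl : isqrt r * l <= isqrt r * l ^+ 2 by exact: ler_wpM2l.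
have -> : 2 * (J * l) * (K' * isqrt r) = 2 * J * K' * (isqrt r * l) by ring.
rewrite -[leRHS]mulrA ler_wpM2l //; last exact: le_trans hl hD.
by rewrite !mulr_ge0 //; lra.
Qed.

End TotientSums.

(** * Euler products *)

Section EulerProducts.
Context {R : realType}.
Local Notation mu := (@moebius R).
Local Notation isqrt := (@isqrt R).

Lemma squarefree_prod_primes d : squarefree d -> (\prod_(p <- primes d) p)%N = d.
Proof.
move=> sd; have d0 := squarefree_gt0 sd.
rewrite [RHS](prod_prime_decomp d0) prime_decompE big_map /=.
apply: eq_big_seq => p pd; suff -> : logn p d = 1%N by rewrite expn1.
have := pd; rewrite mem_primes => /and3P[pp _ _].
apply/eqP; rewrite eqn_leq logn_gt0 pd andbT leqNgt -pfactor_dvdn //.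
apply/negP => /(squarefreeP d0 sd) p1; by rewrite p1 in pp.
Qed.

Lemma primes_prod_uniq (s : seq nat) : uniq s -> all prime s ->
  perm_eq (primes (\prod_(p <- s) p)) s.
Proof.
move=> us ps; apply: uniq_perm => //; first exact: primes_uniq.
elim: s us ps => [|p s IH] /=; first by rewrite big_nil.
move=> /andP[pns us] /andP[pp ps] q; rewrite big_cons primesM ?(prime_gt0 pp) //.
  by rewrite primes_prime // !inE IH.
rewrite big_seq prodn_cond_gt0 // => r rs; exact: prime_gt0 (allP ps _ rs).
Qed.

Lemma isqrt_cvg0 : (fun n => isqrt n.+1) @ \oo --> 0.
Proof.
have -> : (fun n => isqrt n.+1) = (fun n => Num.sqrt (@harmonic R n)).
  by apply/funext => n; rewrite /isqrt /harmonic sqrtrV.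
rewrite -[X in _ --> X](@sqrtr0 R).
apply: continuous_cvg; [exact: sqrt_continuous|exact: cvg_harmonic].
Qed.

Lemma cvg_of_isqrt (t : nat -> R) (c K : R) :
  (forall n, (0 < n)%N -> `|t n - c| <= K * isqrt n) -> t @ \oo --> c.
Proof.
move=> H; rewrite -(cvg_shiftS t); apply/subr_cvg0/norm_cvg0P.
apply: (squeeze_cvgr (f := fun=> 0) (h := fun n => K * isqrt n.+1)).
- by apply: nearW => n; rewrite normr_ge0 /=; exact: H.
- exact: cvg_cst.
- rewrite -[X in _ --> X](mulr0 K); apply: cvgM; [exact: cvg_cst|exact: isqrt_cvg0].
Qed.

(** The product over the primes up to [n] is expanded by [euler_divisors] at their product [X]. Its
    terms with [d <= n] form the partial sum of the series; those with [d > n] are bounded by the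
    tail of the majorant. *)
Lemma euler_product_cvg (f : nat -> R) (K c : R) (M : nat) :
  (0 < M)%N -> 0 <= K -> f 1%N = 1 ->
  (forall p d, prime p -> (0 < d)%N -> ~~ (p %| d)%N -> f (p * d)%N = f p * f d) ->
  (forall d, (0 < d)%N -> `|f d| <= K * isqrt d ^+ 3) ->
  (fun n => \sum_(1 <= d < n.+1 | coprime d M) mu d * f d) @ \oo --> c ->
  (fun m => \prod_(0 <= p < m | prime p && ~~ (p %| M)%N) (1 - f p)) @ \oo --> c.
Proof.
move=> M0 K0 f1 fM fK fc.
pose S n := \sum_(1 <= d < n.+1 | coprime d M) mu d * f d.
pose Pr m := \prod_(0 <= p < m | prime p && ~~ (p %| M)%N) (1 - f p).
have dist n : (0 < n)%N -> `|Pr n.+1 - S n| <= 2 * K * isqrt n.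
  move=> n0; pose s := [seq p <- index_iota 0 n.+1 | prime p && ~~ (p %| M)%N].
  pose X := (\prod_(p <- s) p)%N.
  have us : uniq s by rewrite filter_uniq // iota_uniq.
  have ps : all prime s by apply/allP => p; rewrite mem_filter => /andP[/andP[]].
  have X0 : (0 < X)%N.
    by rewrite /X big_seq prodn_cond_gt0 // => p /(allP ps) /prime_gt0.
  have PE : Pr n.+1 = \sum_(1 <= d < X.+1 | (d %| X)%N) mu d * f d.
    rewrite (euler_divisors X0 f1 fM) (perm_big _ (primes_prod_uniq us ps)).
    by rewrite /s big_filter.
  pose Z := maxn n X.
  have -> : Pr n.+1 = \sum_(1 <= d < Z.+1 | (d %| X)%N) mu d * f d.
    by rewrite PE [RHS]sum_divisors_widen // X0 leq_maxr.
  (* For squarefree [d <= n], dividing [X] means that the prime factors of [d], automatically at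
     most [n], avoid those of [M]; other [d] are killed by [mu]. *)
  have key d : (0 < d)%N -> (d <= n)%N ->
      (if (d %| X)%N then mu d * f d else 0) = (if coprime d M then mu d * f d else 0).
    move=> d0 dn; have [sd|sd] := boolP (squarefree d); last first.
      by rewrite moebius_nsquarefree // mul0r !if_same.
    suff -> : (d %| X)%N = coprime d M by [].
    apply/idP/idP => [dX|cd].
      rewrite coprime_has_primes //; apply/hasPn => p pM; apply/negP => pd.
      have pX : p \in primes X.
        move: pd; rewrite !mem_primes X0 => /and3P[-> _ pd]; exact: dvdn_trans dX.
      have := perm_mem (primes_prod_uniq us ps) p; rewrite pX mem_filter.
      by move: pM; rewrite mem_primes => /and3P[_ _ ->]; rewrite andbF.
    rewrite -(squarefree_prod_primes sd) /X [Y in (_ %| Y)%N](bigID (mem (primes d))) /=.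
    rewrite -[Y in (_ %| Y * _)%N]big_filter.
    rewrite [Y in (_ %| Y * _)%N](perm_big (primes d)) ?dvdn_mulr //.
    apply: uniq_perm; [exact: filter_uniq|exact: primes_uniq|move=> p].
    rewrite mem_filter andb_idr // => pd; rewrite mem_filter mem_index_iota.
    have := pd; rewrite mem_primes => /and3P[-> _ pdv] /=.
    apply/andP; split; last by rewrite ltnS (leq_trans (dvdn_leq d0 pdv)).
    apply/negP => pM; move: cd; rewrite coprime_has_primes // => /hasP; apply.
    by exists p => //; move: pd; rewrite !mem_primes M0 pM => /and3P[->].
  rewrite (big_cat_nat (n := n.+1)) //= ?ltnS ?leq_maxl //.
  have -> : \sum_(1 <= d < n.+1 | (d %| X)%N) mu d * f d = S n.
    rewrite /S big_mkcond [RHS]big_mkcond; apply: eq_big_nat => d /andP[d0 dn].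
    by apply: key.
  rewrite addrAC subrr add0r; apply: le_trans (ler_norm_sum _ _ _) _.
  apply: (@le_trans _ _ (\sum_(n.+1 <= d < Z.+1) K * isqrt d ^+ 3)).
    rewrite big_mkcond; apply: ler_sum_nat => d /andP[nd _].
    have d0 : (0 < d)%N by exact: leq_trans nd.
    case: ifP => _; last by rewrite mulr_ge0 // exprn_ge0 // isqrt_ge0.
    by apply: le_trans (fK d d0); rewrite normrM ler_piMl // normr_moebius_le1.
  rewrite -mulr_sumr; have h := @sum_isqrt_tail R n Z; rewrite n0 leq_maxl in h.
  by have := ler_wpM2l K0 (h isT); lra.
have i0 := isqrt_cvg0.
rewrite -/Pr -(cvg_shiftS Pr) -(cvg_shiftS (fun n => Pr n.+1)).
apply: (cvg_sub0 (g := fun n => S n.+1)); last by rewrite (cvg_shiftS S).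
apply/norm_cvg0P; apply: (squeeze_cvgr (f := fun=> 0) (h := fun n => 2 * K * isqrt n.+1)).
- by apply: nearW => n; rewrite normr_ge0 /=; exact: dist.
- exact: cvg_cst.
- by rewrite -(mulr0 (2 * K)); apply: cvgM => //; exact: cvg_cst.
Qed.

Lemma totientMp p d : prime p -> (0 < d)%N -> ~~ (p %| d)%N ->
  totient (p * d) = (totient p * totient d)%N.
Proof. by move=> pp d0 pd; rewrite totient_coprime // prime_coprime. Qed.

Lemma totient_sqr d : (0 < d)%N -> totient (d ^ 2) = (d * totient d)%N.
Proof.
move=> d0; have := @natr_div_totient R (d ^ 2); rewrite expn_gt0 d0 => /(_ isT).
rewrite primesX // -natr_div_totient // => /eqP.
rewrite eqr_div ?pnatr_eq0 -?lt0n ?totient_gt0 ?expn_gt0 ?d0 //.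
rewrite -!natrM eqr_nat -mulnn -mulnA eqn_pmul2l // => /eqP ->; by [].
Qed.

Lemma totient_prime_natr p : prime p -> (totient p)%:R = p%:R - 1 :> R.
Proof.
by move=> pp; rewrite totient_prime // -[in RHS](prednK (prime_gt0 pp)) -natr1 addrK.
Qed.

Lemma coprime_euler_cvg M : (0 < M)%N ->
  (fun m => \prod_(0 <= p < m | prime p && ~~ (p %| M)%N) (1 - (p%:R - 1) ^- 2))
    @ \oo --> @coprime_euler R M.
Proof.
move=> M0; have [K K0 HK] := @inv_totient_bounds R.
have [K' _ HK'] := @coprime_euler_tail R.
have := @euler_product_cvg (fun d => (totient d)%:R ^- 2) K (coprime_euler M) M M0 K0.
have -> : (fun m => \prod_(0 <= p < m | prime p && ~~ (p %| M)%N) (1 - (p%:R - 1) ^- 2)) =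
  (fun m => \prod_(0 <= p < m | prime p && ~~ (p %| M)%N) (1 - (totient p)%:R ^- 2) : R).
  by apply/funext => m; apply: eq_bigr => p /andP[pp _]; rewrite totient_prime_natr.
apply.
- by rewrite expr1n invr1.
- by move=> p d pp d0 pd; rewrite totientMp // natrM exprMn invfM.
- move=> d d0; rewrite ger0_norm ?invr_ge0 ?exprn_ge0 //; exact: (HK d d0).1.
- apply: (@cvg_of_isqrt _ _ K') => n n0; exact: HK'.
Qed.

(** The Euler product is turned into the series that the sum over square divisors yields. For even
    [N] the condition [2 < p] follows from [p] not dividing [N]. The rate is uniform in [N]. *)
Lemma calA_tail : exists2 K : R, 0 <= K & forall N z, (0 < N)%N -> ~~ odd N -> (0 < z)%N ->
  `|\sum_(1 <= k < z.+1 | coprime k N) mu k / (k%:R * (totient k)%:R) - calA N|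
   <= K * isqrt z.
Proof.
have [K K0 HK] := @inv_totient_bounds R; exists (2 * K) => [|N z N0 Nev z0].
  by rewrite mulr_ge0.
pose a k := if coprime k N then mu k / (k%:R * (totient k)%:R) else 0.
have Ha k : (0 < k)%N -> `|a k| <= K * isqrt k ^+ 3.
  move=> k0; rewrite /a; case: ifP => _; last first.
    by rewrite normr0 mulr_ge0 // exprn_ge0 // isqrt_ge0.
  by apply: normr_coef_le; have [] := HK k k0.
have [c tc Hc] := isqrt_series Ha.
suff -> : calA N = c by rewrite big_mkcond; exact: Hc.
apply: cvg_lim => //.
have -> : (fun m => \prod_(0 <= p < m | prime p && (~~ (p %| N) && (2 < p))%N)
             (1 - (p%:R * (p%:R - 1))^-1)) =
  (fun m => \prod_(0 <= p < m | prime p && ~~ (p %| N)%N) (1 - (p%:R * (totient p)%:R)^-1) : R).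
  apply/funext => m; rewrite (eq_bigl (fun p => prime p && ~~ (p %| N)%N)).
    by apply: eq_bigr => p /andP[pp _]; rewrite totient_prime_natr.
  move=> p; case pp : (prime p) => //=; case pN : (p %| N)%N => //=.
  rewrite ltn_neqAle prime_gt1 // andbT; apply/eqP => p2.
  by move: pN; rewrite -p2 dvdn2 Nev.
apply: (@euler_product_cvg (fun d => (d%:R * (totient d)%:R)^-1) K c N) => //.
- by rewrite mul1r invr1.
- by move=> p d pp d0 pd; rewrite totientMp // !natrM !invfM; ring.
- move=> d d0; rewrite ger0_norm ?invr_ge0 ?mulr_ge0 //; exact: (HK d d0).2.
- move: tc; rewrite (_ : (fun n => \sum_(1 <= k < n.+1) a k) = (fun n =>
    \sum_(1 <= d < n.+1 | coprime d N) mu d / (d%:R * (totient d)%:R))) //.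
  by apply/funext => n; rewrite [RHS]big_mkcond.
Qed.

Let odd_part m : R := \prod_(0 <= p < m | prime p && (2 < p)%N) (1 - ((p%:R - 1) ^+ 2)^-1).

(** The left side is the telescoping product of [1 - (k - 1) ^ (-2)] over all integers [k] from 3 to
    [n.+2]; keeping only the primes drops factors at most 1. In the limit this gives 1/2. *)
Lemma odd_part_ge n : (n.+2)%:R / (2 * n.+1%:R) <= odd_part n.+3.
Proof.
elim: n => [|n IH].
  rewrite /odd_part big_mkcond !big_nat_recr //= big_geq //= !mul1r; lra.
rewrite /odd_part big_mkcond big_nat_recr //= -big_mkcond -/(odd_part n.+3) /=.
have n0 : 0 <= n%:R :> R by [].
set A := odd_part n.+3 in IH *.
have e2 : n.+2%:R = n%:R + 2 :> R by rewrite -!natr1; ring.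
have e1 : n.+1%:R = n%:R + 1 :> R by rewrite -!natr1; ring.
have e3 : n.+3%:R = n%:R + 3 :> R by rewrite -!natr1; ring.
rewrite e1 e2 in IH; rewrite e2 e3.
move: n0 IH; move: (n%:R : R) => x x0 IH.
case: ifP => _.
  have h : 0 <= 1 - ((x + 3 - 1) ^+ 2)^-1.
    rewrite subr_ge0 invf_le1 ?exprn_gt0; [|lra..].
    by rewrite exprn_ege1 //; lra.
  apply: le_trans (ler_wpM2r h IH); rewrite le_eqVlt; apply/orP; left; apply/eqP.
  field; rewrite !lt0r_neq0 //; lra.
rewrite mulr1; apply: le_trans IH.
rewrite ler_pdivrMr; last by lra.
rewrite mulrAC ler_pdivlMr; last by lra.
by nra.
Qed.

(** For a prime [p > 2] dividing [N], [(1 - (p - 1) ^ (-2)) * (1 + 1 / (p - 2)) = p / (p - 1)], and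
    the leading 2 is this ratio at [p = 2]; together they form [N / phi N]. The identity is exact
    for partial products beyond [N], then passes to the limit. *)
Lemma singular_seriesE N : (0 < N)%N -> ~~ odd N ->
  @singular_series R N = singular_constant N /\ 1 <= @singular_series R N.
Proof.
move=> N0 Nev.
pose B : R := \prod_(p <- primes N | (2 < p)%N) (1 + (p%:R - 2)^-1).
pose Pr m : R := \prod_(0 <= p < m | prime p && ~~ (p %| N)%N) (1 - (p%:R - 1) ^- 2).
have B1 : 1 <= B.
  apply: (big_ind (fun x => 1 <= x)) => // [x y x1 y1|p p2]; first exact: mulr_ege1.
  by rewrite lerDl invr_ge0 subr_ge0 ler_nat ltnW.
have N2 : 2%N \in primes N by rewrite mem_primes N0 /= dvdn2.
have rel m : (N < m)%N -> 2 * odd_part m * B = N%:R / (totient N)%:R * Pr m.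
  move=> Nm; rewrite /odd_part (bigID (fun p => p %| N)%N) /=.
  rewrite (eq_bigl (fun p => (prime p && (p %| N)%N) && (2 < p)%N)); last first.
    by move=> p; rewrite -!andbA; congr (_ && _); rewrite andbC.
  rewrite [X in 2 * (_ * X)](eq_bigl (fun p => prime p && ~~ (p %| N)%N)); last first.
    move=> p; case pp : (prime p) => //=; case pN : (p %| N)%N; rewrite ?andbF // !andbT.
    rewrite ltn_neqAle prime_gt1 // andbT; apply/eqP => p2.
    by move: pN; rewrite -p2 dvdn2 Nev.
  rewrite -/(Pr m) -big_filter_cond.
  have perm : perm_eq [seq p <- index_iota 0 m | prime p && (p %| N)%N] (primes N).
    apply: uniq_perm; rewrite ?primes_uniq ?filter_uniq ?iota_uniq // => p.
    rewrite mem_filter mem_index_iota mem_primes N0 /= andb_idr // => /andP[_ pN].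
    by apply: leq_ltn_trans Nm; exact: dvdn_leq.
  rewrite (perm_big _ perm) natr_div_totient //.
  rewrite (bigID (fun p => 2 < p)%N (fun p => true)) /=.
  have -> : \prod_(p <- primes N | ~~ (2 < p)%N) (p%:R / p.-1%:R) = 2 :> R.
    rewrite big_mkcond (bigD1_seq 2%N) ?primes_uniq //= divr1 big1_seq ?mulr1 // => p.
    move=> /andP[p2]; rewrite mem_primes => /and3P[pp _ _].
    by rewrite ltn_neqAle eq_sym p2 prime_gt1.
  have -> : \prod_(p <- primes N | (2 < p)%N) (p%:R / p.-1%:R) =
     \prod_(p <- primes N | (2 < p)%N) (1 - ((p%:R - 1) ^+ 2)^-1) * B :> R.
    rewrite /B -big_split /= big_seq_cond [RHS]big_seq_cond; apply: eq_bigr => p /andP[_ p2].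
    have p0 : (0 < p)%N by exact: leq_trans p2.
    have -> : p.-1%:R = p%:R - 1 :> R by rewrite -[in RHS](prednK p0) -natr1 addrK.
    have : 3 <= p%:R :> R by rewrite ler_nat.
    by move: (p%:R : R) => x x3; field; rewrite !lt0r_neq0 //; lra.
  by ring.
have oc : odd_part @ \oo --> N%:R / (totient N)%:R * coprime_euler N / (2 * B).
  have h : (fun m => N%:R / (totient N)%:R * Pr m / (2 * B)) @ \oo -->
      N%:R / (totient N)%:R * coprime_euler N / (2 * B).
    apply: cvgM; last exact: cvg_cst.
    by apply: cvgM; [exact: cvg_cst|exact: coprime_euler_cvg].
  apply: cvg_trans h; apply: near_eq_cvg; exists N.+1 => // m /= Nm.
  by rewrite -rel //; field; rewrite gt_eqF // (lt_le_trans ltr01 B1).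
have lim_ge : 2^-1 <= limn odd_part.
  apply: limr_ge; first by apply/cvg_ex; eexists; exact: oc.
  exists 3%N => // -[|[|[|n]]] //= _; apply: le_trans (odd_part_ge n).
  by rewrite ler_pdivlMr ?mulr_gt0 ?ltr0n // mulKf // ler_nat.
have SE : @singular_series R N = 2 * limn odd_part * B by [].
split.
  rewrite SE (cvg_lim _ oc) // /singular_constant; field.
  by rewrite totient_neq0 //= gt_eqF // (lt_le_trans ltr01 B1).
rewrite SE -[1]mulr1; apply: ler_pM => //; lra.
Qed.

End EulerProducts.

(** * Decomposition of the Goldbach sum *)

(** The condition makes every divisor of [N - n] coprime to [N], so that [N] is an admissible
    residue class for it. *)
Definition coprime_mangoldt {R : realType} (N n : nat) : R :=
  if coprime n N then vonMangoldt n else 0.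

Section GoldbachDecomposition.
Context {R : realType}.
Local Notation L := (@slog R).
Local Notation Lambda := (@vonMangoldt R).
Local Notation Lambda' := (@coprime_mangoldt R).
Local Notation mu := (@moebius R).

Lemma coprime_mangoldt_ge0 N n : 0 <= Lambda' N n.
Proof. by rewrite /Lambda' /coprime_mangoldt; case: ifP => // _; exact: vonMangoldt_ge0. Qed.

Lemma coprime_mangoldt_le N n : Lambda' N n <= Lambda n.
Proof. by rewrite /Lambda' /coprime_mangoldt; case: ifP => // _; exact: vonMangoldt_ge0. Qed.

Lemma vonMangoldt_le_slog n N : (n <= N)%N -> Lambda n <= L N.
Proof.
move=> nN; have [->|n0] := posnP n; first exact: slog_ge0.
by apply: le_trans (vonMangoldt_le_ln n0) (le_trans (ln_le_slog n) _); exact: le_slog.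
Qed.

Lemma sum_noncoprime_mangoldt N : (0 < N)%N ->
  \sum_(1 <= n < N.+1 | ~~ coprime n N) Lambda n <= 2 * L N ^+ 2.
Proof.
move=> N0; apply: le_trans (@sum_vonMangoldt_dvd_pow R N N _ N0 _) _.
  by move=> p k pp k0 _; rewrite coprime_pexpl // prime_coprime // negbK.
have h := @ln_le_slog R N; have h0 := @ln_nat_ge0 R N.
by rewrite -mulrA ler_wpM2l // expr2; apply: ler_pM.
Qed.

Lemma ln_fact_le s N : (s <= N)%N -> ln (s`!)%:R <= s%:R * L N :> R.
Proof.
elim: s => [|s IH] sN; first by rewrite fact0 ln1 mul0r.
rewrite factS natrM lnM ?posrE ?ltr0n ?fact_gt0 // -[X in X%:R * _]addn1 natrD mulrDl addrC mul1r.
apply: lerD; first by apply: IH; exact: ltnW.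
by apply: le_trans (ln_le_slog _) _; exact: le_slog.
Qed.

(** A prime power [p ^ k <= N] that is not squarefree has [k >= 2], hence [p <= s], so [p] divides
    the factorial of [s] and [sum_vonMangoldt_dvd_pow] applies. *)
Lemma sum_nsquarefree_mangoldt N s : (0 < s)%N -> (s * s <= N < s.+1 * s.+1)%N ->
  \sum_(1 <= m < N.+1 | ~~ squarefree m) Lambda m <= 2 * s%:R * L N ^+ 2.
Proof.
move=> s0 /andP[sN Ns].
apply: le_trans (@sum_vonMangoldt_dvd_pow R s`! N _ (fact_gt0 s) _) _.
  move=> p k pp k0 pkN nsq.
  have k2 : (2 <= k)%N.
    by move: k k0 nsq {pkN} => [|[|k]] // _; rewrite expn1 squarefree_prime.
  rewrite dvdn_fact // prime_gt0 //= leqNgt; apply/negP => sp.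
  have : (s.+1 * s.+1 <= N)%N.
    apply: leq_trans pkN; apply: leq_trans (_ : p ^ 2 <= _)%N; first by rewrite -mulnn leq_mul.
    by rewrite leq_pexp2l // prime_gt0.
  by rewrite leqNgt Ns.
have sN' : (s <= N)%N by apply: leq_trans sN; rewrite leq_pmulr.
have h := ln_fact_le sN'; have h1 := @ln_le_slog R N.
apply: (@le_trans _ _ (2 * L N * (s%:R * L N))); last by rewrite le_eqVlt; apply/orP; left; apply/eqP; ring.
by apply: ler_pM => //; rewrite ?mulr_ge0 ?ln_nat_ge0 // ler_wpM2l.
Qed.

Definition goldbach_sqf N : R :=
  \sum_(1 <= n < N) Lambda' N n * (mu (N - n) ^+ 2 * Lambda (N - n)).

Lemma goldbach_sqf_approx N s : (0 < s)%N -> (s * s <= N < s.+1 * s.+1)%N ->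
  `|goldbach_r N - goldbach_sqf N| <= 4 * s%:R * L N ^+ 3.
Proof.
move=> s0 sN; have N0 : (0 < N)%N.
  by case/andP: sN => h _; apply: leq_trans h; rewrite muln_gt0 s0.
rewrite /goldbach_r /goldbach_sqf -sumrB; apply: le_trans (ler_norm_sum _ _ _) _.
apply: (@le_trans _ _ (\sum_(1 <= n < N) (L N * (if ~~ coprime n N then Lambda n else 0) +
   L N * (if ~~ squarefree (N - n) then Lambda (N - n) else 0)))).
  apply: ler_sum_nat => n /andP[n0 nN].
  have hn := vonMangoldt_le_slog (ltnW nN); have hm := @vonMangoldt_le_slog (N - n) N (leq_subr _ _).
  have n_ge := @vonMangoldt_ge0 R n; have m_ge := @vonMangoldt_ge0 R (N - n).
  have l0 := @slog_ge0 R N.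
  rewrite moebius_sqr /Lambda' /coprime_mangoldt.
  have p0 : 0 <= Lambda n * Lambda (N - n) by rewrite mulr_ge0.
  case: (coprime n N); case: (squarefree _) => /=;
    rewrite !(mulr0, mul0r, mul1r, mulr1, addr0, add0r, subr0, subrr, normr0) ?(ger0_norm p0) //.
  - by apply: ler_pM.
  - by rewrite mulrC; apply: ler_pM.
  - by rewrite -[leLHS]addr0 mulrC; apply: lerD; [apply: ler_pM|rewrite mulr_ge0].
rewrite big_split /= -!mulr_sumr.
have h1 : \sum_(1 <= n < N) (if ~~ coprime n N then Lambda n else 0) <= 2 * L N ^+ 2.
  apply: le_trans (sum_noncoprime_mangoldt N0).
  rewrite [leRHS]big_mkcond [leRHS]big_nat_recr //= lerDl.
  by case: ifP => // _; exact: vonMangoldt_ge0.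
have h2 : \sum_(1 <= n < N) (if ~~ squarefree (N - n) then Lambda (N - n) else 0) <= 2 * s%:R * L N ^+ 2.
  apply: le_trans (sum_nsquarefree_mangoldt s0 sN).
  rewrite big_nat_rev /= [leRHS]big_mkcond [leRHS]big_nat_recr //=.
  apply: (@le_trans _ _ (\sum_(1 <= i < N) if ~~ squarefree i then Lambda i else 0)).
    apply: ler_sum_nat => i /andP[i0 iN].
    by have -> : (N - (1 + N - i.+1) = i)%N by rewrite add1n subSS subKn // ltnW.
  by rewrite lerDl; case: ifP => // _; exact: vonMangoldt_ge0.
have l0 := @slog_ge0 R N.
apply: le_trans (lerD (ler_wpM2l l0 h1) (ler_wpM2l l0 h2)) _.
have s1 : 1 <= s%:R :> R by rewrite ler1n.
have l3 : 0 <= L N ^+ 3 by rewrite exprn_ge0.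
have := ler_wpM2r l3 s1.
have -> : L N * (2 * L N ^+ 2) = 2 * L N ^+ 3 by ring.
have -> : L N * (2 * s%:R * L N ^+ 2) = 2 * (s%:R * L N ^+ 3) by ring.
have -> : 4 * s%:R * L N ^+ 3 = 4 * (s%:R * L N ^+ 3) by ring.
by lra.
Qed.

Definition small_part N D : R := \sum_(1 <= n < N) Lambda' N n * (mu (N - n) ^+ 2 *
  \sum_(1 <= d < D.+1 | (d %| N - n)%N) mu d * ln d%:R).

Definition large_part N D : R := \sum_(1 <= n < N) Lambda' N n * (mu (N - n) *
  \sum_(1 <= e < ((N - n) %/ D.+1).+1 | (e %| N - n)%N) mu e * ln ((N - n)%:R / e%:R)).

Lemma sum_divisors_div (V : nmodType) m (f : nat -> V) : (0 < m)%N ->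
  \sum_(1 <= d < m.+1 | (d %| m)%N) f d = \sum_(1 <= e < m.+1 | (e %| m)%N) f (m %/ e)%N.
Proof.
move=> m0; rewrite -big_filter -[RHS]big_filter.
set s := [seq i <- index_iota 1 m.+1 | (i %| m)%N].
have memE d : (d \in s) = (0 < d)%N && (d %| m)%N.
  rewrite mem_filter mem_index_iota andbC; case: (boolP (d %| m)%N) => de; rewrite ?andbF //.
  by rewrite !andbT ltnS (dvdn_leq m0 de) andbT.
have us : uniq s by rewrite filter_uniq // iota_uniq.
rewrite -(big_map (fun d => m %/ d)%N xpredT f).
apply: perm_big; apply: uniq_perm => //.
  rewrite map_inj_in_uniq // => a b; rewrite !memE => /andP[a0 ae] /andP[b0 be] H.
  by rewrite -[a](mulKn _ m0) -divnA // H divnA // mulKn.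
move=> d; rewrite memE; apply/andP/mapP => [[d0 de]|[c]].
  exists (m %/ d)%N; first by rewrite memE divn_gt0 // dvdn_leq // dvdn_div.
  by rewrite divnA // mulKn.
by rewrite memE => /andP[c0 ce] ->; rewrite divn_gt0 // dvdn_leq // dvdn_div.
Qed.

(* The terms [d > D] of [\sum_(d %| m) mu d * ln d] are reindexed by [d = m / e], where
   [mu d = mu m * mu e] since [m] is squarefree. *)
Lemma goldbach_sqfE N D : goldbach_sqf N = - small_part N D - large_part N D.
Proof.
rewrite -opprD -big_split -sumrN; apply: eq_big_nat => n /andP[n0 nN] /=.
rewrite -mulrDr -mulrN; congr (_ * _).
set m := (N - n)%N; have m0 : (0 < m)%N by rewrite subn_gt0.
have [sm|sm] := boolP (squarefree m); last by rewrite moebius_nsquarefree // expr0n !mul0r addr0 oppr0.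
rewrite moebius_sqr sm !mul1r -[Lambda m]opprK -sum_moebius_ln //; congr (- _).
rewrite (bigID (fun d => d <= D)%N) /=; congr (_ + _).
  rewrite big_mkcondr -(@sum_divisors_widen _ m (maxn m D)) ?m0 ?leq_maxl //.
  rewrite [RHS](@big_nat_widen _ _ _ 1 D.+1 (maxn m D).+1) ?ltnS ?leq_maxr //.
  by rewrite [RHS]big_mkcondr.
rewrite big_mkcondr sum_divisors_div // mulr_sumr.
rewrite [RHS](@big_nat_widen _ _ _ 1 _ m.+1) ?ltnS ?leq_div //.
rewrite [RHS]big_mkcondr; apply: eq_sum_nat => e /andP[e0 em] dem.
have e_le : (e <= m)%N by [].
have q0 : (0 < m %/ e)%N by rewrite divn_gt0.
have -> : (~~ (m %/ e <= D)%N) = (e < (m %/ D.+1).+1)%N.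
  by rewrite -ltnNge ltnS !leq_divRL // mulnC.
case: ifP => // _.
have mE : mu m = mu e * mu (m %/ e).
  by rewrite -moebiusM ?squarefree_coprime_div // mulnC divnK.
have se : squarefree e := dvdn_squarefree dem sm.
have -> : mu m * (mu e * ln (m%:R / e%:R)) = mu e ^+ 2 * (mu (m %/ e) * ln (m%:R / e%:R)).
  by rewrite mE; ring.
rewrite moebius_sqr se mul1r; congr (_ * ln _).
by rewrite -[in RHS](divnK dem) natrM mulfK // pnatr_eq0 -lt0n.
Qed.

Lemma sum_inv_sqr_tail b n : (0 < b)%N ->
  \sum_(b <= k < n) k%:R ^- 2 <= 2 / b%:R :> R.
Proof.
move=> b0; have [nb|bn] := leqP n b; first by rewrite big_geq // divr_ge0.
have bp : 0 < b%:R :> R by rewrite ltr0n.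
have b1 : 1 <= b%:R :> R by rewrite ler1n.
rewrite big_ltn //.
case: n bn => // n bn.
have := @sum_le_telescope R (fun k => k%:R ^- 2) (fun k => k%:R^-1) b n bn.
have n0 : 0 <= n%:R^-1 :> R by rewrite invr_ge0.
have h1 : b%:R ^- 2 <= b%:R^-1 :> R.
  by rewrite lef_pV2 ?posrE ?exprn_gt0 // expr2 ler_peMl // ltW.
have -> : 2 / b%:R = b%:R^-1 + b%:R^-1 :> R by ring.
move=> h; apply: lerD => //; apply: le_trans (h _) _; last by rewrite gerBl.
move=> k /andP[bk _]; have k0 : 0 < k%:R :> R by rewrite ltr0n; exact: leq_trans bk.
rewrite -natr1; move: (k%:R : R) k0 => x x0.
have -> : x^-1 - (x + 1)^-1 = (x * (x + 1))^-1.
  by field; rewrite !lt0r_neq0 //; lra.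
by rewrite lef_pV2 ?posrE ?exprn_gt0 ?mulr_gt0; [|lra..]; rewrite expr2 ler_wpM2r; lra.
Qed.

(** [2 ^ omega k] counts squarefree divisors, so the sum is at most that of [(a * b) ^ (-2)] over
    pairs with [a * b > K]. For fixed [a] the tail over [b > K / a] is [O(a / K)], which leaves a
    harmonic sum in [a]. *)
Lemma sum_divisor_count_tail K X :
  \sum_(K.+1 <= k < X.+1) (2 ^+ size (primes k)) * k%:R ^- 2 <= 2 * L X / K.+1%:R :> R.
Proof.
have [XK|KX] := leqP X.+1 K.+1.
  by rewrite big_geq // divr_ge0 // mulr_ge0 // slog_ge0.
pose F (a b : nat) : R := if (K < a * b)%N then (a * b)%:R ^- 2 else 0.
apply: (@le_trans _ _ (\sum_(1 <= n < X.+1) \sum_(1 <= d < n.+1 | (d %| n)%N) F d (n %/ d)%N)).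
  rewrite [leRHS](big_cat_nat (n := K.+1)) //=; last exact: ltnW.
  rewrite -[leLHS]add0r; apply: lerD.
    apply: sumr_ge0 => n _; apply: sumr_ge0 => d _; rewrite /F; case: ifP => // _.
  apply: ler_sum_nat => k /andP[Kk _]; have k0 : (0 < k)%N by exact: leq_trans Kk.
  rewrite -sum_normr_moebius // mulr_suml.
  rewrite big_mkcond [leRHS]big_mkcond; apply: ler_sum_nat => d /andP[d0 _].
  case: ifPn => // dk; by rewrite /F mulnC divnK // Kk ler_piMl ?normr_moebius_le1.
rewrite hyperbola.
apply: (@le_trans _ _ (\sum_(1 <= a < X.+1) 2 / K.+1%:R * a%:R^-1)); last first.
  rewrite -mulr_sumr mulrAC; apply: ler_wpM2r; first by rewrite invr_ge0.
  by rewrite ler_wpM2l // harmonic_le.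
apply: ler_sum_nat => a /andP[a0 _].
have a0' : 0 < a%:R :> R by rewrite ltr0n.
have key : \sum_(1 <= b < (X %/ a).+1) F a b <=
    a%:R ^- 2 * \sum_((K %/ a).+1 <= b < (X %/ a).+1) b%:R ^- 2.
  rewrite (big_cat_nat (n := (K %/ a).+1)) //=; last by rewrite ltnS leq_div2r // -ltnS ltnW.
  rewrite big1_seq ?add0r; last first.
    move=> b /=; rewrite mem_index_iota => /andP[_]; rewrite ltnS leq_divRL // => bK.
    by rewrite /F ltnNge mulnC bK.
  rewrite mulr_sumr; apply: ler_sum => b _; rewrite /F; case: ifP => _.
    by rewrite natrM exprMn invfM.
  by rewrite mulr_ge0 ?invr_ge0 ?exprn_ge0.
apply: (le_trans key).
apply: le_trans (ler_wpM2l _ (sum_inv_sqr_tail _ _)) _ => //.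
have h : K.+1%:R <= a%:R * (K %/ a).+1%:R :> R.
  by rewrite -natrM ler_nat mulnC ltn_ceil.
have c0 : 0 < (K %/ a).+1%:R :> R by rewrite ltr0n.
have K0 : 0 < K.+1%:R :> R by rewrite ltr0n.
have -> : a%:R ^- 2 * (2 / (K %/ a).+1%:R) = 2 / (a%:R * (K %/ a).+1%:R) * a%:R^-1 :> R.
  by move: a0' c0; move: (a%:R : R) (_.+1%:R : R) => x y x0 y0; field; rewrite !gt_eqF.
rewrite ler_wpM2r ?invr_ge0 ?(ltW a0') // ler_wpM2l // lef_pV2 ?posrE //.
by rewrite mulr_gt0.
Qed.

Lemma two_pow_omega_sqrM k m : (0 < k)%N -> (0 < m)%N ->
  2 ^+ size (primes (k ^ 2 * m)) <= 2 ^+ size (primes k) * 2 ^+ size (primes m) :> R.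
Proof.
move=> k0 m0; rewrite -exprD ler_weXn2l ?ler1n // -size_cat.
apply: uniq_leq_size; first exact: primes_uniq.
move=> p; rewrite primesM ?expn_gt0 ?k0 // mem_cat primesX //.
Qed.

Lemma sum_two_pow_omega y : \sum_(1 <= m < y.+1) 2 ^+ size (primes m) <= y%:R * L y :> R.
Proof.
apply: (@le_trans _ _ (\sum_(1 <= n < y.+1) \sum_(1 <= d < n.+1 | (d %| n)%N) 1)).
  apply: ler_sum_nat => n /andP[n0 _]; rewrite -sum_normr_moebius //.
  by apply: ler_sum => d _; exact: normr_moebius_le1.
rewrite (@hyperbola R y (fun _ _ => 1)).
apply: (@le_trans _ _ (\sum_(1 <= d < y.+1) y%:R * d%:R^-1)).
  apply: ler_sum_nat => d /andP[d0 _]; rewrite sumr_const_nat subn1 /=.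
  by rewrite ler_pdivlMr ?ltr0n // -natrM ler_nat leq_divM.
by rewrite -mulr_sumr ler_wpM2l // harmonic_le.
Qed.

Definition small_part_trunc N D K : R := \sum_(1 <= n < N) Lambda' N n *
  ((\sum_(1 <= k < K.+1 | (k ^ 2 %| N - n)%N) mu k) *
   \sum_(1 <= d < D.+1 | (d %| N - n)%N) mu d * ln d%:R).

Lemma sum_divisors_ln_le N m D : (0 < m <= N)%N ->
  `|\sum_(1 <= d < D.+1 | (d %| m)%N) mu d * ln d%:R| <= L N * 2 ^+ size (primes m).
Proof.
move=> /andP[m0 mN]; apply: le_trans (ler_norm_sum _ _ _) _.
rewrite -sum_normr_moebius // mulr_sumr -(@sum_divisors_widen _ m (maxn m D)) ?m0 ?leq_maxl //.
rewrite [leRHS](big_cat_nat (n := D.+1)) //= ?ltnS ?leq_maxr // -[leLHS]addr0.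
have l0 := @slog_ge0 R N.
apply: lerD; last by apply: sumr_ge0 => d _; rewrite mulr_ge0.
rewrite big_mkcond [leRHS]big_mkcond; apply: ler_sum_nat => d /andP[d0 _].
case: ifP => // dm; rewrite normrM mulrC ler_wpM2r // ger0_norm ?ln_nat_ge0 //.
apply: le_trans (ln_le_slog _) _; apply: le_slog; apply: leq_trans mN; exact: dvdn_leq.
Qed.

Lemma moebius_sqr_trunc N m K : (0 < m <= N)%N -> (K <= N)%N ->
  `|mu m ^+ 2 - \sum_(1 <= k < K.+1 | (k ^ 2 %| m)%N) mu k| <=
  \sum_(K.+1 <= k < N.+1) (k ^ 2 %| m)%N%:R.
Proof.
move=> mN KN; rewrite moebius_sqr -(sum_moebius_sqr mN).
rewrite (big_cat_nat (n := K.+1)) //= addrAC subrr add0r.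
apply: le_trans (ler_norm_sum _ _ _) _; rewrite big_mkcond; apply: ler_sum => k _.
by case: ifP => // _; exact: normr_moebius_le1.
Qed.

(** Put [N - n = k ^ 2 * e]. Since [2 ^ omega] is submultiplicative here, the sum over
    [e <= N / k ^ 2] is at most [2 ^ omega k * (N / k ^ 2) * L N], and [sum_divisor_count_tail]
    handles [k]. *)
Lemma sum_weighted_square_tail N K : (0 < N)%N -> (K <= N)%N ->
  \sum_(1 <= n < N) (\sum_(K.+1 <= k < N.+1) (k ^ 2 %| N - n)%N%:R) *
     2 ^+ size (primes (N - n)) <= 2 * N%:R * L N ^+ 2 / K.+1%:R :> R.
Proof.
move=> N0 KN.
apply: (@le_trans _ _ (\sum_(K.+1 <= k < N.+1) \sum_(1 <= m < N.+1 | (k ^ 2 %| m)%N)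
   2 ^+ size (primes m))).
  rewrite big_nat_rev /=.
  apply: (@le_trans _ _ (\sum_(1 <= m < N) \sum_(K.+1 <= k < N.+1)
      (if (k ^ 2 %| m)%N then 2 ^+ size (primes m) else 0))).
    apply: ler_sum_nat => i /andP[i0 iN].
    have -> : (N - (1 + N - i.+1) = i)%N by rewrite add1n subSS subKn // ltnW.
    rewrite mulr_suml; apply: ler_sum => k _; case: ifP => _; by rewrite ?mul1r ?mul0r.
  rewrite exchange_big_nat /=; apply: ler_sum => k _.
  rewrite [leRHS]big_mkcond [leRHS]big_nat_recr //= lerDl; case: ifP => // _.
apply: (@le_trans _ _ (\sum_(K.+1 <= k < N.+1)
    N%:R * L N * (2 ^+ size (primes k) * k%:R ^- 2))); last first.
  rewrite -mulr_sumr; apply: le_trans (ler_wpM2l _ (sum_divisor_count_tail K N)) _.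
    by rewrite mulr_ge0 // slog_ge0.
  by rewrite le_eqVlt; apply/orP; left; apply/eqP; ring.
apply: ler_sum_nat => k /andP[Kk _]; have k0 : (0 < k)%N by exact: leq_trans Kk.
rewrite sum_multiples ?expn_gt0 ?k0 //.
apply: (@le_trans _ _ (2 ^+ size (primes k) * \sum_(1 <= e < (N %/ k ^ 2).+1) 2 ^+ size (primes e))).
  rewrite mulr_sumr; apply: ler_sum_nat => e /andP[e0 _]; exact: two_pow_omega_sqrM.
rewrite mulrCA ler_wpM2l ?exprn_ge0 //; apply: le_trans (sum_two_pow_omega _) _.
rewrite mulrAC; apply: ler_pM => //; first exact: slog_ge0.
  rewrite ler_pdivlMr ?exprn_gt0 ?ltr0n // -natrX -natrM ler_nat; exact: leq_divM.
by apply: le_slog; exact: leq_div.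
Qed.

(** Bounding [Lambda'] and the [ln d] by [L N] costs [L N ^+ 2], the square tail another [L N ^+ 2].
    This fourth power is the 4 in the exponent of [logcut]. *)
Lemma small_part_trunc_approx N D K : (0 < N)%N -> (K <= N)%N ->
  `|small_part N D - small_part_trunc N D K| <= 2 * N%:R * L N ^+ 4 / K.+1%:R.
Proof.
move=> N0 KN; rewrite /small_part /small_part_trunc -sumrB.
apply: le_trans (ler_norm_sum _ _ _) _.
have l0 := @slog_ge0 R N.
apply: (@le_trans _ _ (\sum_(1 <= n < N) L N ^+ 2 *
   ((\sum_(K.+1 <= k < N.+1) (k ^ 2 %| N - n)%N%:R) * 2 ^+ size (primes (N - n))))); last first.
  rewrite -mulr_sumr; apply: le_trans (ler_wpM2l _ (sum_weighted_square_tail N0 KN)) _.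
    exact: sqr_ge0.
  by rewrite le_eqVlt; apply/orP; left; apply/eqP; ring.
apply: ler_sum_nat => n /andP[n0 nN].
have mN : (0 < N - n <= N)%N by rewrite subn_gt0 nN leq_subr.
rewrite -mulrBr -mulrBl normrM normrM.
have h1 : `|Lambda' N n| <= L N.
  rewrite ger0_norm ?coprime_mangoldt_ge0 //; apply: le_trans (coprime_mangoldt_le _ _) _.
  by apply: vonMangoldt_le_slog; exact: ltnW.
have h2 := moebius_sqr_trunc mN KN.
have h3 := sum_divisors_ln_le D mN.
apply: le_trans (ler_pM _ _ h1 (ler_pM _ _ h2 h3)) _ => //.
by rewrite le_eqVlt; apply/orP; left; apply/eqP; ring.
Qed.

Definition small_main N D K : R := \sum_(1 <= k < K.+1 | coprime k N) mu k *
  \sum_(1 <= d < D.+1 | coprime d N) mu d * ln d%:R / (totient (lcmn d (k ^ 2)))%:R.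

(* For fixed [k] and fixed [gcdn d (k ^ 2)] the map [d |-> lcmn d (k ^ 2)] is injective. *)
Lemma sum_lcm_le (Delta : nat -> R) D K : (forall q, 0 <= Delta q) ->
  \sum_(1 <= k < K.+1) \sum_(1 <= d < D.+1) Delta (lcmn d (k ^ 2)) <=
  K%:R ^+ 3 * \sum_(1 <= q < (D * K ^ 2).+1) Delta q.
Proof.
move=> D0; set T := (X in _ * X).
have T0 : 0 <= T by apply: sumr_ge0.
apply: (@le_trans _ _ (\sum_(1 <= k < K.+1) (K ^ 2)%:R * T)); last first.
  rewrite sumr_const_nat subn1 /= -[leLHS]mulr_natl mulrA.
  by rewrite exprS natrX.
apply: ler_sum_nat => k /andP[k0 kK].
have k20 : (0 < k ^ 2)%N by rewrite expn_gt0 k0.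
have kK2 : (k ^ 2 <= K ^ 2)%N by rewrite leq_exp2r.
have step g : (0 < g)%N -> \sum_(1 <= d < D.+1 | (g %| d)%N) Delta (k ^ 2 * (d %/ g))%N <= T.
  move=> g0; rewrite sum_multiples //.
  rewrite (eq_bigr (fun e => Delta (k ^ 2 * e)%N)); last by move=> e _; rewrite mulKn.
  apply: (@le_trans _ _ (\sum_(1 <= e < D.+1) Delta (k ^ 2 * e)%N)).
    by rewrite [leRHS](big_cat_nat (n := (D %/ g).+1)) ?ltnS ?leq_div //= lerDl sumr_ge0.
  have := @sum_multiples R (k ^ 2) (D * k ^ 2) Delta k20; rewrite mulnK // => <-.
  rewrite /T [leRHS](big_cat_nat (n := (D * k ^ 2).+1)) ?ltnS ?leq_mul2l ?kK2 ?orbT //=.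
  rewrite -[leLHS]addr0; apply: lerD; last exact: sumr_ge0.
  by rewrite big_mkcond; apply: ler_sum => q _; case: ifP.
(* The actual gcd is enlarged to all [g <= K ^ 2] dividing [d], each costing one copy of [T]; with
   the [K] values of [k] this is the factor [K ^ 3]. *)
apply: (@le_trans _ _ (\sum_(1 <= g < (K ^ 2).+1) \sum_(1 <= d < D.+1 | (g %| d)%N)
    Delta (k ^ 2 * (d %/ g))%N)); last first.
  apply: (@le_trans _ _ (\sum_(1 <= g < (K ^ 2).+1) T)).
    by apply: ler_sum_nat => g /andP[g0 _]; exact: step.
  by rewrite sumr_const_nat subn1 /= mulr_natl.
rewrite (exchange_big_dep xpredT) //=; apply: ler_sum_nat => d /andP[d0 _].
have g0 : (0 < gcdn d (k ^ 2))%N by rewrite gcdn_gt0 d0.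
rewrite big_mkcond (bigD1_seq (gcdn d (k ^ 2))) ?iota_uniq //=; last first.
  rewrite mem_index_iota g0 ltnS (leq_trans _ kK2) //.
  by apply: dvdn_leq => //; exact: dvdn_gcdr.
rewrite dvdn_gcdl -[leLHS]addr0; apply: lerD.
  rewrite (_ : lcmn d (k ^ 2) = (k ^ 2 * (d %/ gcdn d (k ^ 2)))%N) //.
  by rewrite muln_divA ?dvdn_gcdl // /lcmn mulnC.
by apply: sumr_ge0 => g _; case: ifP.
Qed.

End GoldbachDecomposition.

(** * Divisors up to the level of EH *)

Section SmallPart.
Context {R : realType}.
Local Notation L := (@slog R).
Local Notation Lambda := (@vonMangoldt R).
Local Notation Lambda' := (@coprime_mangoldt R).
Local Notation mu := (@moebius R).

Definition coprime_progression N q : R := \sum_(1 <= n < N | (q %| N - n)%N) Lambda' N n.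

Lemma coprime_lcm a b N : coprime (lcmn a b) N = coprime a N && coprime b N.
Proof.
apply/idP/andP => [h|[ha hb]].
  by split; apply: coprime_dvdl h; rewrite ?dvdn_lcml ?dvdn_lcmr.
by apply: (@coprime_dvdl _ (a * b)); rewrite ?coprimeMl ?ha // dvdn_lcm dvdn_mulr ?dvdn_mull.
Qed.

(** A common factor of [q] and [N] divides [n] as soon as [q] divides [N - n], and then [Lambda']
    vanishes at [n]. *)
Lemma coprime_progression_eq0 N q : ~~ coprime q N -> coprime_progression N q = 0.
Proof.
move=> nqN; rewrite /coprime_progression big1_seq // => n /andP[qm].
rewrite mem_index_iota => /andP[n0 nN]; rewrite /Lambda' /coprime_mangoldt ifF //.
apply: contraNF nqN => cn; rewrite /coprime -dvdn1 -(eqP cn) dvdn_gcd dvdn_gcdr andbT.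
have h : (gcdn q N %| N - n)%N by apply: dvdn_trans qm; exact: dvdn_gcdl.
by rewrite -(dvdn_addr _ h) subnK ?dvdn_gcdr // ltnW.
Qed.

Lemma coprime_progression_approx N q (Delta : nat -> R) : (1 < N)%N -> coprime q N ->
  `|\sum_(1 <= n < N.-1.+1 | n == N %[mod q]) Lambda n - N.-1%:R / (totient q)%:R| <= Delta q ->
  `|coprime_progression N q - N.-1%:R / (totient q)%:R| <= Delta q + 2 * L N ^+ 2.
Proof.
move=> N1 cq; rewrite prednK; last exact: ltnW.
set T := \sum_(_ <= _ < _ | _) _ => hD.
have TE : T = \sum_(1 <= n < N | (q %| N - n)%N) Lambda n.
  rewrite /T big_mkcond [RHS]big_mkcond; apply: eq_big_nat => n /andP[n0 nN].
  by rewrite eq_sym (eqn_mod_dvd _ (ltnW nN)).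
have -> : coprime_progression N q - N.-1%:R / (totient q)%:R =
   (T - N.-1%:R / (totient q)%:R) - (T - coprime_progression N q) by ring.
apply: le_trans (ler_normB _ _) _; apply: lerD => //.
rewrite TE /coprime_progression -sumrB ger0_norm; last first.
  by apply: sumr_ge0 => n _; rewrite subr_ge0 coprime_mangoldt_le.
apply: le_trans (sum_noncoprime_mangoldt (ltnW N1)).
rewrite [leRHS]big_mkcond [leRHS]big_nat_recr ?(ltnW N1) //= -[leLHS]addr0; apply: lerD; last first.
  by case: ifP => // _; exact: vonMangoldt_ge0.
rewrite big_mkcond; apply: ler_sum => n _; have h := @vonMangoldt_ge0 R n.
by rewrite /Lambda' /coprime_mangoldt; case: (coprime n N); case: ifP => _ //=; rewrite ?subrr ?subr0.
Qed.

Lemma small_part_truncE N D K : small_part_trunc N D K =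
  \sum_(1 <= k < K.+1) \sum_(1 <= d < D.+1)
    mu k * (mu d * ln d%:R) * coprime_progression N (lcmn d (k ^ 2)).
Proof.
pose G n k d := if ((k ^ 2 %| N - n) && (d %| N - n))%N
   then mu k * (mu d * ln d%:R) * Lambda' N n else 0.
transitivity (\sum_(1 <= n < N) \sum_(1 <= k < K.+1) \sum_(1 <= d < D.+1) G n k d).
  apply: eq_bigr => n _; rewrite big_mkcond mulr_suml mulr_sumr; apply: eq_bigr => k _.
  rewrite [X in _ * (_ * X)]big_mkcond mulr_sumr mulr_sumr; apply: eq_bigr => d _.
  rewrite /G; case: (k ^ 2 %| N - n)%N; case: (d %| N - n)%N; rewrite /= ?mul0r ?mulr0 //.
  by rewrite mulrC.
rewrite exchange_big_nat; apply: eq_bigr => k _.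
rewrite exchange_big_nat; apply: eq_bigr => d _ /=.
rewrite /coprime_progression mulr_sumr [RHS]big_mkcond; apply: eq_bigr => n _.
by rewrite /G dvdn_lcm andbC.
Qed.

Lemma small_part_main N D K (Delta : nat -> R) : (1 < N)%N -> (D <= N)%N ->
  (forall q, 0 <= Delta q) ->
  (forall q, coprime q N ->
   `|\sum_(1 <= n < N.-1.+1 | n == N %[mod q]) Lambda n - N.-1%:R / (totient q)%:R| <= Delta q) ->
  `|small_part_trunc N D K - N.-1%:R * small_main N D K| <=
  L N * (K%:R ^+ 3 * \sum_(1 <= q < (D * K ^ 2).+1) Delta q) + K%:R * D%:R * (2 * L N ^+ 3).
Proof.
move=> N1 DN D0 HD.
have l0 := @slog_ge0 R N.
have -> : N.-1%:R * small_main N D K = \sum_(1 <= k < K.+1) \sum_(1 <= d < D.+1)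
   mu k * (mu d * ln d%:R) * (if coprime (lcmn d (k ^ 2)) N then
      N.-1%:R / (totient (lcmn d (k ^ 2)))%:R else 0).
  rewrite /small_main mulr_sumr big_mkcond; apply: eq_big_nat => k /andP[k0 _].
  under [RHS]eq_bigr do rewrite coprime_lcm coprime_pexpl //.
  case: ifP => _; last by rewrite big1 // => d _; rewrite andbF mulr0.
  rewrite mulrCA !mulr_sumr big_mkcond; apply: eq_bigr => d _; rewrite andbT.
  by case: ifP => _; [ring|rewrite mulr0].
rewrite small_part_truncE -sumrB; apply: le_trans (ler_norm_sum _ _ _) _.
apply: (@le_trans _ _ (\sum_(1 <= k < K.+1) \sum_(1 <= d < D.+1)
   (L N * Delta (lcmn d (k ^ 2)) + 2 * L N ^+ 3))).
  apply: ler_sum_nat => k _; rewrite -sumrB; apply: le_trans (ler_norm_sum _ _ _) _.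
  apply: ler_sum_nat => d /andP[d0 dD]; rewrite -mulrBr normrM.
  have h1 : `|mu k * (mu d * ln d%:R)| <= L N.
    rewrite !normrM (ger0_norm (ln_nat_ge0 _)).
    have hl : ln d%:R <= L N.
      by apply: le_trans (ln_le_slog _) _; apply: le_slog; exact: leq_trans DN.
    rewrite -[leRHS]mul1r; apply: ler_pM; rewrite ?normr_moebius_le1 ?mulr_ge0 ?ln_nat_ge0 //.
    by rewrite -[leRHS]mul1r; apply: ler_pM; rewrite ?normr_moebius_le1 ?ln_nat_ge0.
  have h2 : `|coprime_progression N (lcmn d (k ^ 2)) - (if coprime (lcmn d (k ^ 2)) N then
      N.-1%:R / (totient (lcmn d (k ^ 2)))%:R else 0)| <= Delta (lcmn d (k ^ 2)) + 2 * L N ^+ 2.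
    case: ifPn => cq; first by apply: coprime_progression_approx => //; exact: HD.
    rewrite coprime_progression_eq0 // subrr normr0 addr_ge0 // mulr_ge0 // sqr_ge0 //.
  apply: le_trans (ler_pM _ _ h1 h2) _ => //.
  by rewrite le_eqVlt; apply/orP; left; apply/eqP; ring.
under eq_bigr do rewrite big_split /= -mulr_sumr sumr_const_nat subn1 /=.
rewrite big_split /= -mulr_sumr sumr_const_nat subn1 /=; apply: lerD.
  by rewrite ler_wpM2l // sum_lcm_le.
by rewrite -mulrnA -[leLHS]mulr_natl natrM (mulrC D%:R).
Qed.

(** Write [d = a * b] with [a = gcdn d k]. A nonzero [mu d] forces [a] and [b] to be coprime, and
    then [b] is coprime to [k]; conversely such [b] give back [gcdn (a * b) k = a]. *)
Lemma sum_moebius_gcd k D (F : nat -> R) : (0 < k)%N ->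
  \sum_(1 <= d < D.+1) mu d * F d =
  \sum_(1 <= a < D.+1 | (a %| k)%N)
     mu a * \sum_(1 <= b < (D %/ a).+1 | coprime b k) mu b * F (a * b)%N.
Proof.
move=> k0.
transitivity (\sum_(1 <= d < D.+1) \sum_(1 <= a < D.+1 | (a %| k)%N)
    if (a %| d)%N && (gcdn d k == a) then mu d * F d else 0).
  apply: eq_big_nat => d /andP[d0 dD].
  have g0 : (0 < gcdn d k)%N by rewrite gcdn_gt0 d0.
  rewrite big_mkcond (bigD1_seq (gcdn d k)) ?iota_uniq //=; last first.
    by rewrite mem_index_iota g0 (leq_ltn_trans (dvdn_leq d0 (dvdn_gcdl _ _))).
  rewrite dvdn_gcdr dvdn_gcdl eqxx big1 ?addr0 // => a.
  by rewrite eq_sym => /negbTE ->; rewrite andbF if_same.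
rewrite (exchange_big_dep (fun a => a %| k)%N) //=; apply: eq_sum_nat => a /andP[a0 _] ak.
under eq_bigr do rewrite if_and.
rewrite (eq_bigl xpredT) // -big_mkcond sum_multiples // mulr_sumr [RHS]big_mkcond.
apply: eq_big_nat => b /andP[b0 _].
have [cb|cb] := boolP (coprime b k).
  have -> : gcdn (a * b) k = a.
    by rewrite gcdnC Gauss_gcdl 1?coprime_sym // gcdnC; apply/gcdn_idPl.
  rewrite eqxx moebiusM ?mulrA //; rewrite coprime_sym; exact: coprime_dvdr cb.
case: eqP => // gE.
have [cab|cab] := boolP (coprime a b); last by rewrite moebius_ncoprime // mul0r.
case/negP: cb; rewrite /coprime -dvdn1 -(eqP cab) dvdn_gcd dvdn_gcdl andbT.
by rewrite -gE dvdn_gcd dvdn_gcdr andbT dvdn_mull // dvdn_gcdl.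
Qed.

Lemma lcmn_mul_coprime a b k : (0 < k)%N -> (a %| k)%N -> coprime b k ->
  lcmn (a * b) (k ^ 2) = (b * k ^ 2)%N.
Proof.
move=> k0 ak cb; apply/eqP; rewrite eqn_dvd; apply/andP; split.
  rewrite dvdn_lcm (dvdn_mull b (dvdnn (k ^ 2))) andbT mulnC; apply: dvdn_mul => //.
  by rewrite -mulnn dvdn_mulr.
rewrite Gauss_dvd ?coprimeXr // dvdn_lcmr andbT.
by apply: dvdn_trans (dvdn_lcml _ _); rewrite dvdn_mull.
Qed.

(** With [d = a * b] as in [sum_moebius_gcd], [lcmn d (k ^ 2)] is [b * k ^ 2], independent of [a].
    Its totient factors, which leaves sums over [b] coprime to [k * N] with weight [1 / phi b]. *)
Lemma small_main_term N D k : (0 < N)%N -> (0 < k <= D)%N -> coprime k N ->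
  \sum_(1 <= d < D.+1 | coprime d N) mu d * ln d%:R / (totient (lcmn d (k ^ 2)))%:R =
  (totient (k ^ 2))%:R^-1 * \sum_(1 <= a < k.+1 | (a %| k)%N)
    mu a * (ln a%:R * totient_sum (k * N) (D %/ a) + totient_log_sum (k * N) (D %/ a)).
Proof.
move=> N0 /andP[k0 kD] ckN.
pose F d : R := if coprime d N then ln d%:R / (totient (lcmn d (k ^ 2)))%:R else 0.
transitivity (\sum_(1 <= d < D.+1) mu d * F d).
  rewrite big_mkcond; apply: eq_bigr => d _; rewrite /F; case: ifP => _; last by rewrite mulr0.
  by rewrite mulrA.
rewrite (sum_moebius_gcd _ _ k0) sum_divisors_widen ?k0 // mulr_sumr.
apply: eq_sum_nat => a /andP[a0 _] ak.
rewrite mulrCA; congr (_ * _); rewrite /totient_sum /totient_log_sum mulr_sumr -big_split /= mulr_sumr.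
rewrite big_mkcond [RHS]big_mkcond; apply: eq_big_nat => b /andP[b0 _].
rewrite coprimeMr; have [cbk|cbk] //= := boolP (coprime b k).
rewrite /F coprimeMl (coprime_dvdl ak ckN) /=; case: ifP => _; last by rewrite mulr0.
rewrite lcmn_mul_coprime // totient_coprime ?coprimeXr // natrM lnM ?posrE ?ltr0n //.
by rewrite natrM; field; rewrite !totient_neq0 // expn_gt0 k0.
Qed.

(* The limit of the inner sum is proportional to [\sum_(a %| k) mu a], so only [k = 1] survives. *)
Lemma small_main_asymp : PNT R -> forall j B, exists2 C : R, 0 <= C &
  forall N D K, (0 < N)%N -> (0 < K <= D)%N -> (15 < D %/ K)%N -> (K * N <= (D %/ K) ^ j)%N ->
  `|small_main N D K + singular_constant N| <= C * (K%:R ^+ 3 / L (D %/ K) ^+ B).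
Proof.
move=> pnt j B.
have [C1 C10 H1] := totient_sum_small pnt j B.
have [C2 C20 H2] := totient_log_sum_small pnt j B.
exists (C1 + C2) => [|N D K N0 /andP[K0 KD] y16 KNy]; first exact: addr_ge0.
set y := (D %/ K)%N in y16 KNy *; pose v := L y ^- B.
have v0 : 0 <= v by rewrite invr_ge0 exprn_ge0 // slog_ge0.
have K1 : 1 <= K%:R :> R by rewrite ler1n.
have SE : small_main N D K + singular_constant N = \sum_(1 <= k < K.+1 | coprime k N) mu k *
  (\sum_(1 <= d < D.+1 | coprime d N) mu d * ln d%:R / (totient (lcmn d (k ^ 2)))%:R +
   (k == 1%N)%:R * singular_constant N).
  under [RHS]eq_bigr do rewrite mulrDr.
  rewrite big_split /= -/(small_main N D K); congr (_ + _).
  rewrite big_mkcond big_ltn ?ltnS //= coprime1n moebius1 !mul1r big1_seq ?addr0 // => k /=.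
  rewrite mem_index_iota => /andP[k1 _].
  by rewrite gtn_eqF // mul0r mulr0 if_same.
rewrite SE; apply: le_trans (ler_norm_sum _ _ _) _.
apply: (@le_trans _ _ (\sum_(1 <= k < K.+1) K%:R ^+ 2 * (C1 + C2) * v)); last first.
  rewrite sumr_const_nat subn1 /= -[leLHS]mulr_natl le_eqVlt; apply/orP; left; apply/eqP.
  by rewrite /v; ring.
have T0 : 0 <= K%:R ^+ 2 * (C1 + C2) * v.
  by rewrite (mulr_ge0 (mulr_ge0 (sqr_ge0 _) (addr_ge0 C10 C20)) v0).
rewrite big_mkcond; apply: ler_sum_nat => k /andP[k0 kK].
case: ifP => // ckN.
rewrite normrM -[leRHS]mul1r; apply: ler_pM; rewrite ?normr_moebius_le1 //.
have kD : (k <= D)%N by exact: leq_trans KD.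
rewrite small_main_term ?k0 //.
have k20 : (0 < k ^ 2)%N by rewrite expn_gt0 k0.
pose S := singular_constant (k * N) : R.
have -> : (k == 1%N)%:R * singular_constant N =
   (totient (k ^ 2))%:R^-1 * \sum_(1 <= a < k.+1 | (a %| k)%N) mu a * S :> R.
  rewrite -mulr_suml sum_moebius //; case: eqP => [k1|_]; last by rewrite !mul0r mulr0.
  by rewrite /S k1 mul1n !mul1r exp1n (_ : totient 1 = 1%N) // invr1 mul1r.
rewrite -mulrDr -big_split /= normrM ger0_norm ?invr_ge0 //.
apply: (@le_trans _ _ (1 * \sum_(1 <= a < k.+1) K%:R * (C1 + C2) * v)); last first.
  rewrite mul1r sumr_const_nat subn1 /= -[leLHS]mulr_natl !mulrA.
  rewrite ler_wpM2r // ler_wpM2r ?addr_ge0 // expr2 ler_wpM2r // ler_nat -ltnS //.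
apply: ler_pM => //.
  by rewrite invf_le1 ?ltr0n ?ler1n ?totient_gt0.
apply: le_trans (ler_norm_sum _ _ _) _; rewrite big_mkcond.
apply: ler_sum_nat => a /andP[a0 ak]; case: ifP => [dak|_]; last first.
  by rewrite (mulr_ge0 (mulr_ge0 _ (addr_ge0 C10 C20)) v0).
have aK : (a <= K)%N by exact: leq_trans ak kK.
have yx : (y <= D %/ a)%N by exact: leq_div2l.
have x16 : (15 < D %/ a)%N by exact: leq_trans yx.
have kN0 : (0 < k * N)%N by rewrite muln_gt0 k0.
have kNx : (k * N <= (D %/ a) ^ j)%N.
  apply: (@leq_trans (K * N)); first by rewrite leq_mul2r (kK : (k <= K)%N) orbT.
  by apply: (leq_trans KNy); case: (j) => // i; rewrite leq_exp2r.
have vx : L (D %/ a) ^- B <= v by apply: ler_inv_exp; [exact: slog_gt0|exact: le_slog].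
have h1 := le_trans (H1 _ _ x16 kN0 kNx) (ler_wpM2l C10 vx).
have h2 := le_trans (H2 _ _ x16 kN0 kNx) (ler_wpM2l C20 vx).
rewrite -mulrDr normrM -[leRHS]mul1r; apply: ler_pM; rewrite ?normr_moebius_le1 //.
rewrite -addrA; apply: le_trans (ler_normD _ _) _; rewrite normrM ger0_norm ?ln_nat_ge0 //.
have la : ln a%:R <= K%:R :> R.
  apply: le_trans (ln_le_sub1 _) _; rewrite ?ltr0n //.
  have haK : a%:R <= K%:R :> R by rewrite ler_nat.
  by lra.
apply: le_trans (lerD (ler_pM (ln_nat_ge0 _) (normr_ge0 _) la h1) h2) _.
have := ler_wpM2r (mulr_ge0 C20 v0) K1; lra.
Qed.

End SmallPart.

(** * Divisors beyond the level of EH *)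

Section LargePart.
Context {R : realType}.
Local Notation L := (@slog R).
Local Notation Lambda := (@vonMangoldt R).
Local Notation Lambda' := (@coprime_mangoldt R).
Local Notation mu := (@moebius R).

Lemma exchange_large (N D : nat) (F : nat -> nat -> R) :
  \sum_(1 <= n < N) \sum_(1 <= e < ((N - n) %/ D.+1).+1) F n e =
  \sum_(1 <= e < (N %/ D.+1).+1) \sum_(1 <= n < (N - e * D.+1).+1) F n e.
Proof.
transitivity (\sum_(1 <= n < N) \sum_(1 <= e < (N %/ D.+1).+1)
    if (e * D.+1 <= N - n)%N then F n e else 0).
  apply: eq_big_nat => n /andP[n0 nN].
  rewrite (@big_nat_widen _ _ _ 1 _ (N %/ D.+1).+1) ?ltnS ?leq_div2r ?leq_subr //.
  by rewrite big_mkcond; apply: eq_bigr => e _; rewrite ltnS leq_divRL.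
rewrite exchange_big_nat; apply: eq_big_nat => e /andP[e0 eN] /=.
have eDN : (e * D.+1 <= N)%N by rewrite -leq_divRL.
have Z : ((N - e * D.+1).+1 <= N)%N.
  by rewrite ltn_subrL muln_gt0 e0 /=; apply: leq_trans eDN; rewrite muln_gt0 e0.
rewrite [RHS](@big_nat_widen _ _ _ 1 _ N) // [RHS]big_mkcond.
apply: eq_big_nat => n /andP[n0 nN].
by rewrite ltnS (leq_subRL _ eDN) (leq_subRL _ (ltnW nN)) addnC.
Qed.

Lemma coprime_of_dvd_sub N n q : (n <= N)%N -> (q %| N - n)%N -> coprime n N -> coprime q N.
Proof.
move=> nN qm cn; rewrite /coprime -dvdn1 -(eqP cn) dvdn_gcd dvdn_gcdr andbT.
have h : (gcdn q N %| N - n)%N by apply: dvdn_trans qm; exact: dvdn_gcdl.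
by rewrite -(dvdn_addr _ h) subnK ?dvdn_gcdr.
Qed.

Definition large_main N D : R := \sum_(1 <= e < (N %/ D.+1).+1 | coprime e N)
  mu e / (totient e)%:R *
  \sum_(1 <= n < (N - e * D.+1).+1) Lambda n * mu (N - n) * ln ((N - n)%:R / e%:R).

(** [ln ((N - n) / e)] decreases in [n] and stays nonnegative while [n <= N - e], so [abel_monotone]
    turns a bound uniform in [y] into one for the weighted sum. The term [v] accounts for the [n]
    not coprime to [N]. *)
Lemma large_part_progression N e Z (Delta : R) : (0 < e)%N -> (Z + e <= N)%N -> coprime e N ->
  0 <= Delta ->
  (forall y, (0 < y < N)%N -> `|\sum_(1 <= n < y.+1 | n == N %[mod e]) Lambda n * mu (N - n)
     - (totient e)%:R^-1 * \sum_(1 <= n < y.+1) Lambda n * mu (N - n)| <= Delta) ->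
  `|\sum_(1 <= n < Z.+1 | (e %| N - n)%N) Lambda' N n * mu (N - n) * ln ((N - n)%:R / e%:R)
   - (totient e)%:R^-1 *
     \sum_(1 <= n < Z.+1) Lambda n * mu (N - n) * ln ((N - n)%:R / e%:R)|
  <= L N * Delta + 2 * L N ^+ 3.
Proof.
move=> e0 ZeN ce D0 HD.
have l0 := @slog_ge0 R N.
have e0' : 0 < e%:R :> R by rewrite ltr0n.
have ZN : (Z < N)%N by apply: leq_trans ZeN; rewrite -addn1 leq_add2l.
pose f n : R := ln ((N - n)%:R / e%:R).
have f0 n : (n <= Z)%N -> 0 <= f n.
  move=> nZ; rewrite ln_ge0 // ler_pdivlMr // mul1r ler_nat.
  by rewrite leq_subRL ?(leq_trans nZ (ltnW ZN)) // (leq_trans _ ZeN) // leq_add2r.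
have mpos n : (n <= Z)%N -> 0 < (N - n)%:R / e%:R :> R.
  by move=> nZ; rewrite divr_gt0 // ltr0n subn_gt0 (leq_ltn_trans nZ).
have fL n : (n <= Z)%N -> f n <= L N.
  move=> nZ; have mp := mpos n nZ; apply: le_trans (ln_le_slog N).
  rewrite ler_ln ?posrE ?ltr0n ?(leq_ltn_trans _ ZN) // ler_pdivrMr // -natrM ler_nat.
  by apply: leq_trans (leq_subr n N) _; rewrite leq_pmulr.
pose u n : R := (if (n == N %[mod e])%N then Lambda n * mu (N - n) else 0)
   - (totient e)%:R^-1 * (Lambda n * mu (N - n)).
pose v n : R := if (n == N %[mod e])%N then (Lambda n - Lambda' N n) * mu (N - n) * f n else 0.
have -> : \sum_(1 <= n < Z.+1 | (e %| N - n)%N) Lambda' N n * mu (N - n) * ln ((N - n)%:R / e%:R)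
   - (totient e)%:R^-1 * \sum_(1 <= n < Z.+1) Lambda n * mu (N - n) * ln ((N - n)%:R / e%:R)
  = \sum_(1 <= n < Z.+1) u n * f n - \sum_(1 <= n < Z.+1) v n.
  rewrite mulr_sumr big_mkcond -!sumrB; apply: eq_big_nat => n /andP[n0 nZ].
  rewrite /u /v -/(f n) eq_sym eqn_mod_dvd; last by apply: leq_trans (ltnW ZN).
  by case: ifP => _; ring.
apply: le_trans (ler_normB _ _) _; apply: lerD.
  have [->|Z0] := posnP Z; first by rewrite big_geq // normr0 mulr_ge0.
  apply: le_trans (@abel_monotone R u f 0 Z Delta Z0 _ _ _) _.
  - move=> y /andP[y0 yZ]; rewrite /u sumrB -mulr_sumr -big_mkcond.
    by apply: HD; rewrite y0 (leq_ltn_trans yZ).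
  - by move=> k /andP[_ kZ]; exact: f0.
  - move=> k /andP[k0 kZ]; rewrite ler_ln ?posrE ?mpos //; last exact: ltnW.
    by rewrite ler_wpM2r ?invr_ge0 ?(ltW e0') // ler_nat leq_sub2l.
  - by rewrite mulrC ler_wpM2r // fL.
apply: le_trans (ler_norm_sum _ _ _) _.
apply: (@le_trans _ _ (\sum_(1 <= n < Z.+1) L N * (if ~~ coprime n N then Lambda n else 0))).
  apply: ler_sum_nat => n /andP[n0 nZ]; have hn := @vonMangoldt_ge0 R n.
  rewrite /v /Lambda' /coprime_mangoldt; case: ifP => _; last first.
    by rewrite normr0 mulr_ge0 //; case: ifP.
  case: ifP => cn; first by rewrite subrr !mul0r normr0 mulr_ge0.
  rewrite subr0 !normrM (ger0_norm hn) (ger0_norm (f0 n nZ)) /= mulrC.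
  apply: ler_pM => //; [exact: f0|by rewrite mulr_ge0|exact: fL|by rewrite ler_piMr // normr_moebius_le1].
rewrite -mulr_sumr (_ : 2 * L N ^+ 3 = L N * (2 * L N ^+ 2)); last by ring.
rewrite ler_wpM2l // -big_mkcond; apply: le_trans (sum_noncoprime_mangoldt (leq_ltn_trans (leq0n _) ZN)).
rewrite [leRHS](big_cat_nat (n := Z.+1)) //=; last exact: leqW.
rewrite lerDl; apply: sumr_ge0 => n _; exact: vonMangoldt_ge0.
Qed.

Lemma large_part_approx N D (Delta : nat -> R) : (0 < N)%N ->
  (forall q, 0 <= Delta q) ->
  (forall q y, (0 < q)%N -> (0 < y < N)%N -> coprime q N ->
     `|\sum_(1 <= n < y.+1 | n == N %[mod q]) Lambda n * mu (N - n)
     - (totient q)%:R^-1 * \sum_(1 <= n < y.+1) Lambda n * mu (N - n)| <= Delta q) ->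
  `|large_part N D - large_main N D| <=
   L N * (\sum_(1 <= q < (N %/ D.+1).+1) Delta q) + (N %/ D.+1)%:R * (2 * L N ^+ 3).
Proof.
move=> N0 D0 HD.
have l0 := @slog_ge0 R N.
pose F n e : R := if (e %| N - n)%N then
   mu e * (Lambda' N n * mu (N - n) * ln ((N - n)%:R / e%:R)) else 0.
have -> : large_part N D = \sum_(1 <= e < (N %/ D.+1).+1) mu e *
   \sum_(1 <= n < (N - e * D.+1).+1 | (e %| N - n)%N)
     Lambda' N n * mu (N - n) * ln ((N - n)%:R / e%:R).
  transitivity (\sum_(1 <= n < N) \sum_(1 <= e < ((N - n) %/ D.+1).+1) F n e).
    apply: eq_bigr => n _; rewrite big_mkcond mulr_sumr mulr_sumr; apply: eq_bigr => e _.
    by rewrite /F; case: ifP => _; rewrite ?mulr0 //; ring.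
  rewrite exchange_large; apply: eq_bigr => e _; rewrite /F -big_mkcond mulr_sumr.
  by [].
rewrite /large_main [X in _ - X]big_mkcond -sumrB; apply: le_trans (ler_norm_sum _ _ _) _.
apply: (@le_trans _ _ (\sum_(1 <= e < (N %/ D.+1).+1) (L N * Delta e + 2 * L N ^+ 3))); last first.
  by rewrite big_split /= -mulr_sumr sumr_const_nat subn1 /= lerD2l [leRHS]mulr_natl.
apply: ler_sum_nat => e /andP[e0 eN].
have eDN : (e * D.+1 <= N)%N by rewrite -leq_divRL.
case: ifPn => ce; last first.
  rewrite subr0 big1_seq ?mulr0 ?normr0 ?addr_ge0 ?mulr_ge0 ?exprn_ge0 // => n /andP[en].
  rewrite mem_index_iota => /andP[n0 nZ].
  have nN : (n <= N)%N by apply: leq_trans (leq_subr (e * D.+1) N).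
  rewrite /Lambda' /coprime_mangoldt ifF ?mul0r //; apply: contraNF ce.
  exact: coprime_of_dvd_sub.
rewrite -mulrA -mulrBr normrM -[leRHS]mul1r; apply: ler_pM; rewrite ?normr_moebius_le1 //.
apply: large_part_progression => //; last by move=> y yN; exact: HD.
by rewrite -[leqRHS](subnK eDN) leq_add2l leq_pmulr.
Qed.

(** Exchanging the sums back puts [e] innermost; splitting [ln ((N - n) / e)] leaves the two totient
    sums of length [(N - n) %/ D.+1]. *)
Lemma large_mainE N D : large_main N D = \sum_(1 <= n < N) Lambda n * mu (N - n) *
  (ln (N - n)%:R * totient_sum N ((N - n) %/ D.+1) - totient_log_sum N ((N - n) %/ D.+1)).
Proof.
pose F n e : R := if coprime e N then mu e / (totient e)%:R *
   (Lambda n * mu (N - n) * ln ((N - n)%:R / e%:R)) else 0.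
transitivity (\sum_(1 <= e < (N %/ D.+1).+1) \sum_(1 <= n < (N - e * D.+1).+1) F n e).
  rewrite /large_main big_mkcond; apply: eq_bigr => e _; rewrite /F.
  by case: ifP => _; rewrite ?mulr_sumr // big1.
rewrite -exchange_large; apply: eq_big_nat => n /andP[n0 nN].
rewrite /totient_sum /totient_log_sum !mulr_sumr -sumrB mulr_sumr [RHS]big_mkcond.
apply: eq_big_nat => e /andP[e0 _]; rewrite /F; case: ifP => // _.
by rewrite ln_div ?posrE ?ltr0n ?subn_gt0 //; ring.
Qed.

Lemma totient_sum_le M x : `|totient_sum M x| <= x%:R :> R.
Proof.
apply: le_trans (ler_norm_sum _ _ _) _.
apply: (@le_trans _ _ (\sum_(1 <= n < x.+1) 1)); last by rewrite sumr_const_nat subn1.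
rewrite big_mkcond; apply: ler_sum_nat => n /andP[n0 _]; case: ifP => // _.
rewrite normrM normfV normr_nat -[leRHS]mul1r; apply: ler_pM; rewrite ?normr_moebius_le1 ?invr_ge0 //.
by rewrite invf_le1 ?ltr0n ?ler1n ?totient_gt0.
Qed.

Lemma totient_log_sum_le M x : `|totient_log_sum M x| <= x%:R * L x :> R.
Proof.
apply: le_trans (ler_norm_sum _ _ _) _.
apply: (@le_trans _ _ (\sum_(1 <= n < x.+1) L x)); last by rewrite sumr_const_nat subn1 mulr_natl.
rewrite big_mkcond; apply: ler_sum_nat => n /andP[n0 nx]; case: ifP => _; last exact: slog_ge0.
rewrite normrM normrM normfV normr_nat -[leRHS]mul1r; apply: ler_pM; rewrite ?mulr_ge0 ?invr_ge0 //.
  rewrite -[leRHS]mul1r; apply: ler_pM; rewrite ?normr_moebius_le1 ?invr_ge0 //.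
  by rewrite invf_le1 ?ltr0n ?ler1n ?totient_gt0.
rewrite ger0_norm ?ln_nat_ge0 //; apply: le_trans (ln_le_slog _) _; exact: le_slog.
Qed.

(** Where [(N - n) %/ D.+1 >= X] the totient sums are close to 0 and to [- singular_constant N]. The
    other [n] lie within [X * D.+1] of [N], and there the totient sums are bounded trivially by
    about [X], whence [X ^ 2 * D]. *)
Lemma large_main_asymp : PNT R -> forall j B, exists2 C : R, 0 <= C &
  forall N D X, (0 < N)%N -> (15 < X <= N)%N -> (N <= X ^ j)%N ->
  `|large_main N D - singular_constant N * mangoldt_moebius N| <=
  C * (N%:R * L N ^+ 2 / L X ^+ B + X%:R ^+ 2 * D.+1%:R * L N ^+ 2).
Proof.
move=> pnt j B.
have [C1 C10 H1] := totient_sum_small pnt j B.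
have [C2 C20 H2] := totient_log_sum_small pnt j B.
have [Cs Cs0 Hs] := @singular_constant_le R.
exists (C1 + C2 + 2 + Cs) => [|N D X N0 /andP[X16 XN] NX]; first by rewrite !addr_ge0.
have l1 := @slog_ge1 R N; have l0 : 0 <= L N by lra.
pose v := L X ^- B; have v0 : 0 <= v by rewrite invr_ge0 exprn_ge0 // slog_ge0.
have X1 : 1 <= X%:R :> R by rewrite ler1n; exact: leq_trans X16.
pose S := singular_constant N : R.
pose t n : R := ln (N - n)%:R * totient_sum N ((N - n) %/ D.+1)
   - (totient_log_sum N ((N - n) %/ D.+1) + S).
have -> : large_main N D - singular_constant N * mangoldt_moebius N =
   \sum_(1 <= n < N) Lambda n * mu (N - n) * t n.
  rewrite large_mainE /mangoldt_moebius mulr_sumr -sumrB; apply: eq_bigr => n _.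
  by rewrite /t -/S; ring.
apply: le_trans (ler_norm_sum _ _ _) _.
pose g n : R := if (N - n < X * D.+1)%N then (2 + Cs) * X%:R * L N ^+ 2 else 0.
have Cs2 : 0 <= 2 + Cs by rewrite addr_ge0.
have c0 : 0 <= (2 + Cs) * X%:R * L N ^+ 2 := mulr_ge0 (mulr_ge0 Cs2 (ler0n _ _)) (sqr_ge0 _).
have w0 : 0 <= (C1 + C2) * L N ^+ 2 * v := mulr_ge0 (mulr_ge0 (addr_ge0 C10 C20) (sqr_ge0 _)) v0.
have g0 n : 0 <= g n by rewrite /g; case: ifP.
have tb n : (0 < n < N)%N -> `|Lambda n * mu (N - n) * t n| <= (C1 + C2) * L N ^+ 2 * v + g n.
  move=> /andP[n0 nN].
  have hL : `|Lambda n * mu (N - n)| <= L N.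
    rewrite normrM -[leRHS]mulr1; apply: ler_pM; rewrite ?normr_moebius_le1 //.
    by rewrite ger0_norm ?vonMangoldt_ge0 // vonMangoldt_le_slog // ltnW.
  have lm : ln (N - n)%:R <= L N :> R.
    by apply: le_trans (ln_le_slog _) _; apply: le_slog; exact: leq_subr.
  have good : (X <= (N - n) %/ D.+1)%N -> `|t n| <= (C1 + C2) * L N * v.
    move=> Xx; have x16 := leq_trans X16 Xx.
    have Nx : (N <= ((N - n) %/ D.+1) ^ j)%N.
      by apply: (leq_trans NX); case: (j) => // i; rewrite leq_exp2r.
    have vx : L ((N - n) %/ D.+1) ^- B <= v by apply: ler_inv_exp; [exact: slog_gt0|exact: le_slog].
    have h1 := le_trans (H1 _ _ x16 N0 Nx) (ler_wpM2l C10 vx).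
    have h2 := le_trans (H2 _ _ x16 N0 Nx) (ler_wpM2l C20 vx).
    rewrite /t; apply: le_trans (ler_normB _ _) _; rewrite normrM ger0_norm ?ln_nat_ge0 //.
    apply: le_trans (lerD (ler_pM (ln_nat_ge0 _) (normr_ge0 _) lm h1) h2) _.
    have := ler_wpM2l (mulr_ge0 C20 v0) l1; lra.
  have bad : ((N - n) %/ D.+1 < X)%N -> `|t n| <= (2 + Cs) * X%:R * L N.
    move=> xX; set x := ((N - n) %/ D.+1)%N in xX *.
    have xX' : x%:R <= X%:R :> R by rewrite ler_nat ltnW.
    have h1 := le_trans (totient_sum_le N x) xX'.
    have h2 : `|totient_log_sum N x| <= X%:R * L N.
      apply: le_trans (totient_log_sum_le N x) _; apply: ler_pM; rewrite ?slog_ge0 //.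
      by apply: le_slog; exact: leq_trans (ltnW xX) XN.
    have h3 : `|S| <= Cs * X%:R * L N.
      apply: le_trans (Hs N N0) _; rewrite ler_wpM2r // ler_peMr //.
    rewrite /t -/x; apply: le_trans (ler_normB _ _) _; rewrite normrM ger0_norm ?ln_nat_ge0 //.
    apply: le_trans (lerD (ler_pM (ln_nat_ge0 _) (normr_ge0 _) lm h1) (ler_normD _ _)) _.
    by lra.
  rewrite normrM /g; case: ltnP => h.
    apply: le_trans (_ : L N * ((2 + Cs) * X%:R * L N) <= _).
      by apply: ler_pM => //; apply: bad; rewrite ltn_divLR.
    have := w0.
    by rewrite [_ ^+ 2]expr2; lra.
  apply: le_trans (_ : L N * ((C1 + C2) * L N * v) <= _).
    by apply: ler_pM => //; apply: good; rewrite leq_divRL.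
  by rewrite addr0 le_eqVlt; apply/orP; left; apply/eqP; ring.
apply: (@le_trans _ _ (\sum_(1 <= n < N) ((C1 + C2) * L N ^+ 2 * v + g n))).
  exact: ler_sum_nat.
have gsum : \sum_(1 <= n < N) g n <= (X * D.+1)%:R * ((2 + Cs) * X%:R * L N ^+ 2).
  set c := (2 + Cs) * X%:R * L N ^+ 2 in g g0 c0 tb *.
  rewrite big_nat_rev /=.
  apply: (@le_trans _ _ (\sum_(1 <= i < N) if (i < X * D.+1)%N then c else 0)).
    apply: ler_sum_nat => i /andP[i0 iN]; rewrite /g -/c.
    by have -> : (N - (1 + N - i.+1) = i)%N by rewrite add1n subSS subKn // ltnW.
  rewrite -big_mkcond /=; have [h|h] := leqP N (X * D.+1)%N.
    apply: (@le_trans _ _ (\sum_(1 <= i < N) c)).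
      by rewrite big_mkcond; apply: ler_sum => i _; case: ifP.
    rewrite sumr_const_nat -[leLHS]mulr_natl ler_wpM2r // ler_nat.
    by apply: leq_trans h; exact: leq_subr.
  rewrite -(@big_nat_widen _ _ _ 1 (X * D.+1) N xpredT) ?(ltnW h) //.
  by rewrite sumr_const_nat -[leLHS]mulr_natl ler_wpM2r // ler_nat leq_subr.
rewrite big_split /= sumr_const_nat -[X in X + _]mulr_natl.
have h1 : (N - 1)%:R * ((C1 + C2) * L N ^+ 2 * v) <= N%:R * ((C1 + C2) * L N ^+ 2 * v).
  by rewrite ler_wpM2r // ler_nat leq_subr.
apply: le_trans (lerD h1 gsum) _.
have a0 : 0 <= N%:R * L N ^+ 2 * v := mulr_ge0 (mulr_ge0 (ler0n _ _) (sqr_ge0 _)) v0.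
have b0 : 0 <= X%:R ^+ 2 * D.+1%:R * L N ^+ 2 := mulr_ge0 (mulr_ge0 (sqr_ge0 _) (ler0n _ _)) (sqr_ge0 _).
rewrite natrM.
have -> : N%:R * ((C1 + C2) * L N ^+ 2 * v) = (C1 + C2) * (N%:R * L N ^+ 2 * v) by ring.
have -> : X%:R * D.+1%:R * ((2 + Cs) * X%:R * L N ^+ 2) = (2 + Cs) * (X%:R ^+ 2 * D.+1%:R * L N ^+ 2) by ring.
rewrite -/v mulrDr; apply: lerD; apply: ler_wpM2r => //; lra.
Qed.

End LargePart.

(** * Asymptotics *)

Section Asymptotics.
Context {R : realType}.
Local Notation L := (@slog R).

Definition log_error (A : R) (N : nat) : R := N%:R / L N `^ A.

Lemma log_error_ge0 A N : 0 <= log_error A N.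
Proof. by rewrite divr_ge0 // powR_ge0. Qed.

(* A one-sided bound: [f] is applied to absolute values. *)
Definition log_bounded (A : R) (f : nat -> R) :=
  exists2 C : R, 0 <= C & \forall N \near \oo, f N <= C * log_error A N.

Lemma log_boundedD A f g : log_bounded A f -> log_bounded A g ->
  log_bounded A (fun N => f N + g N).
Proof.
move=> [C C0 HC] [D D0 HD]; exists (C + D); first exact: addr_ge0.
by near=> N; rewrite mulrDl; apply: lerD; near: N.
Unshelve. all: by end_near. Qed.

Lemma log_bounded_le A f g (c : R) : 0 <= c -> log_bounded A g ->
  (\forall N \near \oo, f N <= c * g N) -> log_bounded A f.
Proof.
move=> c0 [C C0 HC] Hfg; exists (c * C); first exact: mulr_ge0.
near=> N; rewrite -mulrA; apply: (@le_trans _ _ (c * g N)); first by near: N.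
by rewrite ler_wpM2l //; near: N.
Unshelve. all: by end_near. Qed.

Lemma log_boundedZ A c f : 0 <= c -> log_bounded A f ->
  log_bounded A (fun N => c * f N).
Proof. by move=> c0 hf; apply: (log_bounded_le c0 hf); near do exact: lexx.
Unshelve. all: by end_near. Qed.

Lemma near_powR_ge (eta C : R) : 0 < eta -> \forall N \near \oo, C <= (N%:R : R) `^ eta.
Proof.
move=> eta0; pose M := (`|C| + 1) `^ eta^-1.
have M0 : 0 <= M by exact: powR_ge0.
exists (Num.truncn M).+1 => // N /= MN.
have MN' : M <= N%:R.
  by apply: le_trans (ltW (truncnS_gt M)) _; rewrite ler_nat.
have C1 : 0 <= `|C| + 1 by rewrite addr_ge0.
apply: (@le_trans _ _ (`|C| + 1)); first by have := ler_norm C; lra.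
have -> : `|C| + 1 = M `^ eta.
  by rewrite /M -powRrM mulVf ?gt_eqF // powRr1.
by apply: ge0_ler_powR; rewrite ?nnegrE // ltW.
Qed.

Lemma slog_powR_le_exp A (B : nat) N : A <= B%:R -> L N `^ A <= L N ^+ B.
Proof.
by move=> AB; rewrite -powR_mulrn ?slog_ge0 // ler_powR ?slog_ge1.
Qed.

Lemma log_bounded_log A (c B : nat) : A + c%:R <= B%:R ->
  log_bounded A (fun N => N%:R * (L N ^+ c / L N ^+ B)).
Proof.
move=> AB; exists 1 => //; near=> N; rewrite mul1r /log_error ler_wpM2l //.
have l0 := @slog_gt0 R N.
rewrite ler_pdivrMr ?exprn_gt0 // mulrC ler_pdivlMr ?powR_gt0 //.
rewrite -!powR_mulrn ?(ltW l0) // -powRD; last by apply/implyP => _; rewrite gt_eqF.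
by rewrite ler_powR ?slog_ge1 // addrC.
Unshelve. all: by end_near. Qed.

Lemma log_bounded_pow A (c : nat) (eta : R) : 0 < eta ->
  log_bounded A (fun N => N%:R `^ (1 - eta) * L N ^+ c).
Proof.
move=> eta0; pose B := (Num.truncn (`|A| + c%:R)).+1.
have AB : A + c%:R <= B%:R.
  by apply: le_trans (ltW (truncnS_gt _)); rewrite lerD2r ler_norm.
have [C C0 HC] := @slog_le_powR R B eta eta0.
apply: (@log_bounded_le _ _ _ C (ltW C0) (log_bounded_log AB)).
near=> N.
have N0 : (0 < N)%N by near: N; exists 1%N.
have N0' : 0 < N%:R :> R by rewrite ltr0n.
have l0 := @slog_gt0 R N.
have h : 1 <= C * N%:R `^ eta / L N ^+ B.
  by rewrite ler_pdivlMr ?exprn_gt0 // mul1r HC.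
have -> : C * (N%:R * (L N ^+ c / L N ^+ B)) =
   (N%:R `^ (1 - eta) * L N ^+ c) * (C * N%:R `^ eta / L N ^+ B).
  have e : N%:R `^ (1 - eta) * N%:R `^ eta = N%:R :> R.
    by rewrite -powRD ?subrK ?powRr1 ?(ltW N0') //; apply/implyP => _; rewrite gt_eqF.
  by rewrite -{1}e; ring.
by rewrite ler_peMr // mulr_ge0 ?powR_ge0 // exprn_ge0 // ltW.
Unshelve. all: by end_near. Qed.

Definition powfloor (eta : R) (N : nat) : nat := Num.truncn ((N%:R : R) `^ eta).

Lemma powfloor_le eta N : (powfloor eta N)%:R <= (N%:R : R) `^ eta.
Proof. by rewrite truncn_le powR_ge0. Qed.

Lemma powfloor_gt eta N : (N%:R : R) `^ eta < (powfloor eta N).+1%:R.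
Proof. exact: truncnS_gt. Qed.

Lemma near_powfloor_ge (eta : R) (m : nat) : 0 < eta ->
  \forall N \near \oo, (m <= powfloor eta N)%N.
Proof.
move=> eta0; near=> N; rewrite truncn_ge_nat ?powR_ge0 //.
by near: N; exact: near_powR_ge.
Unshelve. all: by end_near. Qed.

(** Supplies the [j] for which moduli up to [N] are polynomially bounded in terms of the cutoff, the
    form in which uniformity is stated. The factor 2 compensates for rounding: [w ^ 2 >= N ^ eta]
    once [w >= 2]. *)
Lemma near_powfloor_exp (eta : R) : 0 < eta ->
  exists j, \forall N \near \oo, (N <= powfloor eta N ^ j)%N.
Proof.
move=> eta0; exists (2 * (Num.truncn eta^-1).+1)%N.
near=> N; rewrite -(ler_nat R) natrX.
have w2 : (2 <= powfloor eta N)%N by near: N; exact: near_powfloor_ge.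
set w := powfloor eta N in w2 *.
have N0 : (0 < N)%N by near: N; exists 1%N.
have N1 : 1 <= N%:R :> R by rewrite ler1n.
have h : N%:R `^ eta <= w%:R ^+ 2.
  apply: le_trans (ltW (powfloor_gt eta N)) _; rewrite -natrX ler_nat -mulnn.
  by apply: (@leq_trans (2 * w)); [rewrite mul2n -addnn -addn1 leq_add2l ltnW|rewrite leq_mul2r w2 orbT].
rewrite exprM.
apply: (@le_trans _ _ ((N%:R `^ eta) ^+ (Num.truncn eta^-1).+1)); last first.
  by rewrite lerXn2r ?nnegrE ?powR_ge0 ?exprn_ge0.
rewrite -powR_mulrn ?powR_ge0 // -powRrM -[leLHS]powRr1 // ler_powR //.
rewrite -ler_pdivrMl // mulr1; exact: ltW (truncnS_gt _).
Unshelve. all: by end_near. Qed.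

End Asymptotics.

(** * Cutoffs, and the hypotheses as log savings *)

Section MainTerms.
Context {R : realType}.
Local Notation L := (@slog R).

Lemma near_slog_le_powR (c : nat) (eta : R) : 0 < eta ->
  \forall N \near \oo, L N ^+ c <= N%:R `^ eta.
Proof.
move=> eta0; have eta2 : 0 < eta / 2 by rewrite divr_gt0.
have [C C0 HC] := @slog_le_powR R c (eta / 2) eta2.
near=> N; have N0 : (0 < N)%N by near: N; exists 1%N.
apply: le_trans (HC _ N0) _.
have -> : N%:R `^ eta = N%:R `^ (eta / 2) * N%:R `^ (eta / 2) :> R.
  by rewrite -powRD -?splitr //; apply/implyP => _; rewrite pnatr_eq0 -lt0n.
by rewrite ler_wpM2r ?powR_ge0 //; near: N; exact: near_powR_ge.
Unshelve. all: by end_near. Qed.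

Lemma sum_le_sum_upto (Delta : nat -> R) (Q : nat) (y : R) :
  (forall q, 0 <= Delta q) -> Q%:R <= y ->
  \sum_(1 <= q < Q.+1) Delta q <= sum_upto y Delta.
Proof.
move=> D0 Qy; rewrite /sum_upto.
have h : (Q <= Num.truncn y)%N.
  by rewrite truncn_ge_nat // (le_trans _ Qy).
by rewrite [leRHS](@big_cat_nat _ _ _ Q.+1) //= lerDl sumr_ge0.
Qed.

Lemma EH_log_saving (theta C : R) (B : nat) : EH theta C ->
  exists2 M : R, 0 <= M & forall N, (1 < N)%N -> exists Delta : nat -> R,
  [/\ forall q, 0 <= Delta q,
      forall q y a, (0 < y <= N)%N -> coprime a q ->
        `|\sum_(1 <= n < y.+1 | n == a %[mod q]) vonMangoldt n -
          y%:R / (totient q)%:R| <= Delta q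
    & forall Q : nat, Q%:R <= N%:R `^ theta * ln N%:R `^ C ->
        \sum_(1 <= q < Q.+1) Delta q <= M * (N%:R / L N ^+ B)].
Proof.
move=> H; have B0 : 0 < B.+1%:R :> R by rewrite ltr0n.
have [M HM] := EH_discrepancy B0 H.
exists (`|M| * 3 ^+ B.+1); first by rewrite mulr_ge0 // exprn_ge0.
move=> N N1; have [Delta [D0 D1 D2]] := HM N N1; exists Delta; split => // Q HQ.
apply: le_trans (sum_le_sum_upto D0 HQ) (le_trans D2 _).
exact: ln_saving.
Qed.

Lemma EHmu_log_saving (theta : R) (B : nat) : EHmu theta ->
  exists2 M : R, 0 <= M & forall N, (1 < N)%N -> exists Delta : nat -> R,
  [/\ forall q, 0 <= Delta q,
      forall q y, (0 < q)%N -> (0 < y < N)%N -> coprime q N ->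
        `|\sum_(1 <= n < y.+1 | n == N %[mod q]) vonMangoldt n * moebius (N - n)%N -
          (totient q)%:R^-1 * \sum_(1 <= n < y.+1) vonMangoldt n * moebius (N - n)%N| <= Delta q
    & forall Q : nat, Q%:R <= (N%:R : R) `^ theta ->
        \sum_(1 <= q < Q.+1) Delta q <= M * (N%:R / L N ^+ B)].
Proof.
move=> H; have B0 : 0 < B.+1%:R :> R by rewrite ltr0n.
have [M HM] := EHmu_discrepancy B0 H.
exists (`|M| * 3 ^+ B.+1); first by rewrite mulr_ge0 // exprn_ge0.
move=> N N1; have [Delta [D0 D1 D2]] := HM N N1; exists Delta; split => //.
  by move=> q y q0 y0 cqN; apply: D1 => //; rewrite coprime_sym.
move=> Q HQ; apply: le_trans (sum_le_sum_upto D0 HQ) (le_trans D2 _).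
exact: ln_saving.
Qed.

(* The exponent is half of the [2 * A + 8] in the level of EH, which has to accommodate
   moduli up to [N `^ theta * logcut A N ^ 2]. *)
Definition logcut (A : R) (N : nat) : nat := Num.truncn ((ln N%:R : R) `^ (A + 4)).

Lemma logcut_le_pow A (k : nat) N : 0 < A -> A + 4 <= k%:R -> (0 < N)%N ->
  (logcut A N)%:R <= L N ^+ k.
Proof.
move=> A0 Ak N0; apply: (@le_trans _ _ ((ln N%:R : R) `^ (A + 4))).
  by rewrite truncn_le powR_ge0.
apply: (@le_trans _ _ (L N `^ (A + 4))); last exact: slog_powR_le_exp.
by apply: ge0_ler_powR; rewrite ?nnegrE ?ln_nat_ge0 ?slog_ge0 ?ln_le_slog // addr_ge0 // ltW.
Qed.

Lemma near_logcut_gt0 A : 0 < A -> \forall N \near \oo, (0 < logcut A N)%N.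
Proof.
move=> A0; near=> N; have N4 : (4 <= N)%N by near: N; exists 4%N.
rewrite /logcut truncn_ge_nat ?powR_ge0 //.
have h := @ln_ge1 R N N4.
by rewrite -[leLHS](powRr0 (ln N%:R)) ler_powR // addr_ge0 // ltW.
Unshelve. all: by end_near. Qed.

Lemma log_bounded_sqf A : log_bounded A
  (fun N => `|goldbach_r N - goldbach_sqf N| : R).
Proof.
have h2 : 0 < 1 / 2 :> R by lra.
apply: (@log_bounded_le _ _ _ _ 4 _ (@log_bounded_pow R A 3 _ h2)) => //.
near=> N; have [s /andP[hs hs']] := nat_sqrt_exists N.
have N0 : (0 < N)%N by near: N; exists 1%N.
have s0 : (0 < s)%N by case: s hs hs' => // _; rewrite mul1n ltnS leqNgt N0.
have hss : (s * s <= N < s.+1 * s.+1)%N by rewrite hs.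
apply: le_trans (goldbach_sqf_approx s0 hss) _.
rewrite mulrA ler_wpM2r ?exprn_ge0 ?slog_ge0 // ler_wpM2l //.
have -> : s%:R = (s%:R ^+ 2) `^ (1 - 1 / 2) :> R.
  rewrite -powR_mulrn // -powRrM; have -> : 2%:R * (1 - 1 / 2) = 1 :> R by lra.
  by rewrite powRr1.
apply: ge0_ler_powR; rewrite ?nnegrE ?exprn_ge0 //; first lra.
by rewrite -natrX ler_nat -mulnn.
Unshelve. all: by end_near. Qed.

End MainTerms.

(** * Contribution of the divisors up to [N ^ theta] *)

Section SmallPartAsymptotics.
Context {R : realType}.
Local Notation L := (@slog R).
Variables (A theta : R).
Hypotheses (A_gt0 : 0 < A) (theta_gt0 : 0 < theta) (theta_lt1 : theta < 1).
Local Notation D := (powfloor theta).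
Local Notation K := (logcut A).
Local Notation S := (@singular_constant R).

Lemma exponent_exists (x : R) : exists B : nat, x <= B%:R.
Proof. by exists (Num.truncn x).+1; exact: ltW (truncnS_gt _). Qed.

Lemma near_logcut_le_powR (eta : R) : 0 < eta ->
  \forall N \near \oo, ((K N)%:R : R) <= N%:R `^ eta.
Proof.
move=> eta0; have [k Ak] := exponent_exists (A + 4).
near=> N; have N0 : (0 < N)%N by near: N; exists 1%N.
apply: le_trans (logcut_le_pow A_gt0 Ak N0) _.
by near: N; exact: near_slog_le_powR.
Unshelve. all: by end_near. Qed.

Lemma near_powfloor_le (eta : R) : eta < 1 ->
  \forall N \near \oo, (powfloor eta N <= N)%N.
Proof.
move=> eta1; near=> N; rewrite -(ler_nat R); apply: le_trans (powfloor_le _ _) _.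
have N1 : 1 <= N%:R :> R by rewrite ler1n; near: N; exists 1%N.
by rewrite -[leRHS]powRr1 // ler_powR // ltW.
Unshelve. all: by end_near. Qed.

Lemma near_logcut_le : \forall N \near \oo, (K N <= N)%N.
Proof.
near=> N; rewrite -(ler_nat R) -[leRHS]powRr1 //.
by near: N; exact: near_logcut_le_powR.
Unshelve. all: by end_near. Qed.

Lemma log_bounded_small_trunc D' : log_bounded A
  (fun N => `|small_part N (D' N) - small_part_trunc N (D' N) (K N)| : R).
Proof.
exists (2 * 3 `^ (A + 4)); first by rewrite mulr_ge0 ?powR_ge0.
near=> N; have N1 : (1 < N)%N by near: N; exists 2%N.
have KN : (K N <= N)%N by near: N; exact: near_logcut_le.
apply: le_trans (small_part_trunc_approx _ (ltnW N1) KN) _.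
have l0 := @slog_gt0 R N.
have ln0 : 0 < (ln N%:R : R) by rewrite ln_gt0 // ltr1n.
have h1 : L N `^ (A + 4) <= 3 `^ (A + 4) * ln N%:R `^ (A + 4).
  rewrite -powRM ?(ltW ln0) //.
  apply: ge0_ler_powR; rewrite ?nnegrE ?slog_le_3ln ?(ltW l0) //.
    by rewrite addr_ge0 // ltW.
  by rewrite mulr_ge0 // ltW.
have h2 : ln N%:R `^ (A + 4) < (K N).+1%:R :> R by exact: truncnS_gt.
have e : L N `^ (A + 4) = L N `^ A * L N ^+ 4.
  rewrite -powR_mulrn ?(ltW l0) // -powRD //.
  by apply/implyP => _; rewrite gt_eqF.
rewrite /log_error ler_pdivrMr ?ltr0Sn //.
have lA := powR_gt0 A l0.
have -> : 2 * N%:R * L N ^+ 4 = 2 * N%:R / L N `^ A * (L N `^ A * L N ^+ 4).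
  by rewrite [RHS]mulrA divfK ?gt_eqF.
have -> : 2 * 3 `^ (A + 4) * (N%:R / L N `^ A) * (K N).+1%:R =
  2 * N%:R / L N `^ A * (3 `^ (A + 4) * (K N).+1%:R).
  by move: (_.+1%:R) => z; ring.
rewrite ler_wpM2l ?mulr_ge0 ?invr_ge0 ?(ltW lA) // -e.
apply: le_trans h1 _; rewrite ler_wpM2l ?powR_ge0 //; exact: ltW.
Unshelve. all: by end_near. Qed.

Lemma log_bounded_small_main : EH theta (2 * A + 8) -> log_bounded A
  (fun N => `|small_part_trunc N (D N) (K N) - N.-1%:R * small_main N (D N) (K N)| : R).
Proof.
move=> hEH; have [k Ak] := exponent_exists (A + 4).
have [b Ab] := exponent_exists A.
(* The exponent pays for the factor [L N] and for [K ^ 3 <= L N ^+ (3 * k)], and leaves the saving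
   [b >= A]. *)
have [M M0 HM] := EH_log_saving (1 + 3 * k + b) hEH.
have t1 : 0 < 1 - theta by rewrite subr_gt0.
have hb : A + 0%:R <= b%:R by rewrite addr0.
have B1 := log_bounded_log hb.
have B2 := @log_bounded_pow R A (k + 3) _ t1.
apply: (@log_bounded_le _ _ _ _ 1 _
  (log_boundedD (log_boundedZ M0 B1) (log_boundedZ (ler0n R 2) B2))) => //.
near=> N; rewrite mul1r.
have N1 : (1 < N)%N by near: N; exists 2%N.
have DN : (D N <= N)%N by near: N; exact: near_powfloor_le.
have [Delta [D0 D1 D2]] := HM N N1.
have D1' q : coprime q N ->
  `|\sum_(1 <= n < N.-1.+1 | n == N %[mod q]) vonMangoldt n -
    N.-1%:R / (totient q)%:R| <= Delta q.
  move=> cqN; apply: D1; last by rewrite coprime_sym.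
  by rewrite -subn1 subn_gt0 N1 leq_subr.
apply: le_trans (small_part_main _ N1 DN D0 D1') _.
have l0 := @slog_gt0 R N; have l0' := ltW l0.
have KL : (K N)%:R <= L N ^+ k by exact: logcut_le_pow (ltnW N1).
apply: lerD.
  have lev : (D N * K N ^ 2)%N%:R <= (N%:R : R) `^ theta * ln N%:R `^ (2 * A + 8).
    rewrite natrM; apply: ler_pM => //; first exact: powfloor_le.
    have -> : 2 * A + 8 = (A + 4) * 2%:R :> R by ring.
    rewrite powRrM powR_mulrn ?powR_ge0 // natrX.
    by rewrite lerXn2r ?nnegrE ?powR_ge0 // truncn_le powR_ge0.
  apply: (@le_trans _ _ (L N * ((L N ^+ k) ^+ 3 * (M * (N%:R / L N ^+ (1 + 3 * k + b)))))).
    rewrite ler_wpM2l //; apply: ler_pM; rewrite ?exprn_ge0 ?sumr_ge0 //.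
      by rewrite lerXn2r ?nnegrE ?exprn_ge0.
    exact: D2.
  rewrite -addnA expr0 exprD exprD expr1 mulnC exprM le_eqVlt; apply/orP; left; apply/eqP.
  have := expf_neq0 k (lt0r_neq0 l0); have := expf_neq0 b (lt0r_neq0 l0).
  by have := lt0r_neq0 l0; move: (L N ^+ k) (L N ^+ b) => u v *; field; apply/and3P.
have -> : 1 - (1 - theta) = theta by ring.
rewrite exprD.
have -> : (K N)%:R * (D N)%:R * (2 * L N ^+ 3) = 2 * ((D N)%:R * ((K N)%:R * L N ^+ 3)) :> R.
  by ring.
rewrite ler_wpM2l //; apply: ler_pM; rewrite ?mulr_ge0 ?exprn_ge0 //.
  exact: powfloor_le.
by rewrite ler_wpM2r ?exprn_ge0.
Unshelve. all: by end_near. Qed.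

Lemma log_bounded_small_asymp : PNT R -> log_bounded A
  (fun N => N.-1%:R * `|small_main N (D N) (K N) + S N| : R).
Proof.
move=> pnt; have [k Ak] := exponent_exists (A + 4).
have [b Ab] := exponent_exists A.
have t2 : 0 < theta / 2 by rewrite divr_gt0.
have t4 : 0 < theta / 4 by rewrite divr_gt0.
have [j Hj] := near_powfloor_exp t2.
have [C C0 HC] := small_main_asymp pnt (j + j) (3 * k + b).
have hb : A + (3 * k)%:R <= (3 * k + b)%:R by rewrite natrD addrC lerD2l.
have c0 : 0 <= C * j.+1%:R ^+ (3 * k + b) by rewrite mulr_ge0 // exprn_ge0.
apply: (log_bounded_le c0 (log_bounded_log hb)).
near=> N.
have N1 : (1 < N)%N by near: N; exists 2%N.
have N1' : 1 <= N%:R :> R by rewrite ler1n ltnW.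
have w15 : (15 < powfloor (theta / 2) N)%N by near: N; exact: near_powfloor_ge.
have Nw : (N <= powfloor (theta / 2) N ^ j)%N by near: N.
have K0 : (0 < K N)%N by near: N; exact: near_logcut_gt0.
have KN : (K N <= N)%N by near: N; exact: near_logcut_le.
have K4 : ((K N)%:R : R) <= N%:R `^ (theta / 4).
  by near: N; exact: near_logcut_le_powR.
have K2 : ((K N)%:R : R) <= N%:R `^ (theta / 2).
  by apply: le_trans K4 _; rewrite ler_powR //; lra.
(* So [D / K] is at least a fixed power of [N]: its logarithm is comparable with that of [N], and
   [K * N] is at most a power of it, as [small_main_asymp] asks. *)
have wD : (powfloor (theta / 2) N * K N <= D N)%N.
  rewrite truncn_ge_nat ?powR_ge0 // natrM.
  have -> : N%:R `^ theta = N%:R `^ (theta / 2) * N%:R `^ (theta / 2) :> R.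
    rewrite -powRD -?splitr //; apply/implyP => _; rewrite gt_eqF //; lra.
  by apply: ler_pM => //; exact: powfloor_le.
have wy : (powfloor (theta / 2) N <= D N %/ K N)%N by rewrite leq_divRL.
have Ny : (N <= (D N %/ K N) ^ j)%N.
  by apply: leq_trans Nw _; case: (j) => // i; rewrite leq_exp2r.
have KD : (0 < K N <= D N)%N.
  rewrite K0 (leq_trans _ wD) // leq_pmull //; exact: leq_ltn_trans w15.
have y15 : (15 < D N %/ K N)%N by exact: leq_trans w15 wy.
have KNy : (K N * N <= (D N %/ K N) ^ (j + j))%N.
  by rewrite expnD leq_mul // (leq_trans KN).
have := HC N _ _ (ltnW N1) KD y15 KNy.
set Y := (D N %/ K N)%N; set T := `| _ |; move=> HT.
have l0 := @slog_gt0 R N; have ly := @slog_gt0 R Y.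
have KL : (K N)%:R <= L N ^+ k by exact: logcut_le_pow (ltnW N1).
have hl : (L Y ^+ (3 * k + b))^-1 <= j.+1%:R ^+ (3 * k + b) / L N ^+ (3 * k + b).
  rewrite ler_pdivlMr ?exprn_gt0 // mulrC ler_pdivrMr ?exprn_gt0 // -exprMn.
  by rewrite lerXn2r ?nnegrE ?mulr_ge0 ?(ltW l0) ?(ltW ly) // slog_le_exp.
apply: (@le_trans _ _ (N%:R * (C * (L N ^+ (3 * k) *
  (j.+1%:R ^+ (3 * k + b) / L N ^+ (3 * k + b)))))).
  apply: ler_pM; rewrite ?ler_nat ?leq_pred ?normr_ge0 //.
  apply: le_trans HT _; rewrite ler_wpM2l //; apply: ler_pM => //.
  - by rewrite invr_ge0 exprn_ge0 // ltW.
  - by rewrite mulnC exprM lerXn2r ?nnegrE ?exprn_ge0 // ltW.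
rewrite le_eqVlt; apply/orP; left; apply/eqP.
by move: (L N ^+ _) (L N ^+ _) (j.+1%:R ^+ _) => u v z; ring.
Unshelve. all: by end_near. Qed.

(** Pays for replacing [N.-1], where the progression sums end, by [N] in the main term. *)
Lemma log_bounded_singular : log_bounded A (fun N => `|S N|).
Proof.
have [C C0 HC] := @singular_constant_le R.
apply: (log_bounded_le C0 (@log_bounded_pow R A 1 1 ltr01)).
near=> N; rewrite subrr powRr0 mul1r expr1; apply: HC.
by near: N; exists 1%N.
Unshelve. all: by end_near. Qed.

Lemma log_bounded_small : PNT R -> EH theta (2 * A + 8) -> log_bounded A
  (fun N => `|small_part N (D N) + N%:R * S N|).
Proof.
move=> pnt hEH.
apply: (log_bounded_le ler01 (log_boundedD (log_boundedD (log_boundedD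
  (log_bounded_small_trunc D) (log_bounded_small_main hEH))
  (log_bounded_small_asymp pnt)) log_bounded_singular)).
near=> N; rewrite mul1r.
have -> : N%:R = N.-1%:R + 1 :> R.
  by rewrite natr1 prednK //; near: N; exists 1%N.
set a := small_part _ _; set t := small_part_trunc _ _ _; set m := small_main _ _ _.
have -> : a + (N.-1%:R + 1) * S N =
  (a - t) + (t - N.-1%:R * m) + N.-1%:R * (m + S N) + S N by ring.
apply: le_trans (ler_normD _ _) _; rewrite lerD2r.
apply: le_trans (ler_normD _ _) _; rewrite normrM (ger0_norm (ler0n _ _)) lerD2r.
exact: ler_normD.
Unshelve. all: by end_near. Qed.

End SmallPartAsymptotics.

(** * Contribution of the divisors beyond [N ^ theta], and the asymptotic formula *)

Section LargePartAsymptotics.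
Context {R : realType}.
Local Notation L := (@slog R).
Variables (A theta : R).
Hypotheses (A_gt0 : 0 < A) (theta_gt0 : 0 < theta) (theta_lt1 : theta < 1).
Local Notation D := (powfloor theta).
Local Notation S := (@singular_constant R).
Local Notation mm := (@mangoldt_moebius R).

Lemma log_bounded_large_main : EHmu (1 - theta) -> log_bounded A
  (fun N => `|large_part N (D N) - large_main N (D N)| : R).
Proof.
move=> hEHmu; have [b Ab] := exponent_exists A.
have [M M0 HM] := EHmu_log_saving (1 + b) hEHmu.
have hb : A + 0%:R <= b%:R by rewrite addr0.
have B1 := log_bounded_log hb.
have B2 := @log_bounded_pow R A 3 _ theta_gt0.
apply: (@log_bounded_le _ _ _ _ 1 _
  (log_boundedD (log_boundedZ M0 B1) (log_boundedZ (ler0n R 2) B2))) => //.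
near=> N; rewrite mul1r.
have N1 : (1 < N)%N by near: N; exists 2%N.
have N0 : 0 < N%:R :> R by rewrite ltr0n ltnW.
have [Delta [D0 D1 D2]] := HM N N1.
apply: le_trans (large_part_approx _ (ltnW N1) D0 D1) _.
have l0 := @slog_gt0 R N.
(* [(D N).+1] exceeds [N ^ theta] because of the rounding, so the complementary divisors stay within
   the level of EH_mu. *)
have lev : (N %/ (D N).+1)%N%:R <= (N%:R : R) `^ (1 - theta).
  have e : N%:R = N%:R `^ (1 - theta) * N%:R `^ theta :> R.
    rewrite -powRD ?subrK ?powRr1 //; apply/implyP => _; rewrite gt_eqF //.
  have h : (N %/ (D N).+1)%N%:R * (D N).+1%:R <= N%:R :> R.
    by rewrite -natrM ler_nat leq_trunc_div.
  rewrite -(ler_pM2r (powR_gt0 theta N0)) -e; apply: le_trans h.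
  by rewrite ler_wpM2l // ltW // powfloor_gt.
apply: lerD.
  apply: (@le_trans _ _ (L N * (M * (N%:R / L N ^+ (1 + b))))).
    by rewrite ler_wpM2l ?(ltW l0) //; exact: D2.
  rewrite expr0 exprD expr1 le_eqVlt; apply/orP; left; apply/eqP.
  have := expf_neq0 b (lt0r_neq0 l0).
  by have := lt0r_neq0 l0; move: (L N ^+ b) => u *; field; apply/andP.
by rewrite mulrCA ler_wpM2l // ler_wpM2r // exprn_ge0 // ltW.
Unshelve. all: by end_near. Qed.

Lemma log_bounded_large_asymp : PNT R -> log_bounded A
  (fun N => `|large_main N (D N) - S N * mm N|).
Proof.
move=> pnt; have [b Ab] := exponent_exists A.
(* With [X] near [N ^ ((1 - theta) / 4)], the trivial range costs [X ^ 2 * D], about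
   [N ^ (1 - (1 - theta) / 2)], while [ln X] stays comparable with [ln N]. *)
have t4 : 0 < (1 - theta) / 4 by rewrite divr_gt0 ?subr_gt0.
have t2 : 0 < (1 - theta) / 2 by rewrite divr_gt0 ?subr_gt0.
have t41 : (1 - theta) / 4 < 1 by rewrite ltr_pdivrMr //; move: theta_gt0; lra.
have [j Hj] := near_powfloor_exp t4.
have [C C0 HC] := large_main_asymp pnt j (2 + b).
have hb : A + 2%:R <= (2 + b)%:R by rewrite natrD addrC lerD2l.
have c0 : 0 <= j.+1%:R ^+ (2 + b) :> R by rewrite exprn_ge0.
have B1 := log_boundedZ c0 (log_bounded_log hb).
have B2 := log_boundedZ (ler0n R 2) (@log_bounded_pow R A 2 _ t2).
apply: (log_bounded_le C0 (log_boundedD B1 B2)).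
near=> N.
have N1 : (1 < N)%N by near: N; exists 2%N.
have N0 : 0 < N%:R :> R by rewrite ltr0n ltnW.
have XN : (powfloor ((1 - theta) / 4) N <= N)%N by near: N; exact: near_powfloor_le.
have X15 : (15 < powfloor ((1 - theta) / 4) N)%N by near: N; exact: near_powfloor_ge.
have NX : (N <= powfloor ((1 - theta) / 4) N ^ j)%N by near: N.
have X15N : (15 < powfloor ((1 - theta) / 4) N <= N)%N by rewrite X15.
apply: le_trans (HC _ (D N) _ (ltnW N1) X15N NX) _.
have XT := powfloor_le ((1 - theta) / 4) N.
set X := powfloor _ N in XN X15 NX X15N XT *.
have l0 := @slog_gt0 R N; have ly := @slog_gt0 R X.
have hl : (L X ^+ (2 + b))^-1 <= j.+1%:R ^+ (2 + b) / L N ^+ (2 + b).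
  rewrite ler_pdivlMr ?exprn_gt0 // mulrC ler_pdivrMr ?exprn_gt0 // -exprMn.
  by rewrite lerXn2r ?nnegrE ?mulr_ge0 ?(ltW l0) ?(ltW ly) // slog_le_exp.
rewrite ler_wpM2l //; apply: lerD.
  apply: (@le_trans _ _ (N%:R * L N ^+ 2 * (j.+1%:R ^+ (2 + b) / L N ^+ (2 + b)))).
    by rewrite ler_wpM2l // mulr_ge0 ?exprn_ge0 // ltW.
  rewrite le_eqVlt; apply/orP; left; apply/eqP.
  by move: (L N ^+ (2 + b)) (j.+1%:R ^+ _) => u z; ring.
have D2 : (D N).+1%:R <= 2 * N%:R `^ theta :> R.
  rewrite -natr1 mulr_natl mulr2n; apply: lerD; first exact: powfloor_le.
  by rewrite -[leLHS](powRr0 N%:R) ler_powR ?ler1n 1?ltnW // ltW.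
rewrite [leRHS]mulrA ler_wpM2r ?exprn_ge0 ?(ltW l0) //.
have -> : 1 - (1 - theta) / 2 = (1 - theta) / 4 * 2%:R + theta by lra.
rewrite powRD; last by apply/implyP => _; rewrite gt_eqF.
rewrite mulrCA powRrM powR_mulrn ?powR_ge0 //.
by apply: ler_pM; rewrite ?exprn_ge0 // lerXn2r ?nnegrE ?powR_ge0.
Unshelve. all: by end_near. Qed.

Lemma goldbach_asymp : PNT R -> EH theta (2 * A + 8) -> EHmu (1 - theta) ->
  log_bounded A (fun N => `|goldbach_r N - S N * (N%:R - mm N)|).
Proof.
move=> pnt hEH hEHmu.
apply: (log_bounded_le ler01 (log_boundedD (log_boundedD (log_boundedD
  (log_bounded_sqf A) (log_bounded_small A_gt0 theta_gt0 theta_lt1 pnt hEH))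
  (log_bounded_large_main hEHmu)) (log_bounded_large_asymp pnt))).
near=> N; rewrite mul1r.
have := @goldbach_sqfE R N (D N).
set r := goldbach_r N; set q := goldbach_sqf N; set a := small_part _ _.
set b := large_part _ _; set m := large_main _ _ => e.
have -> : r - S N * (N%:R - mm N) =
  (r - q) - (a + N%:R * S N) - (b - m) - (m - S N * mm N) by rewrite e; ring.
apply: le_trans (ler_normB _ _) _; rewrite lerD2r.
apply: le_trans (ler_normB _ _) _; rewrite lerD2r.
exact: ler_normB.
Unshelve. all: by end_near. Qed.

End LargePartAsymptotics.

(** * The Moebius sum and the conclusion *)

Section MangoldtMoebius.
Context {R : realType}.
Local Notation L := (@slog R).
Local Notation Lambda := (@vonMangoldt R).
Local Notation Lambda' := (@coprime_mangoldt R).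
Local Notation mu := (@moebius R).

Lemma mangoldt_moebius_le_sqr N : (0 < N)%N ->
  `|mangoldt_moebius N| <=
    \sum_(1 <= n < N) Lambda' N n * mu (N - n) ^+ 2 + 2 * L N ^+ 2.
Proof.
move=> N0; apply: le_trans (ler_norm_sum _ _ _) _.
apply: le_trans (lerD (lexx _) (sum_noncoprime_mangoldt N0)).
rewrite [X in _ <= _ + X]big_mkcond big_nat_recr //= addrA.
apply: ler_wpDr; first by case: ifP => // _; exact: vonMangoldt_ge0.
rewrite -big_split /=; apply: ler_sum => n _.
rewrite moebius_sqr normrM normr_moebius ger0_norm ?vonMangoldt_ge0 // /Lambda' /coprime_mangoldt.
case: ifP => _ /=; first by rewrite addr0.
by rewrite mul0r add0r ler_piMr ?vonMangoldt_ge0 // lern1; case: squarefree.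
Qed.

Lemma sum_squarefree_progression N K :
  \sum_(1 <= n < N) Lambda' N n * \sum_(1 <= k < K.+1 | (k ^ 2 %| N - n)%N) mu k =
  \sum_(1 <= k < K.+1 | coprime k N) mu k * coprime_progression (R := R) N (k ^ 2).
Proof.
transitivity (\sum_(1 <= k < K.+1) mu k * coprime_progression (R := R) N (k ^ 2)).
  under eq_bigr do rewrite mulr_sumr big_mkcond.
  rewrite exchange_big /=; apply: eq_bigr => k _.
  by rewrite -big_mkcond mulr_sumr; apply: eq_bigr => n _; rewrite mulrC.
rewrite [RHS]big_mkcond /=; apply: eq_bigr => k _; case: ifP => // /negbT nc.
by rewrite coprime_progression_eq0 ?mulr0 // coprime_pexpl.
Qed.

(** The squarefree indicator is expanded over square divisors as in the small part, but without [d]: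
    the moduli are just [k ^ 2], and [totient (k ^ 2) = k * totient k] produces the series of
    [calA]. *)
Lemma mangoldt_moebius_le N K (Delta : nat -> R) : (1 < N)%N -> (K <= N)%N ->
  (forall q, 0 <= Delta q) ->
  (forall q, coprime q N ->
    `|\sum_(1 <= n < N.-1.+1 | n == N %[mod q]) Lambda n -
      N.-1%:R / (totient q)%:R| <= Delta q) ->
  `|mangoldt_moebius N| <=
    N.-1%:R * \sum_(1 <= k < K.+1 | coprime k N) mu k / (k%:R * (totient k)%:R) +
    \sum_(1 <= q < (K ^ 2).+1) Delta q + K%:R * (2 * L N ^+ 2) +
    2 * N%:R * L N ^+ 3 / K.+1%:R + 2 * L N ^+ 2.
Proof.
move=> N1 KN D0 HD; have N0 := ltnW N1; have l0 := @slog_ge0 R N.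
apply: le_trans (mangoldt_moebius_le_sqr N0) _; rewrite lerD2r.
apply: (@le_trans _ _ (\sum_(1 <= n < N) (Lambda' N n *
    \sum_(1 <= k < K.+1 | (k ^ 2 %| N - n)%N) mu k + L N *
   ((\sum_(K.+1 <= k < N.+1) (k ^ 2 %| N - n)%N%:R) * 2 ^+ size (primes (N - n)))))).
  apply: ler_sum_nat => n /andP[n0 nN].
  have mN : (0 < N - n <= N)%N by rewrite subn_gt0 nN leq_subr.
  have h1 : Lambda' N n <= L N.
    by apply: le_trans (coprime_mangoldt_le _ _) (vonMangoldt_le_slog (ltnW nN)).
  have h2 := le_trans (ler_norm _) (@moebius_sqr_trunc R _ _ _ mN KN).
  rewrite -lerBlDl -mulrBr.
  apply: (@le_trans _ _ (Lambda' N n * \sum_(K.+1 <= k < N.+1) (k ^ 2 %| N - n)%N%:R)).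
    by rewrite ler_wpM2l ?coprime_mangoldt_ge0.
  have t0 : 0 <= \sum_(K.+1 <= k < N.+1) (k ^ 2 %| N - n)%N%:R :> R.
    by apply: sumr_ge0.
  apply: ler_pM; rewrite ?coprime_mangoldt_ge0 // ler_peMr //.
  by rewrite exprn_ege1 // ler1n.
rewrite big_split /= -mulr_sumr; apply: lerD; last first.
  apply: le_trans (ler_wpM2l l0 (sum_weighted_square_tail N0 KN)) _.
  by rewrite le_eqVlt; apply/orP; left; apply/eqP; ring.
rewrite sum_squarefree_progression.
have sqr_sum : \sum_(1 <= k < K.+1) Delta (k ^ 2)%N <= \sum_(1 <= q < (K ^ 2).+1) Delta q.
  elim: (K) => [|j IH]; first by rewrite !big_geq.
  have jj : (j ^ 2 < j.+1 ^ 2)%N by rewrite ltn_exp2r.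
  rewrite big_nat_recr //= [leRHS]big_nat_recr ?expn_gt0 //=; rewrite lerD2r.
  apply: le_trans IH _; rewrite [leRHS](big_cat_nat (n := (j ^ 2).+1)) //= lerDl.
  exact: sumr_ge0.
have -> : K%:R * (2 * L N ^+ 2) = \sum_(1 <= k < K.+1) 2 * L N ^+ 2.
  by rewrite sumr_const_nat subn1 mulr_natl.
rewrite -addrA; apply: le_trans (lerD (lexx _) (lerD sqr_sum (lexx _))).
rewrite -big_split /= mulr_sumr -lerBlDl -sumrB.
apply: le_trans (ler_norm _) (le_trans (ler_norm_sum _ _ _) _).
rewrite big_mkcond; apply: ler_sum_nat => k /andP[k0 _].
have d0 : 0 <= Delta (k ^ 2)%N + 2 * L N ^+ 2.
  by apply: addr_ge0 => //; apply: mulr_ge0 => //; exact: sqr_ge0.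
case: ifP => // cN.
have cN2 : coprime (k ^ 2) N by rewrite coprimeXl.
have -> : mu k * coprime_progression N (k ^ 2) - N.-1%:R * (mu k / (k%:R * (totient k)%:R)) =
   mu k * (coprime_progression N (k ^ 2) - N.-1%:R / (totient (k ^ 2))%:R).
  by rewrite totient_sqr // natrM; move: (k%:R * _)^-1 => z; ring.
rewrite normrM; apply: le_trans (ler_pM _ _ (normr_moebius_le1 _)
  (coprime_progression_approx N1 cN2 (HD _ cN2))) _ => //.
by rewrite mul1r.
Qed.

Lemma normr_calA_le : exists2 M : R, 0 <= M &
  forall N, (0 < N)%N -> ~~ odd N -> `|calA N| <= M.
Proof.
have [M M0 HM] := @calA_tail R.
exists (1 + M); first exact: addr_ge0.
move=> N N0 eN; have := HM N 1%N N0 eN isT.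
have tt1 : totient 1 = 1%N by [].
rewrite big_mkcond big_nat1 coprime1n tt1 moebius1 mulr1 divr1.
rewrite /isqrt sqrtr1 invr1 mulr1 distrC => h.
by have := ler_normD (calA N - 1 : R) 1; rewrite subrK normr1 addrC => /le_trans; apply; rewrite lerD2l.
Qed.

(** With moduli [k ^ 2] only, the truncation can go up to [K] near [N ^ (theta / 2)] and saves a
    power; by [calA_tail] the truncated series then differs from [calA N] by [O(K ^ (-1/2))]. *)
Lemma mangoldt_moebius_upper (A theta C : R) : 0 < theta -> theta < 1 -> 0 <= C ->
  EH theta C ->
  exists2 M : R, 0 <= M & \forall N \near \oo, ~~ odd N ->
    `|mangoldt_moebius N| <= calA N * N%:R + M * log_error A N.
Proof.
move=> t0 t1 C0 hEH.
have t2 : 0 < theta / 2 by rewrite divr_gt0.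
have t1' : 0 < 1 - theta by rewrite subr_gt0.
have t21 : theta / 2 < 1 by lra.
have [b Ab] := exponent_exists A.
have hb : A + 0%:R <= b%:R by rewrite addr0.
have [Q Q0 HQ] := @normr_calA_le.
have [T T0 HT] := @calA_tail R.
have [M M0 HM] := EH_log_saving b hEH.
have [V V0 HV] := @isqrt_le_slog R b.
have [j Hj] := near_powfloor_exp t2.
have TV : 0 <= T * (V * j.+1%:R ^+ b).
  by rewrite mulr_ge0 // mulr_ge0 ?exprn_ge0 // ltW.
have [G G0 HG] := log_boundedD (log_boundedD (log_boundedD (log_boundedD (log_boundedD
  (log_boundedZ Q0 (@log_bounded_pow R A 0 1 ltr01))
  (log_boundedZ TV (log_bounded_log hb)))
  (log_boundedZ M0 (log_bounded_log hb)))
  (log_boundedZ (ler0n R 2) (@log_bounded_pow R A 2 _ t1')))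
  (log_boundedZ (ler0n R 2) (@log_bounded_pow R A 3 _ t2)))
  (log_boundedZ (ler0n R 2) (@log_bounded_pow R A 2 1 ltr01)).
exists G => //; near=> N => eN.
have N4 : (4 <= N)%N by near: N; exists 4%N.
have N1 : (1 < N)%N by exact: leq_trans N4.
have N0 : 0 < N%:R :> R by rewrite ltr0n ltnW.
have N1' : 1 <= N%:R :> R by rewrite ler1n ltnW.
have KN : (powfloor (theta / 2) N <= N)%N by near: N; exact: near_powfloor_le.
have K15 : (15 < powfloor (theta / 2) N)%N by near: N; exact: near_powfloor_ge.
have NK : (N <= powfloor (theta / 2) N ^ j)%N by near: N.
have KP := powfloor_le (theta / 2) N; have KQ := powfloor_gt (theta / 2) N.
set K := powfloor _ N in KN K15 NK KP KQ.
have [Delta [D0 D1 D2]] := HM N N1.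
have D1' q : coprime q N ->
  `|\sum_(1 <= n < N.-1.+1 | n == N %[mod q]) vonMangoldt n -
    N.-1%:R / (totient q)%:R| <= Delta q.
  move=> cqN; apply: D1; last by rewrite coprime_sym.
  by rewrite -subn1 subn_gt0 N1 leq_subr.
apply: le_trans (mangoldt_moebius_le N1 KN D0 D1') _.
have hG := near HG N.
apply: (@le_trans _ _ (calA N * N%:R + _)); last by rewrite lerD2l; exact: hG.
have l0 := @slog_gt0 R N; have lK := @slog_gt0 R K.
rewrite !addrA; apply: lerD; last by rewrite subrr powRr0 mul1r.
apply: lerD; last first.
  have e : N%:R = N%:R `^ (1 - theta / 2) * N%:R `^ (theta / 2) :> R.
    by rewrite -powRD ?subrK ?powRr1 ?(ltW N0) //; apply/implyP => _; rewrite gt_eqF.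
  rewrite ler_pdivrMr ?ltr0Sn //; move: KQ; move: (K.+1%:R : R) => z KQ.
  rewrite {1}e; move: (N%:R `^ (1 - theta / 2)) (powR_ge0 (N%:R : R) (1 - theta / 2)) => p p0.
  have -> : 2 * (p * N%:R `^ (theta / 2)) * L N ^+ 3 =
    2 * (p * L N ^+ 3) * N%:R `^ (theta / 2) by ring.
  by rewrite ler_wpM2l ?(ltW KQ) // mulr_ge0 // mulr_ge0 // exprn_ge0 // ltW.
apply: lerD; last first.
  rewrite mulrCA ler_wpM2l // ler_wpM2r ?exprn_ge0 ?(ltW l0) //.
  by apply: le_trans KP _; rewrite ler_powR //; clear -t0; lra.
apply: lerD; last first.
  rewrite expr0 div1r; apply: D2; rewrite natrX.
  apply: (@le_trans _ _ (N%:R `^ theta)).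
    have -> : theta = theta / 2 * 2%:R by rewrite divfK.
    by rewrite powRrM powR_mulrn ?powR_ge0 // lerXn2r ?nnegrE ?powR_ge0.
  rewrite ler_peMr ?powR_ge0 // -[leLHS](powRr0 (ln N%:R)) ler_powR //.
  exact: ln_ge1.
rewrite subrr powRr0 mul1r expr0 mulr1 div1r.
have h1 := HT N K (ltnW N1) eN (leq_ltn_trans (leq0n 15) K15).
set F := \sum_(1 <= k < K.+1 | coprime k N) _ in h1 *.
have h2 : isqrt K <= V * j.+1%:R ^+ b / L N ^+ b.
  apply: le_trans (HV K K _ _) _; [exact: leq_ltn_trans K15|by rewrite -{1}(expn1 K) leq_pexp2l // (leq_ltn_trans _ K15)|].
  rewrite -mulrA ler_wpM2l ?(ltW V0) // ler_pdivlMr ?exprn_gt0 // mulrC ler_pdivrMr ?exprn_gt0 // -exprMn.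
  by rewrite lerXn2r ?nnegrE ?mulr_ge0 ?(ltW l0) ?(ltW lK) // slog_le_exp.
have h3 : F <= calA N + T * (V * j.+1%:R ^+ b / L N ^+ b).
  rewrite -lerBlDl; apply: le_trans (ler_norm _) (le_trans h1 _).
  by rewrite ler_wpM2l.
have h4 := HQ N (ltnW N1) eN.
have h5 : N%:R = N.-1%:R + 1 :> R by rewrite natr1 prednK // ltnW.
apply: le_trans (ler_wpM2l (ler0n R N.-1) h3) _.
rewrite mulrDr; apply: lerD.
  rewrite h5 mulrDr mulr1 [leLHS]mulrC -addrA lerDl.
  by have := ler_norm (- calA N : R); rewrite normrN; move: h4; clear; lra.
apply: (@le_trans _ _ (N%:R * (T * (V * j.+1%:R ^+ b / L N ^+ b)))).
  rewrite ler_wpM2r ?ler_nat ?leq_pred // mulr_ge0 // divr_ge0 ?exprn_ge0 ?(ltW l0) //.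
  by rewrite mulr_ge0 ?exprn_ge0 ?(ltW V0).
rewrite le_eqVlt; apply/orP; left; apply/eqP.
by move: (L N ^+ b)^-1 (j.+1%:R ^+ b) => u v; ring.
Unshelve. all: by end_near. Qed.

End MangoldtMoebius.

(** * The lower bound and the equivalence *)

Section Conclusion.
Context {R : realType}.
Local Notation L := (@slog R).

Lemma near_slog_ge (x : R) : \forall N \near \oo, x <= L N.
Proof.
exists (Num.truncn (expR x)).+1 => // N /= hN.
apply: le_trans (ln_le_slog N); rewrite -(expRK x) ler_ln ?posrE ?expR_gt0 //.
  by apply: le_trans (ltW (truncnS_gt _)) _; rewrite ler_nat.
by rewrite ltr0n; exact: leq_trans hN.
Qed.

Lemma near_log_error_le (A C eps : R) : 0 < A -> 0 <= C -> 0 < eps ->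
  \forall N \near \oo, C * log_error A N <= eps * N%:R.
Proof.
move=> A0 C0 e0; near=> N; rewrite /log_error mulrCA mulrC ler_wpM2r //.
have h : (C / eps) `^ A^-1 <= L N by near: N; exact: near_slog_ge.
rewrite ler_pdivrMr ?powR_gt0 ?slog_gt0 // mulrC -ler_pdivrMr //.
have c0 : 0 <= C / eps by rewrite divr_ge0 // ltW.
rewrite -[leLHS](powRr1 c0) -(@mulVf _ A) ?gt_eqF // powRrM.
by apply: ge0_ler_powR; rewrite ?nnegrE ?powR_ge0 ?slog_ge0 // ltW.
Unshelve. all: by end_near. Qed.

(** In the lower bound [mangoldt_moebius N] is multiplied by the singular series, known to be
    [O(L N)]; an estimate with exponent [A + 1] absorbs that factor. *)
Lemma slog_log_error (A : R) N : L N * log_error (A + 1) N = log_error A N.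
Proof.
have l0 := @slog_gt0 R N; have p0 := powR_gt0 A l0.
rewrite /log_error powRD; last by apply/implyP => _; rewrite gt_eqF.
by rewrite powRr1 ?(ltW l0) //; field; rewrite !gt_eqF.
Qed.

Lemma log_error_le (A : R) N : 0 < A -> (1 < N)%N -> log_error A N <= N%:R / ln N%:R `^ A.
Proof.
move=> A0 N1; have ln0 : 0 < (ln N%:R : R) by rewrite ln_gt0 // ltr1n.
rewrite ler_wpM2l // lef_pV2 ?posrE ?powR_gt0 ?slog_gt0 //.
by apply: ge0_ler_powR; rewrite ?nnegrE ?ln_nat_ge0 ?slog_ge0 ?ln_le_slog // ltW.
Qed.

Lemma even_gt1 N : (0 < N)%N -> ~~ odd N -> (1 < N)%N.
Proof. by case: N => [|[|N]]. Qed.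

Variables (A theta : R).
Hypotheses (A_gt0 : 0 < A) (theta_gt0 : 0 < theta) (theta_lt1 : theta < 1).
Hypotheses (hEH : EH theta (2 * A + 8)) (hEHmu : EHmu (1 - theta)).

Lemma goldbach_singular_asymp : exists2 C : R, 0 <= C &
  \forall N \near \oo, ~~ odd N ->
    `|goldbach_r N - singular_series N * (N%:R - mangoldt_moebius N)| <= C * log_error A N.
Proof.
have c0 : 0 <= 2 * A + 8 by rewrite addr_ge0 // mulr_ge0 // ltW.
have pnt : PNT R by exact: EH_prime_number_theorem theta_gt0 c0 hEH.
have [C C0 HC] := goldbach_asymp A_gt0 theta_gt0 theta_lt1 pnt hEH hEHmu.
exists C => //; near=> N => eN; have N0 : (0 < N)%N by near: N; exists 1%N.
by rewrite (@singular_seriesE R N N0 eN).1; near: N.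
Unshelve. all: by end_near. Qed.

Lemma goldbach_lower_bound : exists (K : R) (E : nat -> R), forall N : nat, (0 < N)%N -> ~~ odd N ->
  `|E N| <= K * (N%:R / ln N%:R `^ A) /\
  singular_series N * (1 - calA N) * N%:R + E N <= goldbach_r N.
Proof.
have [C C0 [n1 _ HC]] := goldbach_singular_asymp.
have [V V0 HV] := @singular_constant_le R.
have c0 : 0 <= 2 * A + 8 by rewrite addr_ge0 // mulr_ge0 // ltW.
have [M M0 [n2 _ HM]] := mangoldt_moebius_upper (A + 1) theta_gt0 theta_lt1 c0 hEH.
pose d N : R := goldbach_r N - singular_series N * (1 - calA N) * N%:R.
(* Cutting the difference off at 0 makes the inequality hold for every positive even [N], so that
   only the size of [E] is left to estimate. *)
pose E N : R := if (0 < N)%N && ~~ odd N then Num.min 0 (d N) else 0.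
(* [le_all_of_eventually] wants a positive majorant, while the quotient is 0 at [N = 1], where the
   logarithm vanishes. Positive even [N] exceed 1, so the value 1 never reaches the result. *)
pose b N : R := if (1 < N)%N then N%:R / ln N%:R `^ A else 1.
have [] := @le_all_of_eventually R (fun N => `|E N|) b (maxn n1 n2).
- move=> N N0; rewrite /b; case: ifP => // N1.
  by rewrite divr_gt0 ?ltr0n // powR_gt0 // ln_gt0 // ltr1n.
- exists (V * M + C) => N; rewrite geq_max => /andP[Nn1 Nn2].
  have q0 : 0 <= V * M + C by rewrite addr_ge0 // mulr_ge0.
  have b0 : 0 <= b N by rewrite /b; case: ifP => // _; rewrite divr_ge0 ?powR_ge0.
  rewrite /E; case: ifP => [/andP[N0 eN]|_]; last by rewrite normr0 mulr_ge0.
  have N1 := even_gt1 N0 eN.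
  have [S_eq S1] := @singular_seriesE R N N0 eN.
  have S0 : 0 <= singular_series N :> R by exact: le_trans S1.
  have h1 := HC N Nn1 eN; have h2 := HM N Nn2 eN.
  have hS : singular_series N <= V * L N by rewrite S_eq (le_trans (ler_norm _)) ?HV.
  have e1 : singular_series N * (M * log_error (A + 1) N) <= V * M * log_error A N.
    rewrite -(slog_log_error A N); apply: le_trans (ler_wpM2r (mulr_ge0 M0 (log_error_ge0 (A + 1) N)) hS) _.
    by rewrite le_eqVlt; apply/orP; left; apply/eqP; ring.
  have h3 := ler_wpM2l S0 (le_trans (ler_norm (mangoldt_moebius N)) h2).
  have h4 : - ((V * M + C) * log_error A N) <= d N.
    rewrite /d; move: h1; rewrite ler_norml => /andP[h1 _].
    move: h1 h3 e1.
    move: (singular_series N) (mangoldt_moebius N) (calA N) (log_error A N)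
      (log_error (A + 1) N) (goldbach_r N) (N%:R : R) => s m a e e' r n.
    by lra.
  have h5 : 0 <= (V * M + C) * log_error A N by rewrite mulr_ge0 // log_error_ge0.
  apply: (@le_trans _ _ ((V * M + C) * log_error A N)).
    rewrite ler_norml; apply/andP; split.
      by rewrite le_min h4 oppr_le0 h5.
    by rewrite ge_min h5.
  by rewrite ler_wpM2l // /b N1 log_error_le.
- move=> K HK; exists K, E => N N0 eN; have N1 := even_gt1 N0 eN; split.
    by have := HK N N0; rewrite /b N1.
  by rewrite /E N0 eN /= addrC -lerBrDr ge_min /d lexx orbT.
Qed.

(** By [goldbach_singular_asymp], [goldbach_r N - S * N] and [- S * mangoldt_moebius N] agree up to
    [o(N)], [S] being the singular series. As [S >= 1], this error is also small against [S * N],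
    and [S] can be divided out whatever its growth. *)
Lemma goldbach_equivalence :
  (@goldbach_r R ~_even_oo (fun N => singular_series N * N%:R)) <->
  (@mangoldt_moebius R =o_even_oo (fun N => N%:R : R)).
Proof.
have [C C0 HC] := goldbach_singular_asymp.
rewrite eqaddoP eqoP; split => H eps e0; have e2 : 0 < eps / 2 by rewrite divr_gt0.
- have {}H : \forall N \near \oo, ~~ odd N ->
    `|goldbach_r N - singular_series N * N%:R : R| <=
    eps / 2 * `|singular_series N * N%:R : R| := H _ e2.
  have He := near_log_error_le A_gt0 C0 e2.
  (* Eventuality along [even_oo] unfolds to eventuality at [\oo] under the premise [~~ odd N]. *)
  change (\forall N \near \oo, ~~ odd N -> `|(mangoldt_moebius N : R)| <= eps * `|N%:R : R|).
  apply: filterS3 H HC (filterI He (nbhs_infty_gt 0)) => N h1 h2 [h3 N0] eN.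
  have {}h1 := h1 eN; have {}h2 := h2 eN.
  have [_ S1] := @singular_seriesE R N N0 eN.
  have S0 : 0 < singular_series N :> R by exact: lt_le_trans S1.
  rewrite (ger0_norm (ler0n _ N)) -(ler_pM2l S0).
  rewrite normrM (ger0_norm (ler0n _ N)) (ger0_norm (ltW S0)) in h1.
  have h4 := ler_wpM2r (mulr_ge0 (ltW e2) (ler0n R N)) S1.
  rewrite -{1}(ger0_norm (ltW S0)) -normrM.
  have -> : singular_series N * mangoldt_moebius N =
    (goldbach_r N - singular_series N * (N%:R - mangoldt_moebius N)) -
    (goldbach_r N - singular_series N * N%:R) :> R by ring.
  apply: le_trans (ler_normB _ _) _; apply: le_trans (lerD h2 h1) _.
  move: h3 h4; rewrite mul1r; move: (singular_series N) (_ * log_error A N) (N%:R : R) => s x n.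
  by lra.
- have {}H : \forall N \near \oo, ~~ odd N ->
    `|(mangoldt_moebius N : R)| <= eps / 2 * `|N%:R : R| := H _ e2.
  have He := near_log_error_le A_gt0 C0 e2.
  change (\forall N \near \oo, ~~ odd N ->
    `|goldbach_r N - singular_series N * N%:R : R| <=
    eps * `|singular_series N * N%:R : R|).
  apply: filterS3 H HC (filterI He (nbhs_infty_gt 0)) => N h1 h2 [h3 N0] eN.
  have {}h1 := h1 eN; have {}h2 := h2 eN.
  have [_ S1] := @singular_seriesE R N N0 eN.
  have S0 : 0 < singular_series N :> R by exact: lt_le_trans S1.
  rewrite normrM (ger0_norm (ler0n _ N)) (ger0_norm (ltW S0)).
  rewrite (ger0_norm (ler0n _ N)) in h1.
  have h4 := ler_wpM2r (mulr_ge0 (ltW e2) (ler0n R N)) S1.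
  have h5 := ler_wpM2l (ltW S0) h1.
  have -> : goldbach_r N - singular_series N * N%:R =
    (goldbach_r N - singular_series N * (N%:R - mangoldt_moebius N)) -
    singular_series N * mangoldt_moebius N :> R by ring.
  apply: le_trans (ler_normB _ _) _; rewrite normrM (ger0_norm (ltW S0)).
  apply: le_trans (lerD h2 h5) _.
  move: h3 h4; rewrite mul1r; move: (singular_series N) (_ * log_error A N) (N%:R : R) => s x n.
  by lra.
Qed.

End Conclusion.

Theorem theorem1 (R : realType) (A theta : R)
    (A_gt0 : 0 < A) (theta_gt0 : 0 < theta) (theta_lt1 : theta < 1)
    (hEH : EH theta (2 * A + 8)) (hEHmu : EHmu (1 - theta)) :
  (exists (K : R) (E : nat -> R), forall N : nat, (0 < N)%N -> ~~ odd N ->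
     `|E N| <= K * (N%:R / ln N%:R `^ A) /\
     singular_series N * (1 - calA N) * N%:R + E N <= goldbach_r N) /\
  ((@goldbach_r R ~_even_oo (fun N => singular_series N * N%:R)) <->
   (@mangoldt_moebius R =o_even_oo (fun N => N%:R : R))).
Proof.
split; [exact: goldbach_lower_bound hEH hEHmu | exact: goldbach_equivalence hEH hEHmu].
Qed.
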